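(* Let $R(z)=(J-z)^{-1}$. As an identity of sesquilinear forms on finitely supported vectors, $$R(x+i0)-R(x-i0)=\frac{i}{2a\sin\theta}\,\Psi_\theta\Psi_\theta^*,\qquad x=2a\cos\theta,$$ for every $\theta\in(0,\pi)\setminus\Theta_F$. Consequently $$P_{\mathrm{ac}}=\frac1{2\pi}\int_0^\pi\Psi_\theta\Psi_\theta^*\,d\theta .$$ If $\{\varphi_j\}_{j=1}^N$ is an orthonormal basis of the (finite-dimensional) pure point subspace of $J$, then $$I_{\mathscr H}=\sum_{j=1}^N\varphi_j\varphi_j^*+\frac1{2\pi}\int_0^\pi\Psi_\theta\Psi_\theta^*\,d\theta .$$ For finitely supported $f$ define $\widehat f_0(\theta)=\Psi_\theta^*f=(\langle f,\Psi_\theta e_c\rangle)_{c=1}^r\in\mathbb C^r$ (each pairing is a finite sum). Then $$P_{\mathrm{ac}}f=\frac1{2\pi}\int_0^\pi\Psi_\theta\widehat f_0(\theta)\,d\theta,\qquad \|P_{\mathrm{ac}}f\|^2=\frac1{2\pi}\int_0^\pi\|\widehat f_0(\theta)\|_{\mathbb C^r}^2\,d\theta ,$$ and in particular $$\|f\|^2=\sum_{j=1}^N|\langle f,\varphi_j\rangle|^2+\frac1{2\pi}\int_0^\pi\|\widehat f_0(\theta)\|_{\mathbb C^r}^2\,d\theta .$$ The vector-valued integral for $P_{\mathrm{ac}}f$ is understood as a weak integral.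
   Context: Let $q$ be a prime power, $a=\sqrt q$, $d,r\ge1$ integers, $H_C=H_C^*$ a complex $d\times d$ matrix, and $V:\mathbb C^r\to\mathbb C^d$ linear. Let $\mathscr H=\mathbb C^d\oplus\bigoplus_{c=1}^r\ell^2(\mathbb N)$, $\mathbb N=\{1,2,\dots\}$; write elements as $(u,g)$ with $g(n)=(g_1(n),\dots,g_r(n))^t\in\mathbb C^r$. The bounded self-adjoint operator $J$ is $J(u,g)=(H_Cu+Vg(1),\,h)$, where $h(1)=a\,g(2)+V^*u$ and $h(n)=a\{g(n-1)+g(n+1)\}$ for $n\ge2$. The same formula defines $J$ on arbitrary (not necessarily square-summable) pairs $(u,g)$; solutions of $Jf=xf$ there are called generalized eigenfunctions. For $\zeta\in\mathbb C^\times$ put $x(\zeta)=a(\zeta+\zeta^{-1})$, $$F(\zeta)=H_C-x(\zeta)I_d+\frac{\zeta^{-1}}{a}VV^*,\qquad S(\zeta)=-I_r+\frac{\zeta^{-1}-\zeta}{a}V^*F(\zeta)^{-1}V,$$ and for $\alpha\in\mathbb C^r$ $$\Psi(\zeta)\alpha=\Bigl((\zeta^{-1}-\zeta)F(\zeta)^{-1}V\alpha,\ \bigl(\zeta^n\alpha+\zeta^{-n}S(\zeta)\alpha\bigr)_{n\ge1}\Bigr),$$ a generalized eigenfunction of $J$ with eigenvalue $x(\zeta)$. Let $\Theta_F=\{\theta\in(0,\pi):\det F(e^{i\theta})=0\}$, a finite set, and $\Psi_\theta=\Psi(e^{i\theta})$ for $\theta\in(0,\pi)\setminus\Theta_F$;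 on $\Theta_F$ arbitrary measurable values are assigned. $P_{\mathrm{ac}}$ is the absolutely continuous spectral projection of $J$; $e_c$ is the $c$-th standard vector of $\mathbb C^r$. Inner products are linear in the first variable, and for vectors or generalized eigenfunctions $v,w$, $vw^*$ denotes $f\mapsto\langle f,w\rangle v$; thus $\Psi_\theta\Psi_\theta^*=\sum_{c=1}^r(\Psi_\theta e_c)(\Psi_\theta e_c)^*$. Operator identities involving generalized eigenfunctions are understood as sesquilinear-form (weak) identities on finitely supported vectors, extended by density; $R(x\pm i0)$ denotes boundary values of the forms $\langle R(x\pm i\varepsilon)f,g\rangle$ as $\varepsilon\downarrow0$. *)

(* Defs.v *)
From HB Require Import structures.
From mathcomp Require Import all_boot all_order all_algebra.
From mathcomp Require Import complex.
From mathcomp Require Import all_classical all_reals all_analysis.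

Set Implicit Arguments.
Unset Strict Implicit.
Unset Printing Implicit Defensive.

Import Order.TTheory GRing.Theory Num.Theory.
Import numFieldNormedType.Exports.

Local Open Scope classical_set_scope.
Local Open Scope ring_scope.
Local Open Scope complex_scope.
Local Open Scope sesquilinear_scope.

Section Space.
Variables (R : realType) (d r : nat).

(* Arbitrary pairs (u, g).  The index of g is shifted by one:
   [f.2 n] is the vector g(n + 1) of C^r. *)
Definition state := ('cV[R[i]]_d * (nat -> 'cV[R[i]]_r))%type.

Definition dotc (m : nat) (v w : 'cV[R[i]]_m) : R[i] :=
  \sum_i v i 0 * (w i 0)^*.

Definition vsqnorm (m : nat) (v : 'cV[R[i]]_m) : R :=
  \sum_i Normc.normc (v i 0) ^+ 2.

Definition inH (f : state) : Prop :=
  cvgn (series (fun n => vsqnorm (f.2 n))).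

Definition finsupp (f : state) : Prop :=
  exists N : nat, forall n, (N <= n)%N -> f.2 n = 0.

(* Linear in the first variable.  The same formula is the inner product of
   two elements of H and the pairing of a finitely supported vector with an
   arbitrary pair; in the latter case the series is a finite sum.  Limits of
   complex numbers are taken in [R[i]^o], which carries the norm topology. *)
Definition ip (f g : state) : R[i] :=
  dotc f.1 g.1 + limn (series (fun n => dotc (f.2 n) (g.2 n) : R[i]^o)).

Definition sqnormH (f : state) : R := complex.Re (ip f f).

Definition cvgH (fs : nat -> state) (f : state) : Prop :=
  sqnormH (fs k - f) @[k --> \oo] --> (0 : R).

(* The rank one form of v w^* : h |-> <h, w> v, tested against g. *)
Definition rank1_form (v w f g : state) : R[i] := ip f w * ip v g.

Definition is_orth_proj_on (M : state -> Prop) (f p : state) : Prop :=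
  M p /\ forall h, M h -> ip (f - p) h = 0.

(* The orthogonal projection onto the closed subspace M of H. *)
Definition orth_proj (M : state -> Prop) (f : state) : state :=
  xget 0 [set p | is_orth_proj_on M f p].

Definition is_onb (M : state -> Prop) (N : nat) (phi : 'I_N -> state) : Prop :=
  [/\ forall j, M (phi j),
      forall j k, ip (phi j) (phi k) = (j == k)%:R
    & forall f, M f -> f = \sum_j ip f (phi j) *: phi j].

(* The operator T is given by the form B on finitely supported vectors,
   and on all of H by extending B by density. *)
Definition weak_op_eq (T : state -> state) (B : state -> state -> R[i]) :
    Prop :=
  (forall f g, finsupp f -> finsupp g -> ip (T f) g = B f g) /\
  (forall (f g : state) (fs gs : nat -> state),
     inH f -> inH g ->
     (forall k, finsupp (fs k)) -> (forall k, finsupp (gs k)) ->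
     cvgH fs f -> cvgH gs g ->
     B (fs k) (gs k) @[k --> \oo] --> (ip (T f) g : R[i]^o)).

End Space.

Section IntegralOverAngles.
Variable R : realType.

Definition angles : set R := `]0, pi[%classic.

Definition Cintegrable (h : R -> R[i]) : Prop :=
  (@lebesgue_measure R).-integrable angles
    (fun t => (complex.Re (h t))%:E) /\
  (@lebesgue_measure R).-integrable angles
    (fun t => (complex.Im (h t))%:E).

Definition Cintegral (h : R -> R[i]) : R[i] :=
  Rintegral (@lebesgue_measure R) angles (fun t => complex.Re (h t)) +i*
  Rintegral (@lebesgue_measure R) angles (fun t => complex.Im (h t)).

End IntegralOverAngles.

Section Jacobi.
Variables (R : realType) (q d r : nat).
Variables (HC : 'M[R[i]]_d) (V : 'M[R[i]]_(d, r)).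

Let state := state R d r.

Definition ahop : R := Num.sqrt q%:R.

Definition Jop (f : state) : state :=
  (HC *m f.1 + V *m f.2 0%N,
   fun n => if n is m.+1 then ahop%:C *: (f.2 m + f.2 m.+2)
            else ahop%:C *: f.2 1%N + V^t* *m f.1).

Definition resolvent (z : R[i]) (f : state) : state :=
  xget 0 [set h | inH h /\ Jop h - z *: h = f].

Definition polyJ (p : {poly R}) (f : state) : state :=
  \sum_(i < size p) (p`_i)%:C *: iter i Jop f.

(* The spectral measure of f for the bounded self-adjoint operator J, given by
   the functional calculus: it has compact support, and
   <p(J) f, f> = \int p dmu for polynomials p, which are dense in the
   continuous functions on the spectrum. *)
Definition is_spectral_measure
    (mu : {finite_measure set (measurableTypeR R) -> \bar R}) (f : state) :
    Prop :=
  (exists M : R, mu (~` `[- M, M]%classic) = 0%E) /\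
  (forall p : {poly R},
     ip (polyJ p f) f =
     (Rintegral mu [set: R] (fun x : R => p.[x]))%:C).

Definition Hac (f : state) : Prop :=
  inH f /\
  exists mu : {finite_measure set (measurableTypeR R) -> \bar R},
    is_spectral_measure mu f /\ mu `<< (@lebesgue_measure R).

Definition Pac : state -> state := orth_proj Hac.

Definition is_eigenvector (psi : state) : Prop :=
  [/\ inH psi, psi <> 0 & exists x : R[i], Jop psi = x *: psi].

(* The closed linear span of the eigenvectors. *)
Definition Hpp (f : state) : Prop :=
  inH f /\
  forall e : R, 0 < e ->
    exists (n : nat) (c : 'I_n -> R[i]) (psi : 'I_n -> state),
      (forall k, is_eigenvector (psi k)) /\
      sqnormH (f - \sum_k c k *: psi k) < e.

Definition xspec (zeta : R[i]) : R[i] := ahop%:C * (zeta + zeta^-1).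

Definition Fmx (zeta : R[i]) : 'M[R[i]]_d :=
  HC - (xspec zeta)%:M + (zeta^-1 / ahop%:C) *: (V *m V^t*).

Definition Smx (zeta : R[i]) : 'M[R[i]]_r :=
  - 1%:M + ((zeta^-1 - zeta) / ahop%:C) *: (V^t* *m invmx (Fmx zeta) *m V).

Definition Psi (zeta : R[i]) (alpha : 'cV[R[i]]_r) : state :=
  ((zeta^-1 - zeta) *: (invmx (Fmx zeta) *m V *m alpha),
   fun n => zeta ^+ n.+1 *: alpha + zeta ^- n.+1 *: (Smx zeta *m alpha)).

Definition expi (t : R) : R[i] := cos t +i* sin t.

Definition ThetaF : set R :=
  [set t | angles t /\ \det (Fmx (expi t)) = 0].

(* [W] supplies the arbitrary values on the finite set ThetaF; a function
   modified on a finite set stays measurable, so no condition on W is needed. *)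
Definition Psith (W : R -> {linear 'cV[R[i]]_r -> state}) (t : R)
    (alpha : 'cV[R[i]]_r) : state :=
  if `[< ThetaF t >] then W t alpha else Psi (expi t) alpha.

Section Expansion.
Variable W : R -> {linear 'cV[R[i]]_r -> state}.

Definition evec (c : 'I_r) : 'cV[R[i]]_r := delta_mx c 0.

Definition PsiPsi_form (t : R) (f g : state) : R[i] :=
  \sum_(c < r) rank1_form (Psith W t (evec c)) (Psith W t (evec c)) f g.

Definition fhat (f : state) (t : R) : 'cV[R[i]]_r :=
  \col_c ip f (Psith W t (evec c)).

Definition cont_form (f g : state) : R[i] :=
  ((2 * pi)^-1)%:C * Cintegral (fun t => PsiPsi_form t f g).

End Expansion.

End Jacobi.

(* Main.v *)
Require Import Defs.
From HB Require Import structures.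
From mathcomp Require Import all_boot all_order all_algebra.
From mathcomp Require Import complex.
From mathcomp Require Import all_classical all_reals all_analysis.
From mathcomp Require Import measurable_realfun.
From mathcomp Require Import ring lra zify.

Set Implicit Arguments.
Unset Strict Implicit.
Unset Printing Implicit Defensive.

Import Order.TTheory GRing.Theory Num.Theory.
Import numFieldNormedType.Exports.

Local Open Scope classical_set_scope.
Local Open Scope ring_scope.
Local Open Scope complex_scope.
Local Open Scope sesquilinear_scope.

(** The resolvent acts explicitly on vectors supported near the centre: away from the centre its
    value is the decaying free solution [eta^-n alpha], where [eta + 1/eta = z/a] and [|eta| > 1],
    and the central component is obtained by inverting [F(eta)]. Letting [eta] tend to [e^{it}]
    gives the jump formula for such vectors, and these generate all finitely supported vectors
    under polynomials in [J].

    Let [Q] be the form [(2 pi)^-1 \int Psi Psi^*] on finitely supported vectors. It is bounded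
    because [S] is unitary and [(1/z - z) F(z)^-1 V] is bounded on the circle, and [J] is symmetric
    for it. So [<f, g> - Q f g = <P f, g>] with [P] commuting with [J]. Multiplying by the Laurent
    polynomial [det F] removes the poles of [S], and comparing Fourier coefficients shows that [P]
    has finite rank; its range is then spanned by eigenvectors. Polynomials in [J] peaking at an
    eigenvalue show that [f - P f] is orthogonal to every eigenvector. Hence [P] is the orthogonal
    projection onto the pure point subspace.

    By the same peaking polynomials every absolutely continuous vector is orthogonal to the
    eigenvectors. Conversely the spectral measure of [f - P f] is the image of
    [(2 pi)^-1 |fhat|^2 dt] under [t |-> 2 a cos t], first for finitely supported [f] and then,
    by convergence of the densities in L^1, for all [f]; this image is absolutely continuous.
    Hence [Pac = 1 - P], and every identity of the theorem is one about [Q]. *)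

(** * Complex limits, vectors and the inner product *)

(** The angles cover half of the circle only, so a Fourier coefficient can be read off just from a
    sum h(z) + h(1/z). The identities S(1/z) = S(z)^* = S(z)^-1 on the circle put the pairings that
    occur into this shape. Off the finite set where F is singular, S and F^-1 V are Laurent
    polynomials divided by det F; this gives measurability, whereas the bound on S comes from
    unitarity.

    Nothing shows in advance that P is idempotent. This follows once f - P f is orthogonal to the
    range of P, and finite rank is what reduces J on that range to a Hermitian matrix. Orthogonality
    to an eigenvector for l holds because polynomials with p(l) = 1 fix it under p(J), while Q(p(J)
    f, p(J) f) is the integral of p(2 a cos t)^2 |fhat|^2 up to a constant, and 2 a cos t takes the
    value l at most once.

    The transform fhat is a finite sum and has no direct meaning for a general vector, and [Pac]
    refers to spectral measures of all vectors. This is why densities must be passed to the limit in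
    L^1. *)

Section ComplexLimits.
Variable R : realType.
Local Notation C := R[i].
Local Notation normc := (@Normc.normc R).

Lemma normc_ge0 (z : C) : 0 <= normc z.
Proof. by case: z => x y; rewrite /= sqrtr_ge0. Qed.

Lemma normC_E (z : C) : `|z| = (normc z)%:C.
Proof. by []. Qed.

Lemma normc_real (x : R) : normc x%:C = `|x|.
Proof. by rewrite /= expr0n addr0 sqrtr_sqr. Qed.

Lemma normc_conj (z : C) : normc z^* = normc z.
Proof. by case: z => x y /=; rewrite sqrrN. Qed.

Lemma normcD (z w : C) : normc (z + w) <= normc z + normc w.
Proof. by rewrite -lecR; have := ler_normD z w; rewrite !normC_E -!rmorphD. Qed.

Lemma normcB (z w : C) : normc (z - w) = normc (w - z).
Proof. by have /complexI := distrC z w. Qed.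

Lemma sqr_normcE (z : C) : normc z ^+ 2 = complex.Re z ^+ 2 + complex.Im z ^+ 2.
Proof. by case: z => x y /=; rewrite sqr_sqrtr ?addr_ge0 ?sqr_ge0. Qed.

Lemma mulcJ (z : C) : z * z^* = (normc z ^+ 2)%:C.
Proof.
by case: z => x y; rewrite sqr_normcE /=; apply/eqP; rewrite eq_complex /=; apply/andP; split; apply/eqP; ring.
Qed.

Lemma Re_le_normc (z : C) : `|complex.Re z| <= normc z.
Proof. by rewrite -lecR; exact: normc_ge_Re. Qed.

Lemma Im_le_normc (z : C) : `|complex.Im z| <= normc z.
Proof.
rewrite -(@ler_pXn2r _ 2) // ?nnegrE ?normc_ge0 // sqr_normcE real_normK ?num_real //.
by rewrite lerDr sqr_ge0.
Qed.

Lemma normc_le_ReIm (z : C) : normc z <= `|complex.Re z| + `|complex.Im z|.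
Proof.
rewrite -(@ler_pXn2r _ 2) // ?nnegrE ?normc_ge0 ?addr_ge0 // sqr_normcE sqrrD.
rewrite !real_normK ?num_real // lerD2r lerDl mulrn_wge0 // mulr_ge0 //.
Qed.

(** The norm of [R[i]] is itself complex valued, so convergence in [R[i]^o] quantifies over complex
    radii. This is the bridge to real limits, where squeezing and monotonicity are usable. *)
Lemma cvgC_normc (T : Type) (F : set_system T) {FF : Filter F} (f : T -> C) (l : C) :
  (f x : C^o) @[x --> F] --> (l : C^o) <-> normc (f x - l) @[x --> F] --> (0 : R).
Proof.
split=> [/cvgrPdist_lt h|/cvgrPdist_lt h]; apply/cvgrPdist_lt.
  move=> e e0; have e0' : 0 < e%:C by rewrite ltcR.
  apply: filterS (h _ e0') => x; rewrite normC_E ltcR sub0r normrN normcB.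
  by rewrite ger0_norm ?normc_ge0.
move=> e e0; have eE : e = (complex.Re e)%:C by rewrite RRe_real // gtr0_real.
rewrite eE in e0 *; rewrite ltcR in e0.
apply: filterS (h _ e0) => x; rewrite normC_E ltcR sub0r normrN normcB.
by rewrite ger0_norm ?normc_ge0.
Qed.

Lemma cvgC_ReIm (T : Type) (F : set_system T) {FF : Filter F} (f : T -> C) (a b : R) :
  complex.Re (f x) @[x --> F] --> a -> complex.Im (f x) @[x --> F] --> b ->
  (f x : C^o) @[x --> F] --> (a +i* b : C^o).
Proof.
move=> ha hb; apply/cvgC_normc.
have h0 : `|complex.Re (f x) - a| + `|complex.Im (f x) - b| @[x --> F] --> (0:R).
  rewrite -[X in _ --> X](addr0 (0:R)); apply: cvgD.
    by rewrite -(@normr0 R R) -(subrr a); apply: cvg_norm; apply: cvgB => //; exact: cvg_cst.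
  by rewrite -(@normr0 R R) -(subrr b); apply: cvg_norm; apply: cvgB => //; exact: cvg_cst.
apply: (squeeze_cvgr _ (cvg_cst 0) h0).
apply: filterE => x; rewrite normc_ge0 /=; apply: (le_trans (normc_le_ReIm _)).
by case: (f x).
Qed.

Lemma cvgC_Re (T : Type) (F : set_system T) {FF : Filter F} (f : T -> C) (l : C) :
  (f x : C^o) @[x --> F] --> (l : C^o) -> complex.Re (f x) @[x --> F] --> complex.Re l.
Proof.
move/cvgC_normc/cvgrPdist_lt => h; apply/cvgrPdist_lt => e e0.
apply: filterS (h _ e0) => x; rewrite sub0r normrN ger0_norm ?normc_ge0 //.
apply: le_lt_trans; rewrite normcB; apply: le_trans (Re_le_normc _).
by case: (f x) => ? ?; case: (l).
Qed.

Lemma cvgC_Im (T : Type) (F : set_system T) {FF : Filter F} (f : T -> C) (l : C) :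
  (f x : C^o) @[x --> F] --> (l : C^o) -> complex.Im (f x) @[x --> F] --> complex.Im l.
Proof.
move/cvgC_normc/cvgrPdist_lt => h; apply/cvgrPdist_lt => e e0.
apply: filterS (h _ e0) => x; rewrite sub0r normrN ger0_norm ?normc_ge0 //.
apply: le_lt_trans; rewrite normcB; apply: le_trans (Im_le_normc _).
by case: (f x) => ? ?; case: (l).
Qed.

Lemma cvgC_conj (T : Type) (F : set_system T) {FF : Filter F} (f : T -> C) (l : C) :
  (f x : C^o) @[x --> F] --> (l : C^o) -> ((f x)^* : C^o) @[x --> F] --> (l^* : C^o).
Proof.
move=> h; have -> : l^* = complex.Re l +i* (- complex.Im l) by case: l h.
apply: cvgC_ReIm.
  have -> : (fun x => complex.Re (f x)^*) = (fun x => complex.Re (f x)).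
    by apply/funext => x; case: (f x).
  exact: cvgC_Re.
have -> : (fun x => complex.Im (f x)^*) = (fun x => - complex.Im (f x)).
  by apply/funext => x; case: (f x).
by apply: cvgN; exact: cvgC_Im.
Qed.

Lemma cvgC_real (T : Type) (F : set_system T) {FF : Filter F} (f : T -> R) (l : R) :
  f x @[x --> F] --> l -> ((f x)%:C : C^o) @[x --> F] --> (l%:C : C^o).
Proof. by move=> h; apply: cvgC_ReIm => //=; exact: cvg_cst. Qed.

Lemma cvgCD (T : Type) (F : set_system T) {FF : Filter F} (f g : T -> C) (k l : C) :
  (f x : C^o) @[x --> F] --> (k : C^o) -> (g x : C^o) @[x --> F] --> (l : C^o) ->
  (f x + g x : C^o) @[x --> F] --> (k + l : C^o).
Proof. exact: (@cvgD C C^o). Qed.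

Lemma cvgCB (T : Type) (F : set_system T) {FF : Filter F} (f g : T -> C) (k l : C) :
  (f x : C^o) @[x --> F] --> (k : C^o) -> (g x : C^o) @[x --> F] --> (l : C^o) ->
  (f x - g x : C^o) @[x --> F] --> (k - l : C^o).
Proof. exact: (@cvgB C C^o). Qed.

Lemma cvgCM (T : Type) (F : set_system T) {FF : Filter F} (f g : T -> C) (k l : C) :
  (f x : C^o) @[x --> F] --> (k : C^o) -> (g x : C^o) @[x --> F] --> (l : C^o) ->
  (f x * g x : C^o) @[x --> F] --> (k * l : C^o).
Proof. exact: (@cvgM C). Qed.

Lemma cvgC_sum (T : Type) (F : set_system T) {FF : Filter F} (I : Type) (s : seq I)
    (f : I -> T -> C) (l : I -> C) :
  (forall i, (f i x : C^o) @[x --> F] --> (l i : C^o)) ->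
  (\sum_(i <- s) f i x : C^o) @[x --> F] --> (\sum_(i <- s) l i : C^o).
Proof.
move=> h; elim: s => [|i s ih].
  have -> : (fun x => \sum_(j <- [::]) f j x) = cst (0 : C) by apply/funext => x; rewrite big_nil.
  by rewrite big_nil; exact: cvg_cst.
have -> : (fun x => \sum_(j <- i :: s) f j x) = (fun x => f i x + \sum_(j <- s) f j x).
  by apply/funext => x; rewrite big_cons.
rewrite big_cons; exact: (cvgCD (h i) ih).
Qed.

Lemma cvgC_unique (T : Type) (F : set_system T) {FF : ProperFilter F} (f : T -> C) (k l : C) :
  (f x : C^o) @[x --> F] --> (k : C^o) -> (f x : C^o) @[x --> F] --> (l : C^o) -> k = l.
Proof. by move=> h1 h2; exact: (cvg_unique (@norm_hausdorff _ _) h1 h2). Qed.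

Lemma Re_sum I (s : seq I) (P : pred I) (F : I -> C) :
  complex.Re (\sum_(i <- s | P i) F i) = \sum_(i <- s | P i) complex.Re (F i).
Proof. by apply: (big_morph (@complex.Re R)) => // -[? ?] [? ?]. Qed.

Lemma Im_sum I (s : seq I) (P : pred I) (F : I -> C) :
  complex.Im (\sum_(i <- s | P i) F i) = \sum_(i <- s | P i) complex.Im (F i).
Proof. by apply: (big_morph (@complex.Im R)) => // -[? ?] [? ?]. Qed.

Lemma normc_summable (u : nat -> C) :
  cvgn (series (fun n => normc (u n))) -> cvgn (series (u : nat -> C^o)).
Proof.
move=> h.
have cR : cvgn (series (fun n => complex.Re (u n))).
  apply: normed_cvg; apply: series_le_cvg h => n //=; [exact: normc_ge0|exact: Re_le_normc].
have cI : cvgn (series (fun n => complex.Im (u n))).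
  apply: normed_cvg; apply: series_le_cvg h => n //=; [exact: normc_ge0|exact: Im_le_normc].
apply/cvg_ex; exists (limn (series (fun n => complex.Re (u n))) +i*
                      limn (series (fun n => complex.Im (u n)))).
apply: cvgC_ReIm.
  have -> : (fun n => complex.Re (series (u : nat -> C^o) n)) = series (fun n => complex.Re (u n)).
    by apply/funext => n; rewrite /series /= Re_sum.
  exact: cR.
have -> : (fun n => complex.Im (series (u : nat -> C^o) n)) = series (fun n => complex.Im (u n)).
  by apply/funext => n; rewrite /series /= Im_sum.
exact: cI.
Qed.

End ComplexLimits.

(** * Adjoint matrices and the inner product of column vectors *)

Section Vectors.
Variable R : realType.
Local Notation C := R[i].
Local Notation normc := (@Normc.normc R).

Lemma conjcD (u v : C) : (u + v)^*%C = u^*%C + v^*%C. Proof. exact: rmorphD. Qed.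
Lemma conjcN (u : C) : (- u)^*%C = - u^*%C. Proof. exact: rmorphN. Qed.
Lemma conjcB (u v : C) : (u - v)^*%C = u^*%C - v^*%C. Proof. exact: rmorphB. Qed.
Lemma conjcM (u v : C) : (u * v)^*%C = u^*%C * v^*%C. Proof. exact: rmorphM. Qed.
Lemma conjcV (u : C) : (u^-1)^*%C = (u^*%C)^-1. Proof. exact: fmorphV. Qed.
Lemma conjcX (u : C) n : (u ^+ n)^*%C = (u^*%C) ^+ n. Proof. exact: rmorphXn. Qed.

Lemma adjmxE (m n : nat) (A : 'M[C]_(m, n)) i j : (A^t* ) i j = (A j i)^*%C.
Proof. by rewrite !mxE. Qed.

Lemma adjmxK (m n : nat) (A : 'M[C]_(m, n)) : A^t*^t* = A.
Proof. by apply/matrixP => i j; rewrite !adjmxE conjcK. Qed.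

Lemma adjmxM (m n p : nat) (A : 'M[C]_(m, n)) (B : 'M[C]_(n, p)) :
  (A *m B)^t* = B^t* *m A^t*.
Proof. by rewrite trmx_mul map_mxM. Qed.

Lemma adjmxD (m n : nat) (A B : 'M[C]_(m, n)) : (A + B)^t* = A^t* + B^t*.
Proof. by rewrite linearD /= map_mxD. Qed.

Lemma adjmxN (m n : nat) (A : 'M[C]_(m, n)) : (- A)^t* = - A^t*.
Proof. by rewrite linearN /= map_mxN. Qed.

Lemma adjmxB (m n : nat) (A B : 'M[C]_(m, n)) : (A - B)^t* = A^t* - B^t*.
Proof. by rewrite adjmxD adjmxN. Qed.

Lemma adjmxZ (m n : nat) c (A : 'M[C]_(m, n)) : (c *: A)^t* = c^*%C *: A^t*.
Proof. by rewrite linearZ /= map_mxZ. Qed.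

Lemma adjmx_scalar (n : nat) (c : C) : (c%:M : 'M[C]_n)^t* = (c^*%C)%:M.
Proof. by rewrite tr_scalar_mx map_scalar_mx. Qed.

Lemma adjmx_inv (n : nat) (A : 'M[C]_n) : (invmx A)^t* = invmx (A^t* ).
Proof. by rewrite trmx_inv map_invmx. Qed.

Lemma det_adjmx (n : nat) (A : 'M[C]_n) : \det (A^t* ) = (\det A)^*%C.
Proof. by rewrite det_map_mx det_tr. Qed.

Lemma dotcDl m (u v w : 'cV[C]_m) : dotc (u + v) w = dotc u w + dotc v w.
Proof. by rewrite /dotc -big_split /=; apply: eq_bigr => i _; rewrite mxE mulrDl. Qed.

Lemma dotcZl m c (v w : 'cV[C]_m) : dotc (c *: v) w = c * dotc v w.
Proof. by rewrite /dotc mulr_sumr; apply: eq_bigr => i _; rewrite mxE mulrA. Qed.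

Lemma dotcC m (v w : 'cV[C]_m) : dotc w v = (dotc v w)^*%C.
Proof.
rewrite /dotc rmorph_sum; apply: eq_bigr => i _ /=.
by rewrite rmorphM /= conjcK mulrC.
Qed.

Lemma dotcDr m (u v w : 'cV[C]_m) : dotc w (u + v) = dotc w u + dotc w v.
Proof. by rewrite !(dotcC _ w) dotcDl rmorphD. Qed.

Lemma dotcZr m c (v w : 'cV[C]_m) : dotc w (c *: v) = c^*%C * dotc w v.
Proof. by rewrite !(dotcC _ w) dotcZl rmorphM. Qed.

Lemma dotc0l m (w : 'cV[C]_m) : dotc 0 w = 0.
Proof. by rewrite -(scale0r 0) dotcZl mul0r. Qed.

Lemma dotc0r m (w : 'cV[C]_m) : dotc w 0 = 0.
Proof. by rewrite dotcC dotc0l rmorph0. Qed.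

Lemma dotcNl m (v w : 'cV[C]_m) : dotc (- v) w = - dotc v w.
Proof. by rewrite -scaleN1r dotcZl mulN1r. Qed.

Lemma dotcBl m (u v w : 'cV[C]_m) : dotc (u - v) w = dotc u w - dotc v w.
Proof. by rewrite dotcDl dotcNl. Qed.

Lemma dotcNr m (v w : 'cV[C]_m) : dotc w (- v) = - dotc w v.
Proof. by rewrite [LHS]dotcC dotcNl rmorphN /= -dotcC. Qed.

Lemma dotcBr m (u v w : 'cV[C]_m) : dotc w (u - v) = dotc w u - dotc w v.
Proof. by rewrite dotcDr dotcNr. Qed.

Lemma dotc_mulmx m (v w : 'cV[C]_m) : dotc v w = (w^t* *m v) 0 0.
Proof. by rewrite mxE; apply: eq_bigr => i _; rewrite adjmxE mulrC. Qed.

Lemma dotc_adj m n (A : 'M[C]_(m, n)) v w : dotc (A *m v) w = dotc v (A^t* *m w).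
Proof. by rewrite !dotc_mulmx adjmxM adjmxK mulmxA. Qed.

Lemma dotcvv m (v : 'cV[C]_m) : dotc v v = (vsqnorm v)%:C.
Proof. by rewrite /dotc /vsqnorm rmorph_sum; apply: eq_bigr => i _; rewrite mulcJ. Qed.

Lemma vsqnorm_ge0 m (v : 'cV[C]_m) : 0 <= vsqnorm v.
Proof. by apply: sumr_ge0 => i _; rewrite sqr_ge0. Qed.

Lemma vsqnorm0 m : vsqnorm (0 : 'cV[C]_m) = 0.
Proof. by apply: complexI; rewrite -dotcvv dotc0l. Qed.

Lemma vsqnorm_eq0 m (v : 'cV[C]_m) : vsqnorm v = 0 -> v = 0.
Proof.
move=> /eqP; rewrite psumr_eq0 => [/allP h|i _]; last by rewrite sqr_ge0.
apply/matrixP => i j; rewrite ord1 mxE; apply: Normc.eq0_normc.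
by apply/eqP; have := h i (mem_index_enum i); rewrite sqrf_eq0.
Qed.

Lemma vsqnormZ m c (v : 'cV[C]_m) : vsqnorm (c *: v) = normc c ^+ 2 * vsqnorm v.
Proof.
by rewrite /vsqnorm mulr_sumr; apply: eq_bigr => i _; rewrite mxE Normc.normcM exprMn.
Qed.

Lemma vsqnormD m (v w : 'cV[C]_m) : vsqnorm (v + w) <= 2 * (vsqnorm v + vsqnorm w).
Proof.
rewrite /vsqnorm -big_split mulr_sumr; apply: ler_sum => i _ /=; rewrite mxE.
have h := normcD (v i 0) (w i 0).
have h2 : normc (v i 0 + w i 0) ^+ 2 <= (normc (v i 0) + normc (w i 0)) ^+ 2.
  by rewrite ler_pXn2r // ?nnegrE ?normc_ge0 ?addr_ge0 ?normc_ge0.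
apply: (le_trans h2); rewrite -subr_ge0.
have -> : 2 * (normc (v i 0) ^+ 2 + normc (w i 0) ^+ 2) - (normc (v i 0) + normc (w i 0)) ^+ 2 =
  (normc (v i 0) - normc (w i 0)) ^+ 2 by ring.
exact: sqr_ge0.
Qed.

Lemma normc_sum I (s : seq I) (P : pred I) (F : I -> C) :
  normc (\sum_(i <- s | P i) F i) <= \sum_(i <- s | P i) normc (F i).
Proof.
elim/big_ind2: _ => //; first by rewrite Normc.normc0.
by move=> a b c d ha hc; apply: (le_trans (normcD _ _)); apply: lerD.
Qed.

(** Termwise arithmetic-geometric mean; the bound is additive, so it is summable along two
    square-summable sequences. *)
Lemma normc_dotc m (v w : 'cV[C]_m) : normc (dotc v w) <= vsqnorm v + vsqnorm w.
Proof.
apply: (le_trans (normc_sum _ _ _)); rewrite /vsqnorm -big_split; apply: ler_sum => i _ /=.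
rewrite Normc.normcM normc_conj; set a := normc _; set b := normc _.
have : 0 <= (a - b) ^+ 2 by rewrite sqr_ge0.
have : 0 <= (a + b) ^+ 2 by rewrite sqr_ge0.
by rewrite !expr2; nra.
Qed.

Lemma vsqnorm_mul_le m n (A : 'M[C]_(m, n)) v :
  vsqnorm (A *m v) <= (\sum_i \sum_j n%:R * normc (A i j) ^+ 2) * vsqnorm v.
Proof.
rewrite {1}/vsqnorm mulr_suml; apply: ler_sum => i _; rewrite mxE.
(* Cauchy-Schwarz for n summands, by summing 2 x y <= x^2 + y^2 over all pairs. *)
have hs : forall (F : 'I_n -> C), normc (\sum_j F j) ^+ 2 <= n%:R * \sum_j normc (F j) ^+ 2.
  move=> F; have h1 : normc (\sum_j F j) ^+ 2 <= (\sum_j normc (F j)) ^+ 2.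
    by rewrite ler_pXn2r // ?nnegrE ?normc_ge0 ?sumr_ge0 ?normc_sum // => j _; rewrite normc_ge0.
  apply: (le_trans h1); rewrite expr2 mulr_suml.
  have -> : n%:R * (\sum_j normc (F j) ^+ 2) =
    \sum_(j < n) \sum_(k < n) ((normc (F j) ^+ 2 + normc (F k) ^+ 2) / 2).
    under [RHS]eq_bigr => j _ do rewrite -mulr_suml big_split /= sumr_const card_ord.
    rewrite -mulr_suml big_split /= sumr_const card_ord sumrMnl -mulr_natl; by field.
  apply: ler_sum => j _; rewrite mulr_sumr; apply: ler_sum => k _.
  have : 0 <= (normc (F j) - normc (F k)) ^+ 2 by rewrite sqr_ge0.
  by rewrite !expr2; lra.
apply: (le_trans (hs _)); rewrite mulr_sumr mulr_suml; apply: ler_sum => j _.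
rewrite Normc.normcM exprMn mulrA; apply: ler_wpM2l; first by rewrite mulr_ge0 ?sqr_ge0.
by rewrite /vsqnorm (bigD1 j) //= lerDl sumr_ge0 // => k _; rewrite sqr_ge0.
Qed.

Lemma vsqnorm_mul m n (A : 'M[C]_(m, n)) :
  exists2 K : R, 0 <= K & forall v, vsqnorm (A *m v) <= K * vsqnorm v.
Proof.
exists (\sum_i \sum_j n%:R * normc (A i j) ^+ 2); last exact: vsqnorm_mul_le.
by apply: sumr_ge0 => i _; apply: sumr_ge0 => j _; rewrite mulr_ge0 ?sqr_ge0.
Qed.

End Vectors.

(** * Pairings of arbitrary pairs and the Hilbert space *)

Section States.
Variables (R : realType) (d r : nat).
Local Notation C := R[i].
Local Notation normc := (@Normc.normc R).
Local Notation state := (state R d r).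
Implicit Types f g h : state.

Definition psum f g (N : nat) : C := dotc f.1 g.1 + \sum_(0 <= n < N) dotc (f.2 n) (g.2 n).

(** [ip] is built on [limn], which says nothing about a divergent series. This predicate makes the
    algebra of [ip] valid; it covers two vectors of the Hilbert space as well as a finitely
    supported vector paired with a generalized eigenfunction. *)
Definition pairable f g : Prop := cvgn (psum f g : nat -> C^o).

Lemma psum_cvg f g : pairable f g -> (psum f g N : C^o) @[N --> \oo] --> (ip f g : C^o).
Proof.
move=> hp; rewrite /ip; apply: cvgD; first exact: cvg_cst.
have : cvgn (series (fun n => dotc (f.2 n) (g.2 n) : C^o)); last by [].
have -> : series (fun n => dotc (f.2 n) (g.2 n) : C^o) =
   (fun N => psum f g N - dotc f.1 g.1 : C^o).
  by apply/funext => N; rewrite /psum addrC addKr.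
move/cvg_ex: hp => [l hl]; apply/cvg_ex; exists (l - dotc f.1 g.1 : C^o).
by apply: (@cvgB _ C^o _ _ _ _ _ _ _ hl); exact: cvg_cst.
Qed.

Lemma ip_eq f g (l : C) : (psum f g N : C^o) @[N --> \oo] --> (l : C^o) ->
  pairable f g /\ ip f g = l.
Proof.
move=> h; have hp : pairable f g by apply/cvg_ex; exists l.
split=> //; exact: (cvg_unique (@norm_hausdorff _ _) (psum_cvg hp) h).
Qed.

Lemma ip_near f g (l : C) : (\forall N \near \oo, psum f g N = l) ->
  pairable f g /\ ip f g = l.
Proof.
move=> h; apply: ip_eq; apply: cvg_near_cst; exact: h.
Qed.

Lemma psum_stable f g N : (forall n, (N <= n)%N -> dotc (f.2 n) (g.2 n) = 0) ->
  forall M, (N <= M)%N -> psum f g M = psum f g N.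
Proof.
move=> h M NM; rewrite /psum (big_cat_nat _ NM) //= [X in _ + (_ + X)]big_nat.
by rewrite [X in _ + (_ + X)]big1 ?addr0 // => n /andP[/h].
Qed.

Lemma ip_psum f g N : (forall n, (N <= n)%N -> dotc (f.2 n) (g.2 n) = 0) ->
  pairable f g /\ ip f g = psum f g N.
Proof. by move=> h; apply: ip_near; exists N => // M NM; exact: psum_stable. Qed.

Lemma ip_finl f g N : (forall n, (N <= n)%N -> f.2 n = 0) -> ip f g = psum f g N.
Proof. by move=> h; apply: (proj2 (ip_psum _)) => n /h ->; rewrite dotc0l. Qed.

Lemma ip_finr f g N : (forall n, (N <= n)%N -> g.2 n = 0) -> ip f g = psum f g N.
Proof. by move=> h; apply: (proj2 (ip_psum _)) => n /h ->; rewrite dotc0r. Qed.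

Lemma pairable_finl f g : finsupp f -> pairable f g.
Proof. by case=> N h; apply: (proj1 (@ip_psum _ _ N _)) => n /h ->; rewrite dotc0l. Qed.

Lemma pairable_finr f g : finsupp g -> pairable f g.
Proof. by case=> N h; apply: (proj1 (@ip_psum _ _ N _)) => n /h ->; rewrite dotc0r. Qed.

Lemma psumC f g N : psum g f N = (psum f g N)^*%C.
Proof.
by rewrite /psum rmorphD /= -dotcC rmorph_sum; congr (_ + _); apply: eq_bigr => n _; exact: dotcC.
Qed.

Lemma psumDl f g h N : psum (f + g) h N = psum f h N + psum g h N.
Proof.
rewrite /psum dotcDl addrACA; congr (_ + _).
by rewrite -big_split; apply: eq_bigr => n _; rewrite /= -dotcDl.
Qed.

Lemma psumZl c f h N : psum (c *: f) h N = c * psum f h N.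
Proof.
rewrite /psum dotcZl mulrDr; congr (_ + _).
by rewrite mulr_sumr; apply: eq_bigr => n _; rewrite -dotcZl.
Qed.

Lemma pairableDl f g h : pairable f h -> pairable g h ->
  pairable (f + g) h /\ ip (f + g) h = ip f h + ip g h.
Proof.
move=> hf hg; apply: ip_eq; rewrite (_ : psum _ _ = fun N => psum f h N + psum g h N).
  by apply: cvgD; exact: psum_cvg.
by apply/funext => N; rewrite psumDl.
Qed.

Lemma pairableZl c f h : pairable f h -> pairable (c *: f) h /\ ip (c *: f) h = c * ip f h.
Proof.
move=> hf; apply: ip_eq; rewrite (_ : psum _ _ = fun N => c * psum f h N).
  by apply: cvgM; [exact: cvg_cst|exact: psum_cvg].
by apply/funext => N; rewrite psumZl.
Qed.

Lemma pairableC f g : pairable f g -> pairable g f /\ ip g f = (ip f g)^*%C.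
Proof.
move=> hf; apply: ip_eq; rewrite (_ : psum _ _ = fun N => (psum f g N)^*%C).
  by apply: cvgC_conj; exact: psum_cvg.
by apply/funext => N; rewrite psumC.
Qed.

Lemma inH_series f : inH f <-> cvgn (series (fun n => vsqnorm (f.2 n))).
Proof. by []. Qed.

Lemma inH_pair f g : inH f -> inH g -> pairable f g.
Proof.
move=> hf hg; rewrite /pairable.
rewrite (_ : psum f g = (fun N => dotc f.1 g.1 +
   series (fun n => dotc (f.2 n) (g.2 n) : C^o) N : C^o)) //.
apply: is_cvgD; first exact: is_cvg_cst.
apply: normc_summable; apply: (@series_le_cvg _ _ (fun n => vsqnorm (f.2 n) + vsqnorm (g.2 n))).
- by move=> n; exact: normc_ge0.
- by move=> n; rewrite addr_ge0 ?vsqnorm_ge0.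
- by move=> n; exact: normc_dotc.
- have -> : series (fun n => vsqnorm (f.2 n) + vsqnorm (g.2 n)) =
    series (fun n => vsqnorm (f.2 n)) + series (fun n => vsqnorm (g.2 n)).
    by apply/funext => n; rewrite /series /= big_split.
  exact: is_cvgD.
Qed.

Lemma finsuppD f g : finsupp f -> finsupp g -> finsupp (f + g).
Proof.
move=> [N hN] [M hM]; exists (maxn N M) => n; rewrite geq_max => /andP[Nn Mn].
by rewrite (_ : (f + g).2 n = f.2 n + g.2 n) // hN // hM // addr0.
Qed.

Lemma finsuppZ c f : finsupp f -> finsupp (c *: f).
Proof. by move=> [N hN]; exists N => n Nn; rewrite (_ : (c *: f).2 n = c *: f.2 n) // hN // scaler0. Qed.

Lemma finsupp0 : finsupp (0 : state).
Proof. by exists 0%N. Qed.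

Lemma finsupp_inH f : finsupp f -> inH f.
Proof.
move=> [N h]; apply/cvg_ex; exists (series (fun n => vsqnorm (f.2 n)) N).
apply: cvg_near_cst; exists N => // M /= NM.
rewrite seriesEnat /= (big_cat_nat _ NM) //= [X in _ + X]big_nat.
by rewrite [X in _ + X]big1 ?addr0 // => n /andP[/h -> _]; rewrite vsqnorm0.
Qed.

Lemma inHD f g : inH f -> inH g -> inH (f + g).
Proof.
move=> hf hg; rewrite inH_series.
apply: (@series_le_cvg _ _ (fun n => 2 * (vsqnorm (f.2 n) + vsqnorm (g.2 n)))).
- by move=> n; exact: vsqnorm_ge0.
- by move=> n; rewrite mulr_ge0 // addr_ge0 ?vsqnorm_ge0.
- by move=> n; exact: vsqnormD.
- have -> : series (fun n => 2 * (vsqnorm (f.2 n) + vsqnorm (g.2 n))) =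
    (fun n => 2 * (series (fun n => vsqnorm (f.2 n)) n + series (fun n => vsqnorm (g.2 n)) n)).
    by apply/funext => n; rewrite /series /= -big_split mulr_sumr.
  by apply: is_cvgM; [exact: is_cvg_cst | exact: is_cvgD].
Qed.

Lemma inHZ c f : inH f -> inH (c *: f).
Proof.
move=> hf; rewrite inH_series.
have -> : series (fun n => vsqnorm ((c *: f).2 n)) =
    (fun n => normc c ^+ 2 * series (fun n => vsqnorm (f.2 n)) n).
  by apply/funext => n; rewrite /series /= mulr_sumr; apply: eq_bigr => k _; rewrite vsqnormZ.
by apply: is_cvgM; [exact: is_cvg_cst | exact: hf].
Qed.

Lemma inH0 : inH (0 : state).
Proof. exact: (finsupp_inH finsupp0). Qed.

Lemma inHN f : inH f -> inH (- f).
Proof. by move=> ?; rewrite -scaleN1r; exact: inHZ. Qed.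

Lemma inHB f g : inH f -> inH g -> inH (f - g).
Proof. by move=> ? ?; apply: inHD => //; exact: inHN. Qed.

Lemma finsuppB f g : finsupp f -> finsupp g -> finsupp (f - g).
Proof. by move=> ? ?; apply: finsuppD => //; rewrite -scaleN1r; exact: finsuppZ. Qed.

Lemma inH_sum I (s : seq I) (F : I -> state) :
  (forall i, inH (F i)) -> inH (\sum_(i <- s) F i).
Proof.
by move=> h; elim/big_ind: _ => [|? ?|? _]; [exact: inH0|exact: inHD|exact: h].
Qed.

Lemma finsupp_sum I (s : seq I) (F : I -> state) :
  (forall i, finsupp (F i)) -> finsupp (\sum_(i <- s) F i).
Proof.
by move=> h; elim/big_ind: _ => [|? ?|? _]; [exact: finsupp0|exact: finsuppD|exact: h].
Qed.

Lemma ipC f g : inH f -> inH g -> ip g f = (ip f g)^*%C.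
Proof. by move=> hf hg; exact: (proj2 (pairableC (inH_pair hf hg))). Qed.

Lemma ipDl f g h : inH f -> inH g -> inH h -> ip (f + g) h = ip f h + ip g h.
Proof. by move=> hf hg hh; apply: (proj2 (pairableDl _ _)); exact: inH_pair. Qed.

Lemma ipZl c f h : inH f -> inH h -> ip (c *: f) h = c * ip f h.
Proof. by move=> hf hh; apply: (proj2 (pairableZl _ _)); exact: inH_pair. Qed.

Lemma ipNl f h : inH f -> inH h -> ip (- f) h = - ip f h.
Proof. by move=> hf hh; rewrite -scaleN1r ipZl // mulN1r. Qed.

Lemma ipBl f g h : inH f -> inH g -> inH h -> ip (f - g) h = ip f h - ip g h.
Proof. by move=> hf hg hh; rewrite ipDl ?ipNl //; exact: inHN. Qed.

Lemma ipDr f g h : inH f -> inH g -> inH h -> ip h (f + g) = ip h f + ip h g.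
Proof.
move=> hf hg hh; rewrite (ipC (inHD hf hg) hh) ipDl // rmorphD /=.
by rewrite -(ipC hf hh) -(ipC hg hh).
Qed.

Lemma ipZr c f h : inH f -> inH h -> ip h (c *: f) = c^*%C * ip h f.
Proof. by move=> hf hh; rewrite (ipC (@inHZ c _ hf) hh) ipZl // rmorphM /= -(ipC hf hh). Qed.

Lemma ipNr f h : inH f -> inH h -> ip h (- f) = - ip h f.
Proof. by move=> hf hh; rewrite (ipC (inHN hf) hh) ipNl // rmorphN /= -(ipC hf hh). Qed.

Lemma ipBr f g h : inH f -> inH g -> inH h -> ip h (f - g) = ip h f - ip h g.
Proof. by move=> hf hg hh; rewrite ipDr ?ipNr //; exact: inHN. Qed.

Lemma ip0l f : ip 0 f = 0.
Proof. by rewrite (@ip_finl 0 f 0%N) // /psum big_nil dotc0l addr0. Qed.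

Lemma ip0r f : ip f 0 = 0.
Proof. by rewrite (@ip_finr f 0 0%N) // /psum big_nil dotc0r addr0. Qed.

Lemma ip_suml I (s : seq I) (F : I -> state) h : (forall i, inH (F i)) -> inH h ->
  ip (\sum_(i <- s) F i) h = \sum_(i <- s) ip (F i) h.
Proof.
move=> hF hh; elim: s => [|x s ih]; first by rewrite !big_nil ip0l.
by rewrite !big_cons ipDl ?ih //; exact: inH_sum.
Qed.

Lemma ip_sumr I (s : seq I) (F : I -> state) h : (forall i, inH (F i)) -> inH h ->
  ip h (\sum_(i <- s) F i) = \sum_(i <- s) ip h (F i).
Proof.
move=> hF hh; elim: s => [|x s ih]; first by rewrite !big_nil ip0r.
by rewrite !big_cons ipDr ?ih //; exact: inH_sum.
Qed.

Lemma sqnormH_cvg f : inH f ->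
  (vsqnorm f.1 + \sum_(0 <= n < N) vsqnorm (f.2 n)) @[N --> \oo] --> sqnormH f.
Proof.
move=> hf; rewrite (_ : (fun N => _) = (fun N => complex.Re (psum f f N))).
  by apply: cvgC_Re; exact: psum_cvg (inH_pair hf hf).
apply/funext => N; rewrite /psum dotcvv; under [in RHS]eq_bigr do rewrite dotcvv.
by rewrite -rmorph_sum -rmorphD.
Qed.

Lemma ipff f : inH f -> ip f f = (sqnormH f)%:C.
Proof.
move=> hf; have h : complex.Im (psum f f N) @[N --> \oo] --> complex.Im (ip f f).
  by apply: cvgC_Im; exact: psum_cvg (inH_pair hf hf).
rewrite /sqnormH; have : complex.Im (ip f f) = 0.
  apply: (cvg_unique (@norm_hausdorff _ _) h) => //.
  rewrite (_ : (fun N => _) = (fun _ => 0)); first exact: cvg_cst.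
  apply/funext => N; rewrite /psum dotcvv; under eq_bigr do rewrite dotcvv.
  by rewrite -rmorph_sum -rmorphD.
by case: (ip f f) => a b /= ->.
Qed.

Lemma psum_le_sqnormH f N : inH f ->
  vsqnorm f.1 + \sum_(0 <= n < N) vsqnorm (f.2 n) <= sqnormH f.
Proof.
move=> hf; rewrite -(cvg_lim _ (sqnormH_cvg hf)) //.
apply: (@nondecreasing_cvgn_le _ (fun N => vsqnorm f.1 + \sum_(0 <= n < N) vsqnorm (f.2 n))).
  move=> n m nm; rewrite lerD2l (big_cat_nat _ nm) //= lerDl sumr_ge0 // => k _.
  exact: vsqnorm_ge0.
by apply/cvg_ex; exists (sqnormH f); exact: sqnormH_cvg.
Qed.

Lemma sqnormH_ge0 f : inH f -> 0 <= sqnormH f.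
Proof.
move=> hf; apply: le_trans (psum_le_sqnormH 0 hf).
by rewrite big_nil addr0 vsqnorm_ge0.
Qed.

Lemma sqnormH_eq0 f : inH f -> sqnormH f = 0 -> f = 0.
Proof.
move=> hf h0; have h N : vsqnorm f.1 + \sum_(0 <= n < N) vsqnorm (f.2 n) = 0.
  apply/eqP; rewrite eq_le; apply/andP; split; first by have := psum_le_sqnormH N hf; rewrite h0.
  rewrite addr_ge0 ?vsqnorm_ge0 //.
  by apply: sumr_ge0 => n _; exact: vsqnorm_ge0.
have h1 : f.1 = 0 by apply: vsqnorm_eq0; have := h 0%N; rewrite big_nil addr0.
have h2 : f.2 = 0.
  apply/funext => n; apply: vsqnorm_eq0; have := h n.+1.
  have := h n; rewrite big_nat_recr //= addrA => ->; by rewrite add0r.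
by case: f h1 h2 {hf h0 h} => u v /= -> ->.
Qed.

(** Pairing f with its own truncations yields the partial sums of its squared norm. *)
Lemma ip_nondeg f : inH f -> (forall g, finsupp g -> ip f g = 0) -> f = 0.
Proof.
move=> hf h; apply: sqnormH_eq0 => //.
apply: (cvg_unique (@norm_hausdorff _ _) (sqnormH_cvg hf)) => //.
rewrite (_ : (fun N => _) = (fun _ => 0)); first exact: cvg_cst.
apply/funext => N.
pose g : state := (f.1, fun n => if (n < N)%N then f.2 n else 0).
have gN n : (N <= n)%N -> g.2 n = 0 by rewrite /g /= ltnNge => ->.
have fg : finsupp g by exists N.
have := h g fg; rewrite (@ip_finr _ _ N gN) /psum.
have -> : \sum_(0 <= n < N) dotc (f.2 n) (g.2 n) = \sum_(0 <= n < N) (vsqnorm (f.2 n))%:C.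
  by apply: eq_big_nat => n /andP[_ nN]; rewrite /g /= nN dotcvv.
by rewrite dotcvv -rmorph_sum -rmorphD => /complexI.
Qed.

Definition trunc (N : nat) f : state := (f.1, fun n => if (n < N)%N then f.2 n else 0).

Lemma trunc_finsupp N f : finsupp (trunc N f).
Proof. by exists N => n; rewrite /= ltnNge => ->. Qed.

Lemma trunc_cvg f : inH f -> cvgH (fun N => trunc N f) f.
Proof.
move=> hf; rewrite /cvgH.
have fi N : inH (trunc N f) := finsupp_inH (trunc_finsupp N f).
(* The pairings of the truncation with f and with itself coincide, so the squared distance is the
   tail of the norm series. *)
have e N : sqnormH (trunc N f - f) =
   sqnormH f - (vsqnorm f.1 + \sum_(0 <= n < N) vsqnorm (f.2 n)).
  apply: complexI; rewrite -ipff; last exact: inHB.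
  rewrite ipBl ?ipBr //; try exact: inHB.
  have h0 g : (forall n, (n < N)%N -> g.2 n = f.2 n) -> g.1 = f.1 ->
      ip (trunc N f) g = (vsqnorm f.1 + \sum_(0 <= n < N) vsqnorm (f.2 n))%:C.
    move=> g2 g1; rewrite (@ip_finl _ _ N); last by move=> n; rewrite /= ltnNge => ->.
    rewrite /psum /= g1 dotcvv rmorphD /=; congr (_ + _).
    rewrite (rmorph_sum (real_complex R)) [LHS]big_nat [RHS]big_nat; apply: eq_bigr => n /andP[_ nN].
    by rewrite nN g2 // dotcvv.
  have h1 : ip (trunc N f) f = (vsqnorm f.1 + \sum_(0 <= n < N) vsqnorm (f.2 n))%:C by exact: h0.
  have h2 : ip (trunc N f) (trunc N f) = (vsqnorm f.1 + \sum_(0 <= n < N) vsqnorm (f.2 n))%:C.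
    by apply: h0 => // n nN; rewrite /= nN.
  by rewrite (ipC (fi N) hf) h1 h2 conjc_real ipff // rmorphB /= subrr sub0r opprB.
under eq_fun do rewrite e.
suff : (sqnormH f - (vsqnorm f.1 + \sum_(0 <= n < N) vsqnorm (f.2 n))) @[N --> \oo] -->
    sqnormH f - sqnormH f by rewrite subrr.
by apply: cvgB; [exact: cvg_cst|exact: sqnormH_cvg].
Qed.

End States.

Lemma cvgC_shiftS (R : realType) (u : nat -> R[i]) (l : R[i]) :
  (u N : R[i]^o) @[N --> \oo] --> (l : R[i]^o) -> (u N.+1 : R[i]^o) @[N --> \oo] --> (l : R[i]^o).
Proof. by move=> h; rewrite (@cvg_shiftS (R[i]^o) u). Qed.

(** * Cauchy-Schwarz for positive semidefinite forms *)

Section HermitianForms.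
Variable R : realType.
Local Notation C := R[i].

(** Relative to a domain D and for semidefinite forms, because it serves both [ip] on [inH] and the
    form Q, whose values are controlled only on [finsupp]. *)
Lemma hermitian_form_CS (X : lmodType C) (D : X -> Prop) (b : X -> X -> C) :
  (forall c f g, D f -> D g -> D (f + c *: g)) ->
  (forall c f g h, D f -> D g -> D h -> b (f + c *: g) h = b f h + c * b g h) ->
  (forall f g, D f -> D g -> b g f = (b f g)^*%C) ->
  (forall f, D f -> 0 <= b f f) ->
  forall f g, D f -> D g -> `|b f g| ^+ 2 <= b f f * b g g.
Proof.
move=> DD bl bc b0 f g Df Dg.
have br c h k l : D h -> D k -> D l -> b l (h + c *: k) = b l h + c^*%C * b l k.
  move=> Dh Dk Dl; rewrite (bc (h + c *: k)) ?bl ?rmorphD ?rmorphM //=; last exact: DD.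
  by rewrite -!bc.
have bE c : b (f + c *: g) (f + c *: g) =
    b f f + c * (b f g)^*%C + c^*%C * b f g + c * c^*%C * b g g.
  rewrite bl ?br //; last exact: DD.
  by rewrite (bc f g) //; ring.
have nE : `|b f g| ^+ 2 = b f g * (b f g)^*%C by rewrite sqr_normc.
have bff := b0 _ Df.
(* If g is a null vector, positivity along f - t b(f,g) g for all real t forces b(f,g) = 0.
   Otherwise positivity is used at the minimiser f - (b(f,g) / b(g,g)) g. *)
have := b0 _ Dg; rewrite le_eqVlt => /orP[/eqP g0|g0].
  rewrite -g0 mulr0 nE.
  have hc (t : R) : 0 <= b f f - 2 * t%:C * (b f g * (b f g)^*%C).
    have := b0 _ (DD (- (t%:C * b f g)) f g Df Dg); rewrite bE -g0.
    have -> : (- (t%:C * b f g))^*%C = - (t%:C * (b f g)^*%C) by rewrite rmorphN rmorphM; congr (- (_ * _)); exact: conjc_real.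
    by set A := b f f; set z := b f g; congr (_ <= _); ring.
  move: nE hc bff; rewrite mulcJ; set s : R := _ ^+ 2; set A := b f f => _ hc A0.
  have AE : A = (complex.Re A)%:C by rewrite RRe_real // ger0_real.
  rewrite lecR leNgt; apply/negP => s0.
  have hr t : 0 <= complex.Re A - 2 * t * s.
    have := hc t; rewrite {1}AE (_ : _ - _ = (complex.Re A - 2 * t * s)%:C) ?lecR //.
    by rewrite rmorphB !rmorphM /= rmorph_nat.
  have h := hr ((complex.Re A + 1) / s).
  have e : 2 * ((complex.Re A + 1) / s) * s = 2 * (complex.Re A + 1).
    by rewrite -mulrA mulfVK // gt_eqF.
  rewrite e in h; have : 0 <= complex.Re A by rewrite -lecR -AE.
  by move: h; lra.
pose c := - (b f g / b g g).
have gr : (b g g)^*%C = b g g by rewrite -bc.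
have := b0 _ (DD c f g Df Dg); rewrite bE /c.
rewrite (_ : (- (b f g / b g g))^*%C = - ((b f g)^*%C / b g g)); last by rewrite rmorphN rmorphM /= fmorphV /= gr.
rewrite nE.
have g1 : b g g != 0 by rewrite gt_eqF.
move=> h; rewrite -subr_ge0 -(pmulr_lge0 _ g0).
move: h; set A := b f f; set B := b g g in g0 g1 *; set z := b f g; set w := z^*%C => h.
rewrite -(@pmulr_rge0 _ B) // in h; rewrite -(@pmulr_rge0 _ B) // in h.
have -> : (A * B - z * w) * B = B * (B * (A + - (z / B) * w + - (w / B) * z + - (z / B) * - (w / B) * B)).
  by field.
exact: h.
Qed.

End HermitianForms.

(** * The operator J *)

Section JacobiOperator.
Variables (R : realType) (q d r : nat).
Variables (HC : 'M[R[i]]_d) (V : 'M[R[i]]_(d, r)).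
Hypothesis hHC : HC = HC^t*.
Local Notation C := R[i].
Local Notation normc := (@Normc.normc R).
Local Notation state := (state R d r).
Local Notation J := (Jop q HC V).
Local Notation a := (ahop R q).
Implicit Types f g h : state.

Lemma ip_CS f g : inH f -> inH g -> normc (ip f g) ^+ 2 <= sqnormH f * sqnormH g.
Proof.
move=> hf hg.
have := @hermitian_form_CS R state (@inH R d r) (@ip R d r).
move=> /(_ (fun c f g hf hg => inHD hf (@inHZ _ _ _ c _ hg))).
move=> /(_ _ (@ipC R d r) _ f g hf hg) h.
rewrite -lecR rmorphXn rmorphM /= -!ipff //; apply: h.
  by move=> c k l m hk hl hm; rewrite ipDl ?ipZl //; exact: inHZ.
by move=> k hk; rewrite ipff // lecR sqnormH_ge0.
Qed.

Lemma inH_bound f (K : R) :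
  (forall N, vsqnorm f.1 + \sum_(0 <= n < N) vsqnorm (f.2 n) <= K) ->
  inH f /\ sqnormH f <= K.
Proof.
move=> h; have hf : inH f.
  apply: nondecreasing_is_cvgn.
    move=> n m nm; rewrite !seriesEnat /= (big_cat_nat _ nm) //= lerDl sumr_ge0 // => k _.
    exact: vsqnorm_ge0.
  exists K => _ [N _ <-]; apply: le_trans (h N).
  by rewrite seriesEnat /= lerDr vsqnorm_ge0.
split=> //; rewrite -(cvg_lim (@norm_hausdorff _ _) (sqnormH_cvg hf)).
apply: limr_le; first by apply/cvg_ex; exists (sqnormH f); exact: sqnormH_cvg.
by apply: nearW => N; exact: h.
Qed.

Lemma JopD f g : J (f + g) = J f + J g.
Proof.
congr pair; first by rewrite /= !mulmxDr addrACA.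
apply/funext => -[|m].
  by rewrite /= scalerDr mulmxDr addrACA.
by rewrite [RHS]/= -[RHS]scalerDr -[in RHS]addrACA.
Qed.

Lemma JopZ c f : J (c *: f) = c *: J f.
Proof.
congr pair; first by rewrite /= scalerDr -!scalemxAr.
apply/funext => -[|m].
  by rewrite /= [RHS]scalerDr -scalemxAr !scalerA mulrC.
by rewrite /= [RHS]scalerA mulrC -scalerA; congr (_ *: _); rewrite scalerDr.
Qed.

Lemma Jop0 : J 0 = 0.
Proof. by rewrite -(scale0r 0) JopZ !scale0r. Qed.

Lemma JopN f : J (- f) = - J f.
Proof. by rewrite -scaleN1r JopZ scaleN1r. Qed.

Lemma JopB f g : J (f - g) = J f - J g.
Proof. by rewrite JopD JopN. Qed.

Lemma Jop_sum I (s : seq I) (F : I -> state) :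
  J (\sum_(i <- s) F i) = \sum_(i <- s) J (F i).
Proof. exact: (big_morph _ JopD Jop0). Qed.

Lemma Jop_finsupp f : finsupp f -> finsupp (J f).
Proof.
move=> [N h]; exists N.+1 => -[|n] //= Nn.
by rewrite h ?(h n.+2) ?addr0 ?scaler0 //; lia.
Qed.

Lemma Jop_bounded : exists2 K : R, 0 <= K &
  forall f, inH f -> inH (J f) /\ sqnormH (J f) <= K * sqnormH f.
Proof.
have [KH KH0 hKH] := vsqnorm_mul HC; have [KV KV0 hKV] := vsqnorm_mul V.
have [KW KW0 hKW] := vsqnorm_mul (V^t* ).
exists (2 * KH + 2 * KV + 2 * a ^+ 2 + 2 * KW + 4 * a ^+ 2).
  by rewrite !addr_ge0 // mulr_ge0 // sqr_ge0.
move=> f hf; apply: inH_bound => N; set s := sqnormH f.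
have sN M : vsqnorm f.1 + \sum_(0 <= n < M) vsqnorm (f.2 n) <= s := psum_le_sqnormH M hf.
have pos (v : nat -> R) M : (forall n, 0 <= v n) -> 0 <= \sum_(0 <= n < M) v n.
  by move=> v0; apply: sumr_ge0 => n _; exact: v0.
have vp n : 0 <= vsqnorm (f.2 n) := vsqnorm_ge0 _.
have u0 : vsqnorm f.1 <= s by have := sN 0%N; rewrite big_nil addr0.
have sM M : \sum_(0 <= n < M) vsqnorm (f.2 n) <= s.
  by apply: le_trans (sN M); rewrite lerDr vsqnorm_ge0.
have fn n : vsqnorm (f.2 n) <= s.
  by apply: le_trans (sM n.+1); rewrite big_nat_recr //= lerDr pos.
have na : normc a%:C ^+ 2 = a ^+ 2 by rewrite normc_real real_normK // num_real.
have h1 : vsqnorm (J f).1 <= 2 * KH * s + 2 * KV * s.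
  apply: (le_trans (vsqnormD _ _)); rewrite -!mulrA -mulrDr ler_wpM2l // lerD //.
    by apply: (le_trans (hKH _)); rewrite ler_wpM2l.
  by apply: (le_trans (hKV _)); rewrite ler_wpM2l.
have h2 : vsqnorm ((J f).2 0%N) <= 2 * a ^+ 2 * s + 2 * KW * s.
  apply: (le_trans (vsqnormD _ _)); rewrite -![2 * _ * s]mulrA -mulrDr ler_wpM2l // lerD //.
    by rewrite vsqnormZ na ler_wpM2l ?sqr_ge0.
  by apply: (le_trans (hKW _)); rewrite ler_wpM2l.
have h3 M : \sum_(0 <= n < M) vsqnorm ((J f).2 n.+1) <= 4 * a ^+ 2 * s.
  apply: (@le_trans _ _ (\sum_(0 <= n < M) a ^+ 2 * (2 * (vsqnorm (f.2 n) + vsqnorm (f.2 n.+2))))).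
    by apply: ler_sum => n _; rewrite vsqnormZ na ler_wpM2l ?sqr_ge0 // vsqnormD.
  rewrite -!mulr_sumr big_split /= (_ : 4 * a ^+ 2 * s = a ^+ 2 * (2 * (s + s))); last by ring.
  rewrite ler_wpM2l ?sqr_ge0 // ler_wpM2l // lerD //.
  apply: le_trans (sM M.+2); rewrite !big_nat_recl //= addrA lerDr addr_ge0 //.
apply: (@le_trans _ _ (vsqnorm (J f).1 + \sum_(0 <= n < N.+1) vsqnorm ((J f).2 n))).
  by rewrite lerD2l big_nat_recr //= lerDl vsqnorm_ge0.
rewrite big_nat_recl //; have := h3 N; move: h1 h2; rewrite !mulrDl; lra.
Qed.

Lemma Jop_inH f : inH f -> inH (J f).
Proof. by have [K _ h] := Jop_bounded; move/h => []. Qed.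

(** Discrete Green formula: the symmetry of [HC] and the pairing of V with its adjoint cancel
    everything inside, and the Wronskian at the cut remains. At least one site must be kept for the
    terms with V to cancel, hence [N.+1]. *)
Lemma psum_Jop f g N : psum (J f) g N.+1 - psum f (J g) N.+1 =
  a%:C * (dotc (f.2 N.+1) (g.2 N) - dotc (f.2 N) (g.2 N.+1)).
Proof.
elim: N => [|N ih].
  rewrite /psum !big_nat1 /= !dotcDl !dotcDr !dotcZl !dotcZr !dotc_adj adjmxK -hHC conjc_real.
  ring.
have pS (k l : state) : psum k l N.+2 = psum k l N.+1 + dotc (k.2 N.+1) (l.2 N.+1).
  by rewrite /psum big_nat_recr //= addrA.
rewrite !pS opprD addrACA ih /= !dotcZl !dotcZr conjc_real !dotcDl !dotcDr.
ring.
Qed.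

Lemma ip_Jop_finr f g : finsupp g -> ip (J f) g = ip f (J g).
Proof.
move=> fg; have [N h] := fg; have [M hM] := Jop_finsupp fg.
rewrite (@ip_finr _ _ _ _ _ (maxn N M).+1); last by move=> n nM; apply: h; lia.
rewrite (@ip_finr _ _ _ _ _ (maxn N M).+1); last by move=> n nM; apply: hM; lia.
apply/eqP; rewrite -subr_eq0 psum_Jop h ?(h (maxn N M).+1) ?dotc0r ?subrr ?mulr0 //; lia.
Qed.

Lemma ip_Jop_finl f g : finsupp f -> ip (J f) g = ip f (J g).
Proof.
move=> ff; rewrite (proj2 (pairableC (@pairable_finr _ _ _ g _ (Jop_finsupp ff)))).
by rewrite -ip_Jop_finr // (proj2 (pairableC (@pairable_finr _ _ _ (J g) _ ff))).
Qed.

Lemma inH_term_cvg0 f : inH f -> vsqnorm (f.2 n) @[n --> \oo] --> (0 : R).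
Proof. by move=> hf; exact: cvg_series_cvg_0. Qed.

(** The Wronskian of [psum_Jop] is bounded by terms of two convergent series and so tends to 0. *)
Lemma ip_Jop f g : inH f -> inH g -> ip (J f) g = ip f (J g).
Proof.
move=> hf hg; have hJf := Jop_inH hf; have hJg := Jop_inH hg.
have h1 := psum_cvg (inH_pair hJf hg); have h2 := psum_cvg (inH_pair hf hJg).
apply/eqP; rewrite -subr_eq0; apply/eqP.
have h3 : (psum (J f) g N.+1 - psum f (J g) N.+1 : C^o) @[N --> \oo] -->
    (ip (J f) g - ip f (J g) : C^o).
  by apply: (cvgCB (f := fun N => psum (J f) g N.+1) (g := fun N => psum f (J g) N.+1)); exact: cvgC_shiftS.
apply: (cvgC_unique h3).
apply/cvgC_normc.
pose b N := `|a| * ((vsqnorm (f.2 N.+1) + vsqnorm (g.2 N)) + (vsqnorm (f.2 N) + vsqnorm (g.2 N.+1))).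
have hb : b N @[N --> \oo] --> (0 : R).
  have -> : (0 : R) = `|a| * ((0 + 0) + (0 + 0)) by rewrite !addr0 mulr0.
  apply: cvgMr; apply: cvgD; apply: cvgD.
  - by have := inH_term_cvg0 hf; rewrite -(cvg_shiftS (fun n => vsqnorm (f.2 n))).
  - exact: inH_term_cvg0.
  - exact: inH_term_cvg0.
  - by have := inH_term_cvg0 hg; rewrite -(cvg_shiftS (fun n => vsqnorm (g.2 n))).
apply: (squeeze_cvgr _ (cvg_cst 0) hb); apply: nearW => N.
rewrite normc_ge0 /= psum_Jop subr0 Normc.normcM normc_real ler_wpM2l //.
apply: (le_trans (normcD _ _)); rewrite normcN lerD //; exact: normc_dotc.
Qed.

End JacobiOperator.

(** * The scattering matrix and the generalized eigenfunctions *)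

Section Scattering.
Variables (R : realType) (q d r : nat).
Variables (HC : 'M[R[i]]_d) (V : 'M[R[i]]_(d, r)).
Hypothesis hHC : HC = HC^t*.
Hypothesis ha : 0 < ahop R q.
Local Notation C := R[i].
Local Notation normc := (@Normc.normc R).
Local Notation state := (state R d r).
Local Notation J := (Jop q HC V).
Local Notation a := (ahop R q).
Local Notation F := (Fmx q HC V).
Local Notation S := (Smx q HC V).
Local Notation x := (xspec (R := R) q).

Let ac0 : a%:C != 0 :> C.
Proof. by rewrite (inj_eq (@complexI R)) gt_eqF. Qed.

(** The central component of [Psi] as a matrix acting on alpha. The factor 1/z - z belongs to it: it
    is this product that stays bounded on the circle. *)
Definition Ymx (z : C) : 'M[C]_(d, r) := (z^-1 - z) *: (invmx (F z) *m V).

Lemma expi_conj (t : R) : (expi t)^*%C = (expi t)^-1.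
Proof.
have h : expi t * (expi t)^*%C = 1.
  by rewrite mulcJ sqr_normcE /= cos2Dsin2.
have e0 : expi t != 0 by apply: contraTneq (oner_neq0 C) => e; rewrite -h e mul0r eqxx.
by apply: (mulfI e0); rewrite h divff.
Qed.

Lemma normc_expi (t : R) : normc (expi t) = 1.
Proof. by rewrite /= cos2Dsin2 sqrtr1. Qed.

Lemma expi_neq0 (t : R) : expi t != 0.
Proof.
by apply: contra_eq_neq (normc_expi t) => ->; rewrite Normc.normc0 eq_sym oner_neq0.
Qed.

Lemma xspecV (z : C) : x z^-1 = x z.
Proof. by rewrite /xspec invrK addrC. Qed.

Lemma xspec_expi (t : R) : x (expi t) = (2 * a * cos t)%:C.
Proof.
rewrite /xspec -expi_conj addcJ /= -[2 in LHS](rmorph_nat (real_complex R)) /= -!rmorphM.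
by congr (_%:C); ring.
Qed.

Lemma Fmx_adj (z : C) : z^*%C = z^-1 -> (F z)^t* = F z^-1.
Proof.
move=> hz; rewrite /Fmx adjmxD adjmxB adjmxZ adjmx_scalar adjmxM adjmxK -hHC xspecV.
congr (_ - _%:M + _ *: _).
  by rewrite /xspec conjcM conjcD conjcV hz conjc_real invrK addrC.
by rewrite conjcM !conjcV conjc_real hz.
Qed.

Lemma Fmx_sub (z : C) : F z - F z^-1 = ((z^-1 - z) / a%:C) *: (V *m V^t* ).
Proof.
by rewrite /Fmx xspecV opprD addrACA subrr add0r invrK -scalerBl -mulrBl.
Qed.

Lemma Fmx_unitV (z : C) : z^*%C = z^-1 -> (F z^-1 \in unitmx) = (F z \in unitmx).
Proof. by move=> hz; rewrite -Fmx_adj // !unitmxE det_adjmx !unitfE conjc_eq0. Qed.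

(** The second resolvent identity, with the difference of the two F a multiple of V times its
    adjoint. Both the unitarity of S and the jump formula rest on it. *)
Lemma invF_sub (z : C) : F z \in unitmx -> F z^-1 \in unitmx ->
  invmx (F z) - invmx (F z^-1) =
  - (((z^-1 - z) / a%:C) *: (invmx (F z) *m V *m V^t* *m invmx (F z^-1))).
Proof.
move=> u1 u2.
rewrite -[X in X - _](mulmxK u2) -[X in _ - X]mul1mx -(mulVmx u1).
rewrite -!mulmxA -mulmxBr -mulmxBl -opprB Fmx_sub mulNmx mulmxN.
by rewrite -scalemxAl -scalemxAr !mulmxA.
Qed.

Lemma Smx_adj (z : C) : z^*%C = z^-1 -> (S z)^t* = S z^-1.
Proof.
move=> hz; rewrite /Smx adjmxD adjmxN adjmx_scalar conjc1 adjmxZ !adjmxM adjmxK.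
rewrite (adjmx_inv (F z)) (Fmx_adj hz) mulmxA.
have -> : ((z^-1 - z) / a%:C)^*%C = (z^-1^-1 - z^-1) / a%:C; last by [].
by rewrite conjcM conjcB !conjcV conjc_real hz.
Qed.

Lemma Ymx_Smx (z : C) : F z \in unitmx -> F z^-1 \in unitmx ->
  Ymx z *m S z^-1 = Ymx z^-1.
Proof.
move=> u1 u2; rewrite /Ymx /Smx invrK -scalemxAl mulmxDr mulmxN mulmx1 -scalemxAr.
rewrite !mulmxA -(opprB z^-1 z) mulNr scaleNr -opprD.
rewrite scaleNr scalerN; congr (- (_ *: _)).
by rewrite scalemxAl -mulmxDl -[X in _ + X]opprK -invF_sub // opprB addrC subrK.
Qed.

(** Write S(z) = -1 + a^-1 V^* Y(z). Since Y(z) S(1/z) = Y(1/z), the product is -S(1/z) + a^-1 V^*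
    Y(1/z), which is 1 by the same formula at 1/z. *)
Lemma Smx_unitary (z : C) : F z \in unitmx -> F z^-1 \in unitmx ->
  S z *m S z^-1 = 1%:M.
Proof.
move=> u1 u2; have h := Ymx_Smx u1 u2.
have SY w : S w = - 1%:M + a%:C^-1 *: (V^t* *m Ymx w).
  rewrite /Smx /Ymx -scalemxAr scalerA mulmxA; congr (_ + _ *: _).
  by rewrite mulrC.
rewrite {1}SY mulmxDl mulNmx mul1mx -scalemxAl -mulmxA h {1}SY opprD opprK.
by rewrite -addrA addNr addr0.
Qed.

Lemma Psi_E (z : C) alpha : Psi q HC V z alpha = (Ymx z *m alpha,
  fun n => z ^+ n.+1 *: alpha + z ^- n.+1 *: (S z *m alpha)).
Proof. by rewrite /Psi /Ymx scalemxAl. Qed.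

Lemma Jop_Psi (z : C) alpha : z != 0 -> F z \in unitmx ->
  J (Psi q HC V z alpha) = x z *: Psi q HC V z alpha.
Proof.
move=> z0 u1; rewrite Psi_E.
have SE : S z *m alpha = - alpha + a%:C^-1 *: (V^t* *m (Ymx z *m alpha)).
  rewrite /Smx /Ymx mulmxDl mulNmx mul1mx -!scalemxAl -scalemxAr scalerA !mulmxA.
  by rewrite (mulrC a%:C^-1).
have FY : F z *m (Ymx z *m alpha) = (z^-1 - z) *: (V *m alpha).
  by rewrite /Ymx -!scalemxAl -scalemxAr !mulmxA mulmxV // mul1mx.
congr pair.
  rewrite /= !expr1 mulmxDr -!scalemxAr SE mulmxDr mulmxN -scalemxAr mulmxA.
  set u := Ymx z *m alpha in FY *.
  move: FY; rewrite /Fmx mulmxDl mulmxBl mul_scalar_mx -scalemxAl => /eqP.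
  rewrite addrAC subr_eq => /eqP FY.
  rewrite -mulmxA in FY.
  rewrite [V *m (V^t* *m u)]mulmxA in FY *.
  set b := V *m V^t* *m u in FY *.
  rewrite -[HC *m _ *m alpha]mulmxA -/u.
  have -> : HC *m u = (z^-1 - z) *: (V *m alpha) + x z *: u - (z^-1 / a%:C) *: b.
    by rewrite -FY addrK.
  apply/matrixP => i j; rewrite !mxE; ring.
apply/funext => -[|m] /=.
  rewrite -!scalerA; apply/matrixP => i j.
  have := congr1 (fun A : 'cV_r => A i j) SE; rewrite !mxE => SEij.
  set s := (\sum__ _) in SEij *; set v := (\sum__ _) in SEij *.
  have -> : v = a%:C * (s + alpha i j) by rewrite SEij; field.
  rewrite /xspec !exprSr !expr0; field.
  by rewrite z0.
apply/matrixP => i j; rewrite !mxE /xspec !exprSr; set s := (\sum__ _).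
by set y := z ^+ m; have y0 : y != 0 by [rewrite expf_neq0]; field; rewrite y0 z0.
Qed.

Definition outgoing (eta : C) (u : 'cV[C]_d) (alpha : 'cV[C]_r) : state :=
  (u, fun n => eta ^- n.+1 *: alpha).

Definition gen_state (u : 'cV[C]_d) (beta : 'cV[C]_r) : state :=
  (u, fun n => if n is 0%N then beta else 0).

Lemma gen_state_finsupp u beta : finsupp (gen_state u beta).
Proof. by exists 1%N => -[]. Qed.

(** The geometric sequence solves the free recursion, so the defect lives at the centre and at the
    first sites. There the absent neighbour eta^0 alpha accounts for the term -a alpha. *)
Lemma Jop_outgoing eta u alpha : eta != 0 ->
  J (outgoing eta u alpha) - x eta *: outgoing eta u alpha =
  gen_state (HC *m u - x eta *: u + eta^-1 *: (V *m alpha)) (V^t* *m u - a%:C *: alpha).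
Proof.
move=> e0; congr pair; first by rewrite /= expr1 -scalemxAr addrAC.
apply/funext => -[|m]; apply/matrixP => i j; rewrite !mxE /xspec !exprSr ?expr0.
  by set s := \sum__ _; field.
by set y := eta ^+ m; have y0 : y != 0 by [rewrite expf_neq0]; field; rewrite y0 e0.
Qed.

Lemma outgoing_inH eta u alpha : 1 < normc eta -> inH (outgoing eta u alpha).
Proof.
move=> he; rewrite inH_series.
have -> : (fun n => vsqnorm ((outgoing eta u alpha).2 n)) =
   geometric (normc eta ^- 2 * vsqnorm alpha) (normc eta ^- 2).
  apply/funext => n; rewrite /= vsqnormZ Normc.normcV -exprVn.
  have nX (w : C) k : normc (w ^+ k) = normc w ^+ k.
    by elim: k => [|k ih]; rewrite ?expr0 ?Normc.normc1 // !exprS Normc.normcM ih.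
  by rewrite nX -!exprVn -exprM mulnC exprM exprS mulrAC.
apply: is_cvg_geometric_series.
have e0 : 0 < normc eta by apply: lt_trans he.
rewrite ger0_norm ?invr_ge0 ?exprn_ge0 ?ltW // invf_lt1 ?exprn_gt0 //.
by rewrite exprn_egt1.
Qed.

(** A kernel vector u of F(eta) makes the outgoing state with alpha = a^-1 V^* u a square-summable
    eigenvector. Its eigenvalue x(eta) is not real, against the symmetry of J. *)
Lemma Fmx_unit (eta : C) : 1 < normc eta -> complex.Im (x eta) != 0 -> F eta \in unitmx.
Proof.
move=> he hI; have e0 : eta != 0.
  by apply: contraTneq he => ->; rewrite Normc.normc0 ltr10.
rewrite -unitmx_tr -row_free_unit; apply/row_freeP.
suff inj (w : 'rV[C]_d) : w *m (F eta)^T = 0 -> w = 0.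
  have /row_freeP // : row_free (F eta)^T.
  rewrite -kermx_eq0; apply/eqP/row_matrixP => i; rewrite row0; apply: inj.
  by rewrite -row_mul mulmx_ker row0.
move=> hw; pose u := w^T.
have Fu : F eta *m u = 0 by apply: trmx_inj; rewrite trmx_mul trmxK hw trmx0.
pose h := outgoing eta u (a%:C^-1 *: (V^t* *m u)).
have hh : inH h := @outgoing_inH _ u _ he.
have Jh : J h = x eta *: h.
  apply/eqP; rewrite -subr_eq0 Jop_outgoing // scalerA divff // scale1r subrr.
  have -> : HC *m u - x eta *: u + eta^-1 *: (V *m (a%:C^-1 *: (V^t* *m u))) = 0.
    by rewrite -Fu /Fmx mulmxDl mulmxBl mul_scalar_mx -scalemxAl -scalemxAr scalerA mulmxA.
  by apply/eqP; congr pair; apply/funext => -[].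
have := ip_Jop q V hHC hh hh; rewrite Jh ipZl // ipZr // ipff // => /eqP.
rewrite -subr_eq0 -mulrBl mulf_eq0 => /orP[|].
  rewrite eq_complex => /andP[_ ] /=; case: (x eta) hI => ? y /= hy.
  by rewrite opprK -mulr2n mulrn_eq0 /= (negbTE hy).
rewrite (inj_eq (@complexI R) _ 0) => /eqP h0.
have := sqnormH_eq0 hh h0; case => u0 _.
by rewrite -[w]trmxK -/u u0 trmx0.
Qed.

End Scattering.

(** * Laurent polynomials and the singular angles *)

Section Laurent.
Variable R : realType.
Local Notation C := R[i].

(** Exponents between -L and L, encoded as z^-L times a polynomial of degree at most 2 L. The
    explicit L matters: it decides later which Fourier coefficients vanish. *)
Definition laurent (L : nat) (h : C -> C) : Prop := exists2 p : {poly C},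
  (size p <= L.*2.+1)%N & forall z, z != 0 -> h z = z ^- L * p.[z].

Lemma laurent_ext L h k : (forall z, z != 0 -> h z = k z) -> laurent L h -> laurent L k.
Proof. by move=> e [p sp hp]; exists p => // z z0; rewrite -e // hp. Qed.

Lemma laurent_cst (c : C) : laurent 0 (fun=> c).
Proof.
exists c%:P; first by rewrite size_polyC; case: eqP.
by move=> z z0; rewrite expr0 invr1 mul1r hornerC.
Qed.

Lemma laurentS L h : laurent L h -> laurent L.+1 h.
Proof.
move=> [p sp hp]; exists (p * 'X).
  apply: (leq_trans (size_polyMleq _ _)); rewrite size_polyX addn2 /= doubleS.
    by apply: (leq_trans _ (leqnSn _)); rewrite ltnS.
by move=> z z0; rewrite hp // hornerMX exprS; field; rewrite z0 expf_neq0.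
Qed.

Lemma laurent_le L M h : (L <= M)%N -> laurent L h -> laurent M h.
Proof.
move=> /subnK <-; elim: (M - L)%N => [|n ih] // hl; rewrite addSn.
by apply: laurentS; exact: ih.
Qed.

Lemma laurentD L h k : laurent L h -> laurent L k -> laurent L (fun z => h z + k z).
Proof.
move=> [p sp hp] [s ss hs]; exists (p + s).
  by apply: (leq_trans (size_polyD _ _)); rewrite geq_max sp ss.
by move=> z z0; rewrite hp // hs // hornerD mulrDr.
Qed.

Lemma laurentM L M h k : laurent L h -> laurent M k ->
  laurent (L + M) (fun z => h z * k z).
Proof.
move=> [p sp hp] [s ss hs]; exists (p * s).
  by apply: (leq_trans (size_polyMleq _ _)); rewrite doubleD; lia.
move=> z z0; rewrite hp // hs // hornerM exprD; field.
by rewrite !expf_neq0.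
Qed.

Lemma laurentZ L c h : laurent L h -> laurent L (fun z => c * h z).
Proof. exact: (laurentM (laurent_cst c)). Qed.

Lemma laurent0 L : laurent L (fun=> 0).
Proof. exact: (laurent_le (leq0n L) (laurent_cst 0)). Qed.

Lemma laurent_sum L I (s : seq I) (P : pred I) (h : I -> C -> C) :
  (forall i, laurent L (h i)) -> laurent L (fun z => \sum_(i <- s | P i) h i z).
Proof.
move=> hh; elim: s => [|i s ih].
  by apply: (laurent_ext _ (laurent0 L)) => z _; rewrite big_nil.
case Pi : (P i).
  by apply: (laurent_ext _ (laurentD (hh i) ih)) => z _; rewrite big_cons Pi.
by apply: (laurent_ext _ ih) => z _; rewrite big_cons Pi.
Qed.

Lemma laurent_prod I (s : seq I) (h : I -> C -> C) :
  (forall i, laurent 1 (h i)) -> laurent (size s) (fun z => \prod_(i <- s) h i z).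
Proof.
move=> hh; elim: s => [|i s ih].
  by apply: (laurent_ext _ (laurent_cst 1)) => z _; rewrite big_nil.
apply: (laurent_ext _ (laurentM (hh i) ih)) => z _.
by rewrite big_cons.
Qed.

Lemma laurent_det n (A : C -> 'M[C]_n) :
  (forall i j, laurent 1 (fun z => A z i j)) -> laurent n (fun z => \det (A z)).
Proof.
move=> hA; apply: laurent_sum => s; apply: laurentZ.
have := @laurent_prod _ (index_enum 'I_n) (fun i z => A z i (perm.fun_of_perm s i)) (fun i => hA i (perm.fun_of_perm s i)).
by rewrite [index_enum _]unlock -enumT size_enum_ord.
Qed.

(** Cofactors are minors of size n - 1. The degree gained leaves room for the factor 1/z - z in
    [laurent_Tmx]. *)
Lemma laurent_adj n (A : C -> 'M[C]_n) i j :
  (forall i j, laurent 1 (fun z => A z i j)) -> laurent n.-1 (fun z => (\adj (A z)) i j).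
Proof.
move=> hA.
apply: (@laurent_ext _ (fun z => (-1) ^+ (j + i) * \det (row' j (col' i (A z))))).
  by move=> z _; rewrite mxE.
apply: laurentZ; apply: laurent_det => k l.
by apply: laurent_ext (hA (lift j k) (lift i l)) => z _; rewrite !mxE.
Qed.

Lemma laurent_id : laurent 1 (fun z => z).
Proof.
exists ('X * 'X); first by rewrite -expr2 size_polyXn.
by move=> z z0; rewrite hornerMX hornerX expr1; field.
Qed.

Lemma laurent_inv : laurent 1 (fun z => z^-1).
Proof.
exists 1; first by rewrite size_poly1.
by move=> z z0; rewrite hornerC expr1 mulr1.
Qed.

Section OfJacobi.
Variables (q d r : nat) (HC : 'M[C]_d) (V : 'M[C]_(d, r)).
Hypothesis hHC : HC = HC^t*.
Hypothesis ha : 0 < ahop R q.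
Hypothesis hd : (0 < d)%N.
Local Notation a := (ahop R q).
Local Notation F := (Fmx q HC V).
Local Notation S := (Smx q HC V).
Local Notation normc := (@Normc.normc R).

Let ac0' : a%:C != 0 :> C.
Proof. by rewrite (inj_eq (@complexI R)) gt_eqF. Qed.

Lemma laurent_Fmx i j : laurent 1 (fun z => F z i j).
Proof.
apply: (@laurent_ext _ (fun z => (HC i j + (- (a%:C *+ (i == j)) * z + (- (a%:C *+ (i == j))) * z^-1)) +
   (a%:C^-1 * (V *m V^t* ) i j) * z^-1)).
  by move=> z _; rewrite /Fmx /xspec !mxE; case: (i == j); rewrite ?mulr1n ?mulr0n; ring.
apply: laurentD; last by apply: laurentZ; exact: laurent_inv.
apply: laurentD; first exact: laurentS (laurent_cst _).
by apply: laurentD; apply: laurentZ; [exact: laurent_id|exact: laurent_inv].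
Qed.

Lemma laurent_detF : laurent d (fun z => \det (F z)).
Proof. exact: laurent_det laurent_Fmx. Qed.

(* [det F] times [S]: a Laurent polynomial, unlike [S]. *)
Definition Tmx (z : C) : 'M[C]_r := - (\det (F z))%:M +
  ((z^-1 - z) / a%:C) *: (V^t* *m \adj (F z) *m V).

Lemma Tmx_Smx (z : C) : F z \in unitmx -> Tmx z = \det (F z) *: S z.
Proof.
move=> u; rewrite /Tmx /Smx scalerDr scalerN scalemx1; congr (_ + _).
have D0 : \det (F z) != 0 by rewrite -unitfE -unitmxE.
rewrite /invmx u -scalemxAr -scalemxAl !scalerA; congr (_ *: _).
by rewrite [in RHS]mulrAC mulfV // mul1r.
Qed.

Lemma laurent_VadjV (A : 'M[C]_(r, d)) (B : 'M[C]_(d, r)) i j :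
  laurent d.-1 (fun z => (A *m \adj (F z) *m B) i j).
Proof.
apply: (@laurent_ext _ (fun z => \sum_l B l j * \sum_k A i k * (\adj (F z)) k l)).
  by move=> z _; rewrite mxE; apply: eq_bigr => l _; rewrite mxE mulrC.
apply: laurent_sum => l; apply: laurentZ; apply: laurent_sum => k; apply: laurentZ.
exact: laurent_adj laurent_Fmx.
Qed.

Lemma laurent_Tmx i j : laurent d (fun z => Tmx z i j).
Proof.
apply: (@laurent_ext _ (fun z => (- ((i == j)%:R : C)) * \det (F z) +
  (a%:C^-1 * z^-1 + (- a%:C^-1) * z) * (V^t* *m \adj (F z) *m V) i j)).
  move=> z _; rewrite /Tmx; move: (V^t* *m _ *m V) => B; rewrite !mxE.
  by case: (i == j); rewrite ?mulr1n ?mulr0n; ring.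
apply: laurentD; first by apply: laurentZ; exact: laurent_detF.
rewrite -[d in laurent d](prednK hd) -add1n; apply: laurentM; last exact: laurent_VadjV.
by apply: laurentD; apply: laurentZ; [exact: laurent_inv|exact: laurent_id].
Qed.

Lemma detF_poly : exists2 p : {poly C}, p != 0 /\ (size p <= d.*2.+1)%N &
  forall z, z != 0 -> \det (F z) = z ^- d * p.[z].
Proof.
have [p sp hp] := laurent_detF; exists p => //; split=> //.
apply/eqP => p0.
(* A point outside the circle where x is not real, so F is invertible there and det F is not
   identically zero. *)
pose z : C := 0 +i* 2.
have zn : 1 < normc z by rewrite /= expr0n add0r sqrtr_sqr ger0_norm // ltr1n.
have z0 : z != 0 by rewrite eq_complex /= eqxx /= pnatr_eq0.
have : F z \in unitmx.
  apply: Fmx_unit => //; rewrite /xspec /=.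
  by rewrite !(mul0r, mulr0, expr0n, oppr0, add0r, addr0) /= gt_eqF //; rewrite mulr_gt0 //; lra.
by rewrite unitmxE hp // p0 horner0 mulr0 unitr0.
Qed.

Lemma expi_inj (s t : R) : angles s -> angles t -> expi s = expi t -> s = t.
Proof.
rewrite /angles /= !in_itv /= => /andP[s0 s1] /andP[t0 t1] [e _].
by apply: (@cos_inj R s t) => //; rewrite in_itv /= !ltW.
Qed.

(** An angle is determined by its point on the circle, so the roots of the polynomial of
    [detF_poly], sent back to angles, exhaust the set. *)
Lemma ThetaF_finite : finite_set (ThetaF q HC V).
Proof.
have [p [p0 _] hp] := detF_poly.
have [rs hrs] : {rs : seq C | forall z, root p z -> z \in rs}.
  have [rs e] := closed_field_poly_normal p; exists rs => z.
  by rewrite e rootZ ?lead_coef_eq0 // root_prod_XsubC.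
apply: (@sub_finite_set _ _ ((fun s => xget 0 [set t : R | angles t /\ expi t = s]) @` [set` rs])).
  move=> t [tA D0]; exists (expi t).
    apply: hrs; rewrite /root; move: D0; rewrite hp ?expi_neq0 // => /eqP.
    by rewrite mulf_eq0 invr_eq0 expf_eq0 (negbTE (expi_neq0 _)) andbF.
  by apply: xget_unique => // s [sA]; exact: expi_inj.
by apply: finite_image; exact: finite_seq.
Qed.

Lemma ThetaF_unit t : angles t -> ~ ThetaF q HC V t -> F (expi t) \in unitmx.
Proof.
move=> tA h; rewrite unitmxE unitfE; apply/eqP => e; exact: h.
Qed.

End OfJacobi.
End Laurent.

(** * Bounds on S and Y along the circle *)

Section BoundedFunctions.
Variables (R : realType) (T : Type).
Local Notation C := R[i].
Local Notation normc := (@Normc.normc R).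

Definition bddC (D : T -> Prop) (h : T -> C) : Prop :=
  exists K : R, forall t, D t -> normc (h t) <= K.

Lemma bddC_cst D c : bddC D (fun=> c).
Proof. by exists (normc c). Qed.

Lemma bddC_ext D h k : (forall t, D t -> h t = k t) -> bddC D h -> bddC D k.
Proof. by move=> e [K hK]; exists K => t Dt; rewrite -e // hK. Qed.

Lemma bddCD D h k : bddC D h -> bddC D k -> bddC D (fun t => h t + k t).
Proof.
move=> [K hK] [L hL]; exists (K + L) => t Dt.
by apply: (le_trans (normcD _ _)); rewrite lerD ?hK ?hL.
Qed.

Lemma bddCM D h k : bddC D h -> bddC D k -> bddC D (fun t => h t * k t).
Proof.
move=> [K hK] [L hL]; exists (K * L) => t Dt.
by rewrite Normc.normcM ler_pM ?normc_ge0 ?hK ?hL.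
Qed.

Lemma bddC_conj D h : bddC D h -> bddC D (fun t => (h t)^*%C).
Proof. by move=> [K hK]; exists K => t Dt; rewrite normc_conj hK. Qed.

Lemma bddC_sum D I (s : seq I) (h : I -> T -> C) :
  (forall i, bddC D (h i)) -> bddC D (fun t => \sum_(i <- s) h i t).
Proof.
move=> hh; elim: s => [|i s ih].
  by apply: (bddC_ext _ (bddC_cst D 0)) => t _; rewrite big_nil.
by apply: (bddC_ext _ (bddCD (hh i) ih)) => t _; rewrite big_cons.
Qed.

End BoundedFunctions.

(** By rank, an invertible A maps the stable row space U onto itself, so U = D U A for some D, and U
    A^-1 = D U. *)
Lemma stable_invmx_ker (K : fieldType) (m n p : nat) (U : 'M[K]_(m, n)) (A : 'M[K]_n) (B : 'M[K]_(n, p)) :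
  A \in unitmx -> (U *m A <= U)%MS -> U *m B = 0 -> U *m invmx A *m B = 0.
Proof.
move=> uA UA UB; have UA' : (U <= U *m A)%MS.
  by rewrite -(geq_leqif (mxrank_leqif_sup UA)) mxrankMfree // row_free_unit.
have [D hD] := submxP UA'.
by rewrite {1}hD -!mulmxA (mulmxA A) mulmxV // mul1mx UB mulmx0.
Qed.

Section BoundedEigenfunctions.
Variables (R : realType) (q d r : nat).
Variables (HC : 'M[R[i]]_d) (V : 'M[R[i]]_(d, r)).
Hypothesis hHC : HC = HC^t*.
Hypothesis ha : 0 < ahop R q.
Local Notation C := R[i].
Local Notation a := (ahop R q).
Local Notation normc := (@Normc.normc R).
Local Notation F := (Fmx q HC V).
Local Notation S := (Smx q HC V).
Local Notation Y := (Ymx q HC V).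
Local Notation x := (xspec (R := R) q).

Let ac0 : a%:C != 0 :> C.
Proof. by rewrite (inj_eq (@complexI R)) gt_eqF. Qed.

Definition regular (t : R) : Prop := F (expi t) \in unitmx.

Lemma regularV t : regular t -> F (expi t)^-1 \in unitmx.
Proof. by move=> h; rewrite Fmx_unitV // expi_conj. Qed.

Lemma Smx_expi_adj t : (S (expi t))^t* = S (expi t)^-1.
Proof. by rewrite Smx_adj // expi_conj. Qed.

Lemma Smx_expi_unitary t : regular t -> S (expi t) *m (S (expi t))^t* = 1%:M.
Proof. by move=> h; rewrite Smx_expi_adj; exact: (Smx_unitary h (regularV h)). Qed.

(** The rows of a unitary matrix have norm 1. *)
Lemma bddC_Smx i j : bddC regular (fun t => S (expi t) i j).
Proof.
exists 1 => t /Smx_expi_unitary h.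
have := congr1 (fun A : 'M[C]_r => A i i) h.
rewrite mxE [RHS]mxE eqxx mulr1n => /(congr1 (@complex.Re R)); rewrite Re_sum => e.
rewrite -(@expr_le1 _ 2) ?normc_ge0 //.
have -> : 1 = \sum_(k < r) normc (S (expi t) i k) ^+ 2.
  by rewrite -[LHS]e; apply: eq_bigr => k _; rewrite adjmxE mulcJ.
by rewrite (bigD1 j) //= lerDl sumr_ge0 // => k _; rewrite sqr_ge0.
Qed.

Lemma bddC_expi : bddC regular (fun t => expi t).
Proof. by exists 1 => t _; rewrite normc_expi. Qed.

Lemma bddC_expiV : bddC regular (fun t => (expi t)^-1).
Proof. by exists 1 => t _; rewrite Normc.normcV normc_expi invr1. Qed.

Lemma VY_S z : V^t* *m Y z = a%:C *: (S z + 1%:M).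
Proof.
rewrite /Ymx /Smx [_ + 1%:M]addrC addrA subrr add0r scalerA -scalemxAr mulmxA.
by rewrite mulrC divfK.
Qed.

(** The equation F Y = (1/z - z) V solved for HC Y: apart from bounded multiples of Y and V only V^*
    Y occurs, which is bounded through S. Hence bounded rows remain bounded after multiplication by
    [HC]. *)
Lemma HY z : F z \in unitmx ->
  HC *m Y z = x z *: Y z + (z^-1 - z) *: V - (z^-1 / a%:C) *: (V *m (V^t* *m Y z)).
Proof.
move=> u; have FY : F z *m Y z = (z^-1 - z) *: V.
  by rewrite /Ymx -scalemxAr mulmxA mulmxV // mul1mx.
rewrite -FY /Fmx mulmxDl mulmxBl mul_scalar_mx -scalemxAl mulmxA.
by rewrite addrA addrK addrC subrK.
Qed.

Definition bdd_rows m (A : 'M[C]_(m, d)) := forall i j, bddC regular (fun t => (A *m Y (expi t)) i j).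

Lemma bdd_rows_mul m n (A : 'M[C]_(m, d)) (B : 'M[C]_(n, m)) : bdd_rows A -> bdd_rows (B *m A).
Proof.
move=> h i j; apply: (@bddC_ext _ _ _ (fun t => \sum_k B i k * (A *m Y (expi t)) k j)).
  by move=> t _; rewrite -mulmxA mxE.
by apply: bddC_sum => k; apply: bddCM; [exact: bddC_cst|exact: h].
Qed.

Lemma bdd_rows_sub m n (A : 'M[C]_(m, d)) (B : 'M[C]_(n, d)) : (B <= A)%MS -> bdd_rows A -> bdd_rows B.
Proof. by move=> /submxP [D ->]; exact: bdd_rows_mul. Qed.

Lemma bdd_rows_col m n (A : 'M[C]_(m, d)) (B : 'M[C]_(n, d)) : bdd_rows A -> bdd_rows B -> bdd_rows (col_mx A B).
Proof.
move=> hA hB i j; rewrite -(splitK i); case: (fintype.split i) => k.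
  apply: bddC_ext (hA k j) => t _; by rewrite mul_col_mx col_mxEu.
apply: bddC_ext (hB k j) => t _; by rewrite mul_col_mx col_mxEd.
Qed.

Lemma bdd_rows_V : bdd_rows (V^t* ).
Proof.
move=> i j; apply: (@bddC_ext _ _ _ (fun t => a%:C * (S (expi t) i j + (i == j)%:R))).
  by move=> t _; rewrite VY_S !mxE.
apply: bddCM; first exact: bddC_cst.
by apply: bddCD; [exact: bddC_Smx|exact: bddC_cst].
Qed.

Lemma bdd_rows_HC m (A : 'M[C]_(m, d)) : bdd_rows A -> bdd_rows (A *m HC).
Proof.
move=> hA i j; apply: (@bddC_ext _ _ _ (fun t =>
   x (expi t) * (A *m Y (expi t)) i j + ((expi t)^-1 + (- 1) * expi t) * (A *m V) i j +
   (- a%:C^-1) * (expi t)^-1 * ((A *m V) *m V^t* *m Y (expi t)) i j)).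
  move=> t rt; rewrite -[in RHS]mulmxA HY //; move: (Y _) => Y0.
  rewrite mulmxBr mulmxDr -!scalemxAr !mulmxA.
  move: (A *m Y0) (A *m V *m _ *m _) => A1 A2; rewrite !mxE; ring.
apply: bddCD; first apply: bddCD.
- apply: bddCM; last exact: hA.
  by apply: bddCM; [exact: bddC_cst|apply: bddCD; [exact: bddC_expi|exact: bddC_expiV]].
- apply: bddCM; last exact: bddC_cst.
  apply: bddCD; first exact: bddC_expiV.
  by apply: bddCM; [exact: bddC_cst|exact: bddC_expi].
- apply: bddCM; last exact: (bdd_rows_mul _ bdd_rows_V).
  by apply: bddCM; [exact: bddC_cst|exact: bddC_expiV].
Qed.

(* The rows w for which w Y is bounded form an HC-invariant space containing the rows of V^*.
   Its orthogonal complement is HC-invariant and annihilates V, hence also F^-1 V. *)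
Lemma bdd_rows_all : bdd_rows 1%:M.
Proof.
(* Row spaces with bounded product are closed under sums, so one of maximal rank contains all
   others. *)
have [K BK Kmax] : exists2 K : 'M[C]_d, bdd_rows K & forall m (A : 'M[C]_(m, d)), bdd_rows A -> (A <= K)%MS.
  pose P n := `[< exists2 K : 'M[C]_d, bdd_rows K & \rank K = n >].
  have P0 : exists n, P n.
    exists 0%N; apply/asboolP; exists 0; last by rewrite mxrank0.
    move=> i j; apply: (bddC_ext _ (bddC_cst _ 0)) => t _; by rewrite mul0mx mxE.
  have Pd n : P n -> (n <= d)%N by move=> /asboolP [K _ <-]; exact: rank_leq_row.
  have [n /asboolP [K BK rK] nmax] := ex_maxnP P0 Pd.
  exists K => // m A BA.
  have BKA : bdd_rows (K + A)%MS.
    by apply: (bdd_rows_sub _ (bdd_rows_col BK BA)); rewrite addsmxE.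
  have rKA : (\rank (K + A)%MS <= \rank K)%N.
    by rewrite rK; apply: nmax; apply/asboolP; exists (K + A)%MS.
  have e : (K == K + A)%MS.
    by rewrite -(geq_leqif (mxrank_leqif_eq (addsmxSl K A))).
  by move/eqmxP: e => e; rewrite e addsmxSr.
suff K1 : (1%:M <= K)%MS by exact: bdd_rows_sub K1 BK.
pose U := kermx (K^t* ).
have UK : U *m K^t* = 0 by exact: mulmx_ker.
have sub0 m (A : 'M[C]_(m, d)) : (A <= K)%MS -> U *m A^t* = 0.
  by move=> /submxP [D ->]; rewrite adjmxM mulmxA UK mul0mx.
have UV : U *m V = 0 by rewrite -[V]adjmxK; apply: sub0; apply: Kmax; exact: bdd_rows_V.
have UHC : (U *m HC <= U)%MS.
  apply/sub_kermxP; rewrite -mulmxA [HC *m _](_ : _ = (K *m HC)^t* ); last by rewrite adjmxM -hHC.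
  by apply: sub0; apply: Kmax; exact: bdd_rows_HC.
have UY t : regular t -> U *m Y (expi t) = 0.
  move=> rt; have UF : (U *m F (expi t) <= U)%MS.
    rewrite /Fmx mulmxDr mulmxBr mul_mx_scalar -scalemxAr mulmxA UV mul0mx scaler0 addr0.
    by rewrite addmx_sub // eqmx_opp scalemx_sub.
  by rewrite /Ymx -scalemxAr mulmxA (stable_invmx_ker rt UF UV) scaler0.
(* Since U Y = 0, the rows of the complement U are themselves bounded; they lie in K and are
   orthogonal to themselves. *)
have BU : bdd_rows U by move=> i j; apply: (bddC_ext _ (bddC_cst _ 0)) => t rt; rewrite UY // mxE.
have UU : U *m U^t* = 0 by apply: sub0; exact: Kmax.
have U0 : U = 0.
  apply/matrixP => i j; have := congr1 (fun A : 'M[C]_d => A i i) UU.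
  rewrite mxE [RHS]mxE => /(congr1 (@complex.Re R)); rewrite Re_sum => /eqP.
  rewrite psumr_eq0 => [/allP h|k _]; last by rewrite adjmxE mulcJ /= sqr_ge0.
  rewrite [RHS]mxE; apply: Normc.eq0_normc; apply/eqP.
  by have := h j (mem_index_enum j); rewrite adjmxE mulcJ /= sqrf_eq0.
have : row_free (K^t* ) by rewrite -kermx_eq0 -/U U0.
rewrite row_free_unit map_unitmx unitmx_tr => uK.
by rewrite sub1mx row_full_unit.
Qed.

Lemma bddC_Ymx i j : bddC regular (fun t => Y (expi t) i j).
Proof. by apply: bddC_ext (bdd_rows_all i j) => t _; rewrite mul1mx. Qed.

End BoundedEigenfunctions.

(** * Boundary values of the resolvent *)

Section FinsuppInduction.
Variables (R : realType) (q d r : nat).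
Variables (HC : 'M[R[i]]_d) (V : 'M[R[i]]_(d, r)).
Hypothesis ha : 0 < ahop R q.
Local Notation C := R[i].
Local Notation state := (state R d r).
Local Notation J := (Jop q HC V).
Local Notation a := (ahop R q).

Let ac0 : a%:C != 0 :> C.
Proof. by rewrite (inj_eq (@complexI R)) gt_eqF. Qed.

Definition delta (n : nat) (beta : 'cV[C]_r) : state :=
  (0, fun k => if k == n then beta else 0).

Lemma delta_finsupp n beta : finsupp (delta n beta).
Proof. by exists n.+1 => k; rewrite /= => /gtn_eqF ->. Qed.

Lemma stateD2 (f g : state) n : (f + g).2 n = f.2 n + g.2 n.
Proof. by []. Qed.

Lemma stateZ2 c (f : state) n : (c *: f).2 n = c *: f.2 n.
Proof. by []. Qed.

Lemma Jop_delta0 beta : J (delta 0 beta) = gen_state (V *m beta) 0 + a%:C *: delta 1 beta.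
Proof.
congr pair; first by rewrite /= mulmx0 scaler0 add0r addr0.
apply/funext => n; rewrite -[LHS]/((J (delta 0 beta)).2 n) -[RHS]/((_ + _ : state).2 n).
by rewrite stateD2 stateZ2; case: n => [|[|m]]; rewrite /= ?mulmx0 ?scaler0 ?add0r ?addr0 ?scaler0.
Qed.

Lemma Jop_deltaS n beta : J (delta n.+1 beta) = a%:C *: delta n beta + a%:C *: delta n.+2 beta.
Proof.
congr pair; first by rewrite /= !mulmx0 scaler0 !addr0.
apply/funext => k; rewrite -[LHS]/((J (delta n.+1 beta)).2 k) -[RHS]/((_ + _ : state).2 k).
rewrite stateD2 !stateZ2; case: k => [|m] /=.
  by rewrite mulmx0 scaler0 !addr0; case: n.
by rewrite scalerDr addrC; congr (_ *: _ + _ *: _).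
Qed.

Lemma finsupp_decomp (f : state) N : (forall n, (N <= n)%N -> f.2 n = 0) ->
  f = gen_state f.1 0 + \sum_(n < N) delta n (f.2 n).
Proof.
move=> h; have e1 : (\sum_(n < N) delta n (f.2 n)).1 = 0.
  by rewrite (big_morph (@fst _ _) (id1 := 0) (op1 := +%R)) // big1.
have e2 k : (\sum_(n < N) delta n (f.2 n)).2 k = \sum_(n < N) (delta n (f.2 n)).2 k.
  exact: (big_morph (fun g : state => g.2 k)).
case: f h e1 e2 => u g /= h e1 e2; congr pair; first by rewrite e1 addr0.
apply/funext => k; rewrite -[RHS]/(_ + _) e2.
have -> : (gen_state u (0 : 'cV[C]_r)).2 k = 0 by case: k.
rewrite add0r; case: (ltnP k N) => kN.
  rewrite (bigD1 (Ordinal kN)) //= eqxx big1 ?addr0 // => j jk.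
  by case: eqP => // e; case/eqP: jk; apply: val_inj.
rewrite h // big1 // => j _ /=; case: eqP => // e; have := ltn_ord j; lia.
Qed.

(* Finitely supported vectors form the module over polynomials in J generated by C^d and the
   first sites of the half-lines. *)
Lemma finsupp_ind (P : state -> Prop) :
  (forall u beta, P (gen_state u beta)) ->
  (forall f g, finsupp f -> finsupp g -> P f -> P g -> P (f + g)) ->
  (forall c f, finsupp f -> P f -> P (c *: f)) ->
  (forall f, finsupp f -> P f -> P (J f)) ->
  forall f, finsupp f -> P f.
Proof.
move=> Pg PD PZ PJ.
(* Two consecutive sites are carried along because J applied to one site reaches both neighbours. *)
have Pd : forall n beta, P (delta n beta) /\ P (delta n.+1 beta).
  elim=> [|n ih] beta.
    have P0 : P (delta 0 beta).
      rewrite (_ : delta 0 beta = gen_state 0 beta); first exact: Pg.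
      by congr pair; apply/funext => -[|].
    split=> //.
    have -> : delta 1 beta = a%:C^-1 *: (J (delta 0 beta) + (-1) *: gen_state (V *m beta) 0).
      by rewrite Jop_delta0 scaleN1r addrC addKr scalerA mulVf // scale1r.
    have f0 := delta_finsupp 0 beta; have fg := gen_state_finsupp (V *m beta) (0 : 'cV[C]_r).
    apply: (PZ); first by apply: finsuppD; [exact: Jop_finsupp|exact: finsuppZ].
    apply: (PD); [exact: Jop_finsupp|exact: finsuppZ|exact: PJ|].
    by apply: (PZ) => //; exact: Pg.
  have [P0 P1] := ih beta; split=> //.
  have -> : delta n.+2 beta = a%:C^-1 *: J (delta n.+1 beta) + (-1) *: delta n beta.
    by rewrite Jop_deltaS scalerDr !scalerA mulVf // !scale1r scaleN1r addrC addKr.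
  have f0 := delta_finsupp n beta; have f1 := delta_finsupp n.+1 beta.
  apply: (PD); [by apply: finsuppZ; exact: Jop_finsupp|exact: finsuppZ| |by apply: (PZ)].
  by apply: (PZ); [exact: Jop_finsupp|exact: PJ].
move=> f ff; have [N h] := ff; rewrite (finsupp_decomp h).
apply: (PD); [exact: gen_state_finsupp|by apply: finsupp_sum => i; exact: delta_finsupp|exact: Pg|].
have [] // : finsupp (\sum_(n < N) delta n (f.2 n)) /\ P (\sum_(n < N) delta n (f.2 n)).
elim/big_ind: _ => [|g1 g2 [? ?] [? ?]|i _].
- split; first exact: finsupp0.
  by rewrite -(scale0r (gen_state 0 0)); apply: (PZ); [exact: gen_state_finsupp|exact: Pg].
- by split; [exact: finsuppD|exact: PD].
- by split; [exact: delta_finsupp|exact: (proj1 (Pd _ _))].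
Qed.

End FinsuppInduction.

Section Resolvent.
Variables (R : realType) (q d r : nat).
Variables (HC : 'M[R[i]]_d) (V : 'M[R[i]]_(d, r)).
Hypothesis hHC : HC = HC^t*.
Hypothesis ha : 0 < ahop R q.
Local Notation C := R[i].
Local Notation normc := (@Normc.normc R).
Local Notation state := (state R d r).
Local Notation J := (Jop q HC V).
Local Notation a := (ahop R q).
Local Notation F := (Fmx q HC V).
Local Notation x := (xspec (R := R) q).

Let ac0 : a%:C != 0 :> C.
Proof. by rewrite (inj_eq (@complexI R)) gt_eqF. Qed.

Definition solves (z : C) (f h : state) := inH h /\ J h - z *: h = f.

Lemma eigenvalue_real (z : C) (h : state) : inH h -> J h = z *: h -> h <> 0 -> complex.Im z = 0.
Proof.
move=> hh Jh h0; have := ip_Jop q V hHC hh hh; rewrite Jh ipZl // ipZr // ipff // => /eqP.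
rewrite -subr_eq0 -mulrBl mulf_eq0 => /orP[|].
  rewrite eq_complex => /andP[_ ] /=; case: z {Jh} => ? y /=.
  by rewrite opprK -mulr2n mulrn_eq0 /= => /eqP.
rewrite (inj_eq (@complexI R) _ 0) => /eqP h1.
by case: h0; exact: sqnormH_eq0.
Qed.

Lemma solves_inj (z : C) f h k : complex.Im z != 0 -> solves z f h -> solves z f k -> h = k.
Proof.
move=> z0 [hh eh] [hk ek]; apply: contrapT => hk0.
case/eqP: z0; apply: (eigenvalue_real (inHB hh hk) _ (fun e => hk0 (subr0_eq e))).
apply/eqP; rewrite -subr_eq0 JopB scalerBr opprB addrACA [- J k + _]addrC.
by rewrite addrACA eh -(opprB (J k)) ek subrr.
Qed.

Lemma resolventE (z : C) f h : complex.Im z != 0 -> solves z f h -> resolvent q HC V z f = h.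
Proof. by move=> z0 hs; apply: xget_unique => // k hk; exact: solves_inj z0 hk hs. Qed.

(** The two components of [Jop_outgoing] solved for u and alpha: inserting alpha = [gen_out] into
    the central equation leaves F(eta) u = f0 + (eta^-1 / a) V beta. *)
Definition gen_sol (eta : C) (f0 : 'cV[C]_d) (beta : 'cV[C]_r) : 'cV[C]_d :=
  invmx (F eta) *m (f0 + (eta^-1 / a%:C) *: (V *m beta)).

Definition gen_out (eta : C) (f0 : 'cV[C]_d) (beta : 'cV[C]_r) : 'cV[C]_r :=
  a%:C^-1 *: (V^t* *m gen_sol eta f0 beta - beta).

Lemma solves_gen eta f0 beta : 1 < normc eta -> complex.Im (x eta) != 0 ->
  solves (x eta) (gen_state f0 beta)
    (outgoing eta (gen_sol eta f0 beta) (gen_out eta f0 beta)).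
Proof.
move=> he hI; have e0 : eta != 0.
  by apply: contraTneq he => ->; rewrite Normc.normc0 ltr10.
have uF := @Fmx_unit _ _ _ _ HC V hHC ha _ he hI.
split; first exact: outgoing_inH.
rewrite Jop_outgoing //; congr gen_state; last first.
  by rewrite /gen_out scalerA divff // scale1r subKr.
have : F eta *m gen_sol eta f0 beta = f0 + (eta^-1 / a%:C) *: (V *m beta).
  by rewrite mulmxA mulmxV // mul1mx.
rewrite /gen_out; move: (gen_sol _ _ _) => u.
rewrite /Fmx mulmxDl mulmxBl mul_scalar_mx -scalemxAl -mulmxA => e.
rewrite -scalemxAr mulmxBr scalerA scalerBr addrA e addrK //.
Qed.

Lemma solvesD z f g h k : solves z f h -> solves z g k -> solves z (f + g) (h + k).
Proof.
move=> [hh <-] [hk <-]; split; first exact: inHD.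
by rewrite JopD scalerDr opprD addrACA.
Qed.

Lemma solvesZ z c f h : solves z f h -> solves z (c *: f) (c *: h).
Proof.
move=> [hh <-]; split; first exact: inHZ.
by rewrite JopZ scalerBr !scalerA [z * c]mulrC.
Qed.

(** The identity R(z) J f = f + z R(z) f. *)
Lemma solvesJ z f h : inH f -> solves z f h -> solves z (J f) (f + z *: h).
Proof.
move=> hf [hh eh]; split; first by apply: inHD => //; exact: inHZ.
rewrite JopD JopZ scalerDr opprD addrACA -scalerBr eh.
by rewrite -addrA addNr addr0.
Qed.

Lemma solves_ex eta f : 1 < normc eta -> complex.Im (x eta) != 0 -> finsupp f ->
  exists h, solves (x eta) f h.
Proof.
move=> he hI ff; pattern f; apply: (@finsupp_ind _ q _ _ HC V ha) ff.
- by move=> u beta; eexists; exact: solves_gen.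
- by move=> {}f g _ _ [h hh] [k hk]; exists (h + k); exact: solvesD.
- by move=> c {}f _ [h hh]; exists (c *: h); exact: solvesZ.
- by move=> {}f ff [h hh]; exists (f + x eta *: h); apply: solvesJ => //; exact: finsupp_inH.
Qed.

(* The outer root of eta + 1/eta = z/a stays close to e^{it} because
   (eta - e^{it}) (eta - e^{-it}) = i e eta / a while |eta - e^{-it}| >= sin t. *)
Lemma outer_root (t : R) : angles t -> exists K : R, forall e, 0 < e -> e <= 1 ->
  exists eta : C, [/\ 1 < normc eta, x eta = (2 * a * cos t) +i* e
    & normc (eta - expi t) <= K * e].
Proof.
rewrite /angles /= in_itv /= => /andP[t0 tpi].
have st : 0 < sin t by apply: sin_gt0_pi; rewrite t0 tpi.
(* For e <= 1 one has |eta| <= |z| / a + |1/eta| <= (2 a + 1) / a + 1 = 3 + 1/a; the division by sin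
   t comes from the distance to the other root. *)
exists ((3 + a^-1) / (a * sin t)) => e e0 e1.
pose z : C := (2 * a * cos t) +i* e.
have [eta0 [n0 q0]] : exists eta : C, eta != 0 /\ x eta = z.
  pose w := z / a%:C; pose s := sqrtc (w ^+ 2 - 4).
  have s2 : s ^+ 2 = w ^+ 2 - 4 by rewrite sqr_sqrtc.
  pose y := (w + s) / 2.
  have yq : y * (w - y) = 1.
    rewrite /y; have -> : (w + s) / 2 * (w - (w + s) / 2) = (w ^+ 2 - s ^+ 2) / 4 by field.
    by rewrite s2; field.
  have y0 : y != 0 by apply: contra_eq_neq yq => ->; rewrite mul0r eq_sym oner_neq0.
  exists y; split=> //; rewrite /xspec.
  have -> : y^-1 = w - y by apply: (mulfI y0); rewrite yq divff.
  by rewrite addrC subrK /w mulrC divfK.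
(* On the unit circle x is real, whereas the imaginary part e is positive. So one of the root and
   its inverse lies strictly outside. *)
have n1 : normc eta0 != 1.
  apply/eqP => h1; have hc : eta0^*%C = eta0^-1.
    apply: (mulfI n0); rewrite mulcJ h1 expr1n divff //.
  have : complex.Im (x eta0) = e by rewrite q0.
  rewrite /xspec -hc; case: (eta0) => b c /=; rewrite mul0r addr0 addrN mulr0 => h2.
  by rewrite -h2 ltxx in e0.
have [eta [he qe]] : exists eta : C, 1 < normc eta /\ x eta = z.
  case: (ltP 1 (normc eta0)) => h1; first by exists eta0.
  exists eta0^-1; rewrite xspecV; split=> //; rewrite Normc.normcV invf_gt1.
    by rewrite lt_neqAle n1.
  by rewrite lt_neqAle normc_ge0 andbT eq_sym; apply: contra n0 => /eqP/Normc.eq0_normc ->.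
exists eta; split=> //.
have et0 : eta != 0 by apply: contraTneq he => ->; rewrite Normc.normc0 ltr10.
have ne0 : 0 < normc eta by apply: lt_trans he.
have prodE : (eta - expi t) * (eta - (expi t)^-1) = ((0 +i* e) / a%:C) * eta.
  have -> : (eta - expi t) * (eta - (expi t)^-1) =
     (a%:C * (eta + eta^-1) - a%:C * (expi t + (expi t)^-1)) / a%:C * eta.
    by field; rewrite et0 ac0 expi_neq0.
  rewrite -[a%:C * (eta + _)]/(x eta) -[a%:C * (expi t + _)]/(x (expi t)) qe xspec_expi.
  by congr (_ / _ * _); rewrite /z; apply/eqP; rewrite eq_complex /= subrr oppr0 addr0 !eqxx.
(* Im x(eta) = a (1 - |eta|^-2) Im eta places eta in the upper half plane, at distance at least sin
   t from e^{-it}. *)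
have Imeta : 0 < complex.Im eta.
  have : complex.Im (x eta) = e by rewrite qe.
  have -> : x eta = a%:C * (eta + (normc eta ^- 2)%:C * eta^*%C).
    rewrite /xspec; congr (_ * (_ + _)); apply: (mulfI et0).
    rewrite divff // mulrCA mulcJ -rmorphM mulVf // expf_neq0 // gt_eqF //.
  case: (eta) he => b c he /=.
  rewrite !(mul0r, addr0) => h.
  have : 0 < a * (c + normc (b +i* c) ^- 2 * - c) by move: h; rewrite /= => ->.
  rewrite pmulr_rgt0 // mulrN -{1}(mul1r c) -mulrBl.
  rewrite pmulr_rgt0 // subr_gt0 invf_lt1 ?exprn_gt0 //; last by apply: lt_trans he.
  by rewrite exprn_egt1.
have low : sin t <= normc (eta - (expi t)^-1).
  apply: le_trans (Im_le_normc _); rewrite -expi_conj.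
  case: (eta) Imeta => b c /= c0; rewrite opprK ger0_norm; last by rewrite addr_ge0 ?ltW.
  by rewrite lerDr ltW.
have up : normc eta <= 3 + a^-1.
  have -> : eta = z / a%:C - eta^-1.
    by rewrite -qe /xspec mulrC mulKf // addrK.
  apply: (le_trans (normcD _ _)).
  have -> : normc (- eta^-1) = normc eta^-1 by exact: normcN.
  rewrite Normc.normcV Normc.normcM Normc.normcV normc_real (gtr0_norm ha).
  have hz : normc z <= 2 * a + 1.
    apply: (le_trans (normc_le_ReIm _)); rewrite /= (gtr0_norm e0) lerD //.
    rewrite normrM gtr0_norm ?mulr_gt0 // -[X in _ <= X]mulr1 ler_wpM2l ?mulr_ge0 ?(ltW ha) //.
    by rewrite ler_norml cos_geN1 cos_le1.
  have h1 : (normc eta)^-1 <= 1 by rewrite invf_le1 // ltW.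
  have h2 : normc z / a <= 2 + a^-1.
    by rewrite ler_pdivrMr // mulrDl mulVf ?gt_eqF.
  by lra.
have nE : normc (eta - expi t) * normc (eta - (expi t)^-1) = e / a * normc eta.
  rewrite -Normc.normcM prodE !Normc.normcM Normc.normcV normc_real (gtr0_norm ha).
  by rewrite /= expr0n add0r sqrtr_sqr gtr0_norm.
rewrite -mulrA mulrC -(ler_pM2r st) -mulrA mulrAC -mulrA.
apply: (@le_trans _ _ (normc (eta - expi t) * normc (eta - (expi t)^-1))).
  by rewrite ler_wpM2l // normc_ge0.
rewrite nE.
have -> : (a * sin t)^-1 * ((3 + a^-1) * sin t * e) = e / a * (3 + a^-1).
  by field; rewrite !gt_eqF.
by rewrite ler_wpM2l // divr_ge0 // ltW.
Qed.

End Resolvent.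

Section TendsC.
Variables (R : realType) (T : Type) (E : set_system T).
Context {FE : Filter E}.
Local Notation C := R[i].

Definition tendsC (f : T -> C) (l : C) : Prop := (f x : C^o) @[x --> E] --> (l : C^o).

Lemma tendsC_cst c : tendsC (fun=> c) c.
Proof. exact: cvg_cst. Qed.

Lemma tendsC_D f g k l : tendsC f k -> tendsC g l -> tendsC (fun x => f x + g x) (k + l).
Proof. exact: cvgCD. Qed.

Lemma tendsC_M f g k l : tendsC f k -> tendsC g l -> tendsC (fun x => f x * g x) (k * l).
Proof. exact: cvgCM. Qed.

Lemma tendsC_conj f l : tendsC f l -> tendsC (fun x => (f x)^*%C) (l^*%C).
Proof. exact: cvgC_conj. Qed.

Lemma tendsC_near f g l : (\forall x \near E, g x = f x) -> tendsC g l -> tendsC f l.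
Proof. by move=> h; apply: cvg_trans; exact: near_eq_cvg. Qed.

Lemma tendsC_ext f g l : g =1 f -> tendsC g l -> tendsC f l.
Proof. by move=> h; apply: tendsC_near; apply: filterE => x; rewrite h. Qed.

Lemma tendsC_V f l : l != 0 -> tendsC f l -> tendsC (fun x => (f x)^-1) (l^-1).
Proof. by move=> l0; exact: (@cvgV C). Qed.

Lemma tendsC_X f l n : tendsC f l -> tendsC (fun x => f x ^+ n) (l ^+ n).
Proof.
move=> h; elim: n => [|n ih].
  by apply: (@tendsC_ext _ (fun=> 1)); [move=> x; rewrite expr0|rewrite expr0; exact: tendsC_cst].
by rewrite exprS; apply: (@tendsC_ext _ (fun x => f x * f x ^+ n)); [move=> x; rewrite exprS|exact: tendsC_M].
Qed.

Lemma tendsC_sum (I : Type) (s : seq I) (f : I -> T -> C) (l : I -> C) :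
  (forall i, tendsC (f i) (l i)) -> tendsC (fun x => \sum_(i <- s) f i x) (\sum_(i <- s) l i).
Proof. exact: cvgC_sum. Qed.

Lemma tendsC_laurent L (h : C -> C) (f : T -> C) (l : C) :
  laurent L h -> l != 0 -> (\forall e \near E, f e != 0) ->
  tendsC f l -> tendsC (fun x => h (f x)) (h l).
Proof.
move=> [p _ hp] l0 f0 hf; rewrite (hp l l0).
apply: (@tendsC_near _ (fun e => (f e) ^- L * p.[f e])).
  by apply: filterS f0 => e fe; rewrite hp.
apply: tendsC_M; first by apply: tendsC_V; [rewrite expf_neq0|exact: tendsC_X].
rewrite horner_coef; apply: (@tendsC_ext _ (fun e => \sum_(i < size p) p`_i * f e ^+ i)).
  by move=> e; rewrite horner_coef.
by apply: tendsC_sum => k; apply: tendsC_M; [exact: tendsC_cst|exact: tendsC_X].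
Qed.

Definition mcvg m n (A : T -> 'M[C]_(m, n)) (B : 'M[C]_(m, n)) :=
  forall i j, tendsC (fun e => A e i j) (B i j).

Lemma mcvg_cst m n (A : 'M[C]_(m, n)) : mcvg (fun=> A) A.
Proof. by move=> i j; exact: tendsC_cst. Qed.

Lemma mcvgD m n (A A' : T -> 'M[C]_(m, n)) B B' :
  mcvg A B -> mcvg A' B' -> mcvg (fun e => A e + A' e) (B + B').
Proof.
by move=> h h' i j; rewrite mxE; apply: tendsC_ext (tendsC_D (h i j) (h' i j)) => e; rewrite mxE.
Qed.

Lemma mcvgZ m n (c : T -> C) c0 (A : T -> 'M[C]_(m, n)) B :
  tendsC c c0 -> mcvg A B -> mcvg (fun e => c e *: A e) (c0 *: B).
Proof.
by move=> h h' i j; rewrite mxE; apply: tendsC_ext (tendsC_M h (h' i j)) => e; rewrite mxE.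
Qed.

Lemma mcvgM m n p (A : T -> 'M[C]_(m, n)) (A' : T -> 'M[C]_(n, p)) B B' :
  mcvg A B -> mcvg A' B' -> mcvg (fun e => A e *m A' e) (B *m B').
Proof.
move=> h h' i j; rewrite mxE; apply: (@tendsC_ext _ (fun e => \sum_k A e i k * A' e k j)).
  by move=> e; rewrite mxE.
by apply: tendsC_sum => k; exact: tendsC_M.
Qed.

Lemma tendsC_dotc m (v : T -> 'cV[C]_m) v0 w :
  mcvg v v0 -> tendsC (fun e => dotc (v e) w) (dotc v0 w).
Proof.
by move=> h; apply: tendsC_sum => i; apply: tendsC_M; [exact: h|exact: tendsC_cst].
Qed.

End TendsC.

Section BoundaryValues.
Variables (R : realType) (q d r : nat).
Variables (HC : 'M[R[i]]_d) (V : 'M[R[i]]_(d, r)).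
Hypothesis hHC : HC = HC^t*.
Hypothesis ha : 0 < ahop R q.
Local Notation C := R[i].
Local Notation normc := (@Normc.normc R).
Local Notation state := (state R d r).
Local Notation J := (Jop q HC V).
Local Notation a := (ahop R q).
Local Notation F := (Fmx q HC V).
Local Notation x := (xspec (R := R) q).

Let ac0 : a%:C != 0 :> C.
Proof. by rewrite (inj_eq (@complexI R)) gt_eqF. Qed.

#[local] Opaque ip resolvent Fmx determinant.

(** By Cramer's rule the entries of the inverse are quotients of Laurent polynomials. *)
Lemma mcvg_invF (T : Type) (E : set_system T) {FE : Filter E} (f : T -> C) (l : C) :
  l != 0 -> F l \in unitmx -> (\forall e \near E, f e != 0) ->
  (\forall e \near E, F (f e) \in unitmx) ->
  tendsC E f l -> mcvg E (fun e => invmx (F (f e))) (invmx (F l)).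
Proof.
move=> l0 ul f0 uf hf i j.
have iE (w : C) : F w \in unitmx -> invmx (F w) i j = (\det (F w))^-1 * (\adj (F w)) i j.
  by move=> uw; rewrite /invmx uw mxE.
apply: (@tendsC_near _ _ _ _ _ (fun e => (\det (F (f e)))^-1 * (\adj (F (f e))) i j)).
  by apply: filterS uf => e ue; rewrite (iE _ ue).
rewrite (iE l ul); apply: tendsC_M.
  apply: tendsC_V; first by rewrite -unitfE -unitmxE.
  exact: (tendsC_laurent (laurent_detF q HC V) l0 f0 hf).
have hl : laurent d.-1 (fun w => (\adj (F w)) i j).
  by apply: laurent_adj => k k'; exact: laurent_Fmx.
exact: (tendsC_laurent hl l0 f0 hf).
Qed.

Section AtAngle.
Variable t : R.
Hypothesis tA : angles t.
Hypothesis treg : regular q HC V t.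
Local Notation zt := (expi t).
Local Notation lam := (2 * a * cos t).

Definition upper (f g : state) (L : C) :=
  tendsC 0^'+ (fun e => ip (resolvent q HC V (lam +i* e) f) g) (L).

(** Chooses an outer root for each small e. The linear bound of [outer_root] makes the choice
    converge to e^{it}, so statements about the resolvent may be proved in terms of eta alone. *)
Lemma near_root (P : R -> C -> Prop) :
  (forall e eta, 0 < e -> 1 < normc eta -> x eta = lam +i* e -> P e eta) ->
  exists eta : R -> C, tendsC 0^'+ eta zt /\
    \forall e \near 0^'+, P e (eta e).
Proof.
move=> hP; have [K hK] := outer_root ha tA.
pose Q e (eta : C) := [/\ 1 < normc eta, x eta = lam +i* e & normc (eta - zt) <= K * e].
pose eta e := xget 0 [set y : C | Q e y].
have He e : 0 < e -> e <= 1 -> Q e (eta e).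
  move=> e0 e1; have [y hy] := hK e e0 e1.
  exact: (@xgetPex _ 0 [set y : C | Q e y] (ex_intro _ y hy)).
have n1 : \forall e \near (0 : R)^'+, 0 < e /\ e <= 1.
  near=> e; split; [by near: e; exact: nbhs_right_gt|by near: e; exact: nbhs_right_le].
exists eta; split; last first.
  by apply: filterS n1 => e [e0 e1]; have [h1 h2 _] := He e e0 e1; exact: hP.
apply/cvgC_normc.
apply: (@squeeze_cvgr _ _ _ _ (fun=> 0) (fun e => K * e)).
- by apply: filterS n1 => e [e0 e1]; rewrite normc_ge0; have [_ _ ->] := He e e0 e1.
- exact: cvg_cst.
- suff : K * e @[e --> (0 : R)^'+] --> K * 0 by rewrite mulr0.
  by apply: cvgMr; apply: cvg_at_right_filter; exact: cvg_id.
Unshelve. all: by end_near. Qed.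

Lemma Im_lam e : 0 < e -> complex.Im (lam +i* e) != 0.
Proof. by move=> e0; rewrite gt_eqF. Qed.

Lemma solves_upper : \forall e \near (0 : R)^'+, forall f, finsupp f ->
  exists h, solves q HC V (lam +i* e) f h.
Proof.
suff [eta [_ h]] : exists eta : R -> C, tendsC 0^'+ eta zt /\ \forall e \near 0^'+,
    forall f, finsupp f -> exists h, solves q HC V (lam +i* e) f h by exact: h.
apply: (near_root (P := fun e _ => forall f, finsupp f ->
  exists h, solves q HC V (lam +i* e) f h)).
move=> e eta e0 he qe f ff; rewrite -qe; apply: solves_ex => //.
by rewrite qe; exact: Im_lam.
Qed.

Lemma solves_lower : \forall e \near (0 : R)^'+, forall f, finsupp f ->
  exists h, solves q HC V (lam -i* e) f h.
Proof.
suff [eta [_ h]] : exists eta : R -> C, tendsC 0^'+ eta zt /\ \forall e \near 0^'+,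
    forall f, finsupp f -> exists h, solves q HC V (lam -i* e) f h by exact: h.
apply: (near_root (P := fun e _ => forall f, finsupp f ->
  exists h, solves q HC V (lam -i* e) f h)).
move=> e eta e0 he qe f ff.
have qe' : x (eta^*%C) = lam -i* e.
  rewrite -[RHS]/((lam +i* e)^*%C) -qe /xspec conjcM conjcD conjcV conjc_real //.
rewrite -qe'; apply: solves_ex => //; first by rewrite normc_conj.
by rewrite qe' /= oppr_eq0 gt_eqF.
Qed.

Lemma near_pos : \forall e \near (0 : R)^'+, 0 < e.
Proof. exact: nbhs_right_gt. Qed.

Lemma lower_conj f g L : finsupp f -> finsupp g -> upper g f L ->
  tendsC 0^'+ (fun e => ip (resolvent q HC V (lam -i* e) f) g) (L^*%C).
Proof.
move=> ff fg hL.
apply: (@tendsC_near _ _ _ _ _ (fun e => (ip (resolvent q HC V (lam +i* e) g) f)^*%C)).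
  have := solves_upper; have := solves_lower; have := near_pos.
  apply: filterS3 => e e0 hl hu; have [h hh] := hl f ff; have [k hk] := hu g fg.
  rewrite (@resolventE _ _ _ _ HC V hHC _ _ k (Im_lam e0)) //.
  rewrite (@resolventE _ _ _ _ HC V hHC (lam -i* e) _ h) //; last by rewrite /= oppr_eq0 gt_eqF.
  case: hh => [ih eh]; case: hk => [ik ek].
  have iJh := @Jop_inH _ q _ _ HC V _ ih; have iJk := @Jop_inH _ q _ _ HC V _ ik.
  rewrite -(ipC ik (finsupp_inH ff)) -ek -eh.
  rewrite ipBr ?ipBl // ?ipZr ?ipZl //; try exact: inHZ.
  by rewrite ip_Jop.
exact: (tendsC_conj hL).
Qed.

Lemma upperD f1 f2 g L1 L2 : finsupp f1 -> finsupp f2 -> finsupp g ->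
  upper f1 g L1 -> upper f2 g L2 -> upper (f1 + f2) g (L1 + L2).
Proof.
move=> h1 h2 hg u1 u2; rewrite /upper.
apply: (@tendsC_near _ _ _ _ _ (fun e => ip (resolvent q HC V (lam +i* e) f1) g +
    ip (resolvent q HC V (lam +i* e) f2) g)).
  have := solves_upper; have := near_pos.
  apply: filterS2 => e e0 hu; have [k1 hk1] := hu f1 h1; have [k2 hk2] := hu f2 h2.
  rewrite (@resolventE _ _ _ _ HC V hHC _ _ _ (Im_lam e0) hk1).
  rewrite (@resolventE _ _ _ _ HC V hHC _ _ _ (Im_lam e0) hk2).
  rewrite (@resolventE _ _ _ _ HC V hHC _ _ _ (Im_lam e0) (solvesD hk1 hk2)).
  by rewrite ipDl //; [exact: (proj1 hk1)|exact: (proj1 hk2)|exact: finsupp_inH].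
exact: (tendsC_D u1 u2).
Qed.

Lemma upperZ c f g L : finsupp f -> finsupp g -> upper f g L -> upper (c *: f) g (c * L).
Proof.
move=> h1 hg u1; rewrite /upper.
apply: (@tendsC_near _ _ _ _ _ (fun e => c * ip (resolvent q HC V (lam +i* e) f) g)).
  have := solves_upper; have := near_pos.
  apply: filterS2 => e e0 hu; have [k1 hk1] := hu f h1.
  rewrite (@resolventE _ _ _ _ HC V hHC _ _ _ (Im_lam e0) hk1).
  rewrite (@resolventE _ _ _ _ HC V hHC _ _ _ (Im_lam e0) (solvesZ c hk1)).
  by rewrite ipZl //; [exact: (proj1 hk1)|exact: finsupp_inH].
by apply: (tendsC_M _ u1); exact: tendsC_cst.
Qed.

Lemma upperDr f g1 g2 L1 L2 : finsupp f -> finsupp g1 -> finsupp g2 ->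
  upper f g1 L1 -> upper f g2 L2 -> upper f (g1 + g2) (L1 + L2).
Proof.
move=> hf h1 h2 u1 u2; rewrite /upper.
apply: (@tendsC_near _ _ _ _ _ (fun e => ip (resolvent q HC V (lam +i* e) f) g1 +
    ip (resolvent q HC V (lam +i* e) f) g2)).
  have := solves_upper; have := near_pos.
  apply: filterS2 => e e0 hu; have [k1 hk1] := hu f hf.
  rewrite (@resolventE _ _ _ _ HC V hHC _ _ _ (Im_lam e0) hk1).
  by rewrite ipDr //; [exact: finsupp_inH|exact: finsupp_inH|exact: (proj1 hk1)].
exact: (tendsC_D u1 u2).
Qed.

Lemma upperZr c f g L : finsupp f -> finsupp g -> upper f g L -> upper f (c *: g) (c^*%C * L).
Proof.
move=> h1 hg u1; rewrite /upper.
apply: (@tendsC_near _ _ _ _ _ (fun e => c^*%C * ip (resolvent q HC V (lam +i* e) f) g)).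
  have := solves_upper; have := near_pos.
  apply: filterS2 => e e0 hu; have [k1 hk1] := hu f h1.
  rewrite (@resolventE _ _ _ _ HC V hHC _ _ _ (Im_lam e0) hk1).
  by rewrite ipZr //; [exact: finsupp_inH|exact: (proj1 hk1)].
by apply: (tendsC_M _ u1); exact: tendsC_cst.
Qed.

Lemma cvg_lam : tendsC (0 : R)^'+ (fun e => lam +i* e) lam%:C.
Proof.
apply: cvgC_ReIm => /=; first exact: cvg_cst.
by apply: cvg_at_right_filter; exact: cvg_id.
Qed.

Lemma upperJ f g L : finsupp f -> finsupp g -> upper f g L ->
  upper (J f) g (ip f g + lam%:C * L).
Proof.
move=> h1 hg u1; rewrite /upper.
apply: (@tendsC_near _ _ _ _ _ (fun e => ip f g + (lam +i* e) * ip (resolvent q HC V (lam +i* e) f) g)).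
  have := solves_upper; have := near_pos.
  apply: filterS2 => e e0 hu; have [k1 hk1] := hu f h1.
  have ik := proj1 hk1; have fi := finsupp_inH h1; have gi := finsupp_inH hg.
  rewrite (@resolventE _ _ _ _ HC V hHC _ _ _ (Im_lam e0) hk1).
  rewrite (@resolventE _ _ _ _ HC V hHC _ _ _ (Im_lam e0) (solvesJ fi hk1)).
  by rewrite ipDl ?ipZl //; exact: inHZ.
apply: tendsC_D; first exact: tendsC_cst.
exact: (tendsC_M cvg_lam u1).
Qed.

Lemma upperJr f g L : finsupp f -> finsupp g -> upper f g L ->
  upper f (J g) (ip f g + lam%:C * L).
Proof.
move=> h1 hg u1; rewrite /upper.
apply: (@tendsC_near _ _ _ _ _ (fun e => ip f g + (lam +i* e) * ip (resolvent q HC V (lam +i* e) f) g)).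
  have := solves_upper; have := near_pos.
  apply: filterS2 => e e0 hu; have [k1 hk1] := hu f h1.
  have ik := proj1 hk1; have fi := finsupp_inH h1; have gi := finsupp_inH hg.
  rewrite (@resolventE _ _ _ _ HC V hHC _ _ _ (Im_lam e0) hk1).
  rewrite -ip_Jop // -ipZl // -ipDl //; last exact: inHZ.
  by congr (ip _ _); rewrite -(proj2 hk1) subrK.
apply: tendsC_D; first exact: tendsC_cst.
exact: (tendsC_M cvg_lam u1).
Qed.

Lemma ip_gen_r (h : state) u beta : ip h (gen_state u beta) = dotc h.1 u + dotc (h.2 0%N) beta.
Proof. by rewrite (@ip_finr _ _ _ _ _ 1) ?/psum ?big_nat1 // => -[]. Qed.

Lemma ip_gen_l (h : state) u beta : ip (gen_state u beta) h = dotc u h.1 + dotc beta (h.2 0%N).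
Proof. by rewrite (@ip_finl _ _ _ _ _ 1) ?/psum ?big_nat1 // => -[]. Qed.

Lemma upper_gen f0 beta g0 gamma :
  upper (gen_state f0 beta) (gen_state g0 gamma)
    (dotc (gen_sol q HC V zt f0 beta) g0 +
     dotc (zt^-1 *: gen_out q HC V zt f0 beta) gamma).
Proof.
have [eta [ceta neta]] := @near_root (fun e eta => [/\ 0 < e, 1 < normc eta & x eta = lam +i* e])
  (fun e eta h1 h2 h3 => And3 h1 h2 h3).
rewrite /upper.
apply: (@tendsC_near _ _ _ _ _ (fun e => dotc (gen_sol q HC V (eta e) f0 beta) g0 +
     dotc ((eta e)^-1 *: gen_out q HC V (eta e) f0 beta) gamma)).
  apply: filterS neta => e [e0 he qe].
  have hI : complex.Im (x (eta e)) != 0 by rewrite qe Im_lam.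
  have := @solves_gen _ _ _ _ HC V hHC ha _ f0 beta he hI; rewrite qe => hs.
  by rewrite (@resolventE _ _ _ _ HC V hHC _ _ _ (Im_lam e0) hs) ip_gen_r /= expr1.
have neta0 : \forall e \near (0 : R)^'+, eta e != 0.
  apply: filterS neta => e [_ he _].
  by apply: contraTneq he => ->; rewrite Normc.normc0 ltr10.
have netau : \forall e \near (0 : R)^'+, F (eta e) \in unitmx.
  apply: filterS neta => e [e0 he qe]; apply: Fmx_unit => //.
  by rewrite qe Im_lam.
have cinv : tendsC (0 : R)^'+ (fun e => (eta e)^-1) zt^-1.
  exact: (tendsC_V (expi_neq0 t) ceta).
have csol : mcvg (0 : R)^'+ (fun e => gen_sol q HC V (eta e) f0 beta) (gen_sol q HC V zt f0 beta).
  apply: mcvgM; first exact: (mcvg_invF (expi_neq0 t) treg neta0 netau ceta).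
  apply: mcvgD; first exact: mcvg_cst.
  apply: mcvgZ; last exact: mcvg_cst.
  by apply: (tendsC_M cinv); exact: tendsC_cst.
apply: tendsC_D; first by apply: (tendsC_dotc csol).
apply: tendsC_dotc; apply: (mcvgZ cinv); apply: mcvgZ; first exact: tendsC_cst.
apply: mcvgD; last exact: mcvg_cst.
by apply: (mcvgM _ csol); exact: mcvg_cst.
Qed.

End AtAngle.
End BoundaryValues.
#[local] Transparent ip resolvent Fmx determinant.

Section FinPairing.
Variables (R : realType) (d r : nat).
Local Notation state := (state R d r).
Implicit Types f g h : state.

Lemma ip_finlC f g : finsupp f -> ip g f = (ip f g)^*%C.
Proof. by move=> ff; exact: (proj2 (pairableC (@pairable_finl _ _ _ f g ff))). Qed.

Lemma ip_finrC f g : finsupp f -> ip f g = (ip g f)^*%C.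
Proof. by move=> ff; exact: (proj2 (pairableC (@pairable_finr _ _ _ g f ff))). Qed.

Lemma ip_finlDl f g h : finsupp f -> finsupp g -> ip (f + g) h = ip f h + ip g h.
Proof.
move=> ff fg; exact: (proj2 (pairableDl (@pairable_finl _ _ _ f h ff) (@pairable_finl _ _ _ g h fg))).
Qed.

Lemma ip_finlZl c f h : finsupp f -> ip (c *: f) h = c * ip f h.
Proof. move=> ff; exact: (proj2 (pairableZl c (@pairable_finl _ _ _ f h ff))). Qed.

Lemma ip_finrDl f g h : finsupp h -> ip (f + g) h = ip f h + ip g h.
Proof.
move=> fh; exact: (proj2 (pairableDl (@pairable_finr _ _ _ f h fh) (@pairable_finr _ _ _ g h fh))).
Qed.

Lemma ip_finrZl c f h : finsupp h -> ip (c *: f) h = c * ip f h.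
Proof. move=> fh; exact: (proj2 (pairableZl c (@pairable_finr _ _ _ f h fh))). Qed.

Lemma ip_finlZr c f h : finsupp f -> ip f (c *: h) = c^*%C * ip f h.
Proof.
by move=> ff; rewrite (ip_finrC _ ff) ip_finrZl // conjcM -ip_finrC.
Qed.

End FinPairing.

(** * The jump of the resolvent *)

Section JumpAlgebra.
Variables (K : fieldType) (d r : nat).
Variables (A A' : 'M[K]_d) (V : 'M[K]_(d, r)) (V' : 'M[K]_(r, d)) (z w a : K).
Hypotheses (zw : z * w = 1) (a0 : a != 0) (wz : w - z != 0).
Local Notation k := ((w - z) / a).
Local Notation c := ((a * (w - z))^-1).
Hypothesis kA : k *: (A *m V *m V' *m A') = A' - A.
Local Notation Y := ((a * k) *: (A *m V)).
Local Notation Y' := (- (a * k) *: (V' *m A')).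
Local Notation G := (k *: (w *: (V' *m A *m V) - a%:M)).
Local Notation G' := (- k *: (z *: (V' *m A' *m V) - a%:M)).

Let k0 : k != 0.
Proof. by rewrite mulf_neq0 ?invr_eq0. Qed.

Let AVVA : A *m V *m V' *m A' = k^-1 *: (A' - A).
Proof. by rewrite -kA scalerA mulVf // scale1r. Qed.

Let z0 : z != 0.
Proof. by apply: contra_eq_neq zw => ->; rewrite mul0r eq_sym oner_neq0. Qed.

Let wE : w = z^-1.
Proof. by apply: (mulfI z0); rewrite zw divff. Qed.

Let wzE y : y = 1 - z * z -> y != 0.
Proof.
by move=> ->; have := mulf_neq0 z0 wz; rewrite mulrBr zw.
Qed.

(** The four [jump_] identities are the blocks of the jump between the centre and the first sites.
    In use A and A' are the inverses of F at z and w = 1/z, Y and G are the central part and the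
    first site of [Psi], and the primed matrices are their adjoints. Each reduces to [kA], the
    identity of [invF_sub]. *)
Lemma jump_YY : A - A' = c *: (Y *m Y').
Proof.
rewrite -scalemxAl -scalemxAr !scalerA mulmxA AVVA scalerA.
move: (A) (A') => B B'; apply/matrixP => i j; rewrite !mxE.
by field; rewrite a0 wz.
Qed.

Lemma jump_YG : (w / a) *: (A *m V) - (z / a) *: (A' *m V) = c *: (Y *m G').
Proof.
rewrite -scalemxAl -scalemxAr mulmxBr -scalemxAr mul_mx_scalar !mulmxA AVVA.
rewrite -scalemxAl mulmxBl.
move: (A *m V) (A' *m V) => B B'; apply/matrixP => i j; rewrite !mxE.
by field; rewrite a0 wz.
Qed.

Lemma jump_GY : (w / a) *: (V' *m A) - (z / a) *: (V' *m A') = c *: (G *m Y').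
Proof.
rewrite -scalemxAl -scalemxAr mulmxBl -scalemxAl mul_scalar_mx.
have -> : V' *m A *m V *m (V' *m A') = k^-1 *: (V' *m A' - V' *m A).
  have -> : V' *m A *m V *m (V' *m A') = V' *m (A *m V *m V' *m A') by rewrite !mulmxA.
  by rewrite AVVA -scalemxAr mulmxBr.
move: (V' *m A) (V' *m A') => B B'; apply/matrixP => i j; rewrite !mxE wE.
by field; rewrite a0 z0 /= wzE //; ring.
Qed.

Lemma jump_GG : (w / a) *: ((w / a) *: (V' *m A *m V) - 1%:M)
   - (z / a) *: ((z / a) *: (V' *m A' *m V) - 1%:M) = c *: (G *m G').
Proof.
rewrite -scalemxAl -scalemxAr mulmxBr !mulmxBl -!scalemxAl -!scalemxAr.
rewrite !mul_mx_scalar !mul_scalar_mx.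
have -> : V' *m A *m V *m (V' *m A' *m V) = k^-1 *: (V' *m A' *m V - V' *m A *m V).
  have -> : V' *m A *m V *m (V' *m A' *m V) = V' *m (A *m V *m V' *m A') *m V by rewrite !mulmxA.
  by rewrite AVVA -scalemxAr -scalemxAl mulmxBr mulmxBl.
move: (V' *m A *m V) (V' *m A' *m V) => B B'; apply/matrixP => i j; rewrite !mxE wE.
by case: (i == j); rewrite ?mulr1n ?mulr0n; field; rewrite a0 z0 /= wzE //; ring.
Qed.

End JumpAlgebra.

Section JumpForm.
Variables (R : realType) (d r : nat).
Local Notation C := R[i].
Variables (A A' : 'M[C]_d) (V : 'M[C]_(d, r)) (z w a : C).
Hypotheses (zw : z * w = 1) (a0 : a != 0) (wz : w - z != 0).
Hypotheses (zJ : z^*%C = w) (aJ : a^*%C = a) (AJ : A^t* = A').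
Local Notation V' := (V^t* ).
Local Notation k := ((w - z) / a).
Local Notation c := ((a * (w - z))^-1).
Hypothesis kA : k *: (A *m V *m V' *m A') = A' - A.
Local Notation Y := ((a * k) *: (A *m V)).
Local Notation Y' := (- (a * k) *: (V' *m A')).
Local Notation G := (k *: (w *: (V' *m A *m V) - a%:M)).
Local Notation G' := (- k *: (z *: (V' *m A' *m V) - a%:M)).

(** [sol] and [w *: out] are the centre and the first site of the resolvent at the boundary, [adj]
    is the adjoint of [Psi] applied to (f0, beta). Pairing the four blocks with (g0, gamma) gives
    the jump for vectors near the centre. *)
Lemma jump_form (f0 g0 : 'cV[C]_d) (beta gamma : 'cV[C]_r) :
  let sol u b := A *m (u + (w / a) *: (V *m b)) in
  let out u b := a^-1 *: (V' *m sol u b - b) in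
  let adj := Y' *m f0 + G' *m beta in
  dotc (sol f0 beta) g0 + dotc (w *: out f0 beta) gamma -
  (dotc f0 (sol g0 gamma) + dotc beta (w *: out g0 gamma)) =
  c * (dotc (Y *m adj) g0 + dotc (G *m adj) gamma).
Proof.
move=> sol out adj.
have wJ : w^*%C = z by rewrite -zJ conjcK.
have act m n p (P : 'M[C]_(m, n)) (Q : 'M[C]_(n, p)) v g : c * dotc (P *m (Q *m v)) g = dotc ((c *: (P *m Q)) *m v) g.
  by rewrite -scalemxAl dotcZl mulmxA.
have eAA : dotc (A *m f0) g0 - dotc (A' *m f0) g0 = c * dotc (Y *m (Y' *m f0)) g0.
  by rewrite act -(jump_YY a0 wz kA) mulmxBl dotcBl.
have lin2 m n (s s' : C) (P P' : 'M[C]_(m, n)) v g :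
    dotc ((s *: P - s' *: P') *m v) g = s * dotc (P *m v) g - s' * dotc (P' *m v) g.
  by rewrite mulmxBl dotcBl -!scalemxAl !dotcZl.
have lin1 m (s : C) (P : 'M[C]_m) v g :
    dotc ((s *: P - 1%:M) *m v) g = s * dotc (P *m v) g - dotc v g.
  by rewrite mulmxBl dotcBl -scalemxAl dotcZl mul1mx.
have eAG : (w / a) * dotc (A *m (V *m beta)) g0 - (z / a) * dotc (A' *m (V *m beta)) g0 =
    c * dotc (Y *m (G' *m beta)) g0.
  by rewrite act -(jump_YG a0 wz kA) lin2 (mulmxA A) (mulmxA A').
have eGA : (w / a) * dotc (V' *m (A *m f0)) gamma - (z / a) * dotc (V' *m (A' *m f0)) gamma =
    c * dotc (G *m (Y' *m f0)) gamma.
  by rewrite act -(jump_GY zw a0 wz kA) lin2 (mulmxA V' A) (mulmxA V' A').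
have eGG : (w / a) * ((w / a) * dotc (V' *m (A *m (V *m beta))) gamma - dotc beta gamma)
   - (z / a) * ((z / a) * dotc (V' *m (A' *m (V *m beta))) gamma - dotc beta gamma) =
    c * dotc (G *m (G' *m beta)) gamma.
  have eQ B : V' *m B *m V *m beta = V' *m (B *m (V *m beta)) by rewrite -!mulmxA.
  rewrite act -(jump_GG zw a0 wz kA) -(eQ A) -(eQ A').
  by move: (V' *m A *m V) (V' *m A' *m V) => X X'; rewrite lin2 !lin1.
have -> : c * (dotc (Y *m adj) g0 + dotc (G *m adj) gamma) =
   c * dotc (Y *m (Y' *m f0)) g0 + c * dotc (Y *m (G' *m beta)) g0 +
   (c * dotc (G *m (Y' *m f0)) gamma + c * dotc (G *m (G' *m beta)) gamma).
  have hD m n (P : 'M[C]_(m, n)) u v g : c * dotc (P *m (u + v)) g = c * dotc (P *m u) g + c * dotc (P *m v) g.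
    by rewrite mulmxDr dotcDl mulrDr.
  by rewrite /adj mulrDr !hD.
rewrite -eAA -eAG -eGA -eGG.
have dA (u v : 'cV[C]_d) : dotc u (A *m v) = dotc (A' *m u) v by rewrite dotc_adj -AJ adjmxK.
have dV (u : 'cV[C]_d) (v : 'cV[C]_r) : dotc u (V *m v) = dotc (V' *m u) v.
  by rewrite dotc_adj adjmxK.
have dV' (u : 'cV[C]_r) (v : 'cV[C]_d) : dotc u (V' *m v) = dotc (V *m u) v.
  by rewrite dotc_adj.
have genA m n (P : 'M[C]_(m, n)) u s v : P *m (u + s *: v) = P *m u + s *: (P *m v).
  by rewrite mulmxDr -scalemxAr.
have wa : (w / a)^*%C = z / a by rewrite conjcM conjcV wJ aJ.
have s1 : dotc (sol f0 beta) g0 = dotc (A *m f0) g0 + (w / a) * dotc (A *m (V *m beta)) g0.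
  by rewrite /sol genA dotcDl dotcZl.
have s2 : dotc (w *: out f0 beta) gamma = (w / a) * (dotc (V' *m (A *m f0)) gamma +
    (w / a) * dotc (V' *m (A *m (V *m beta))) gamma - dotc beta gamma).
  by rewrite /out /sol genA genA scalerA dotcZl dotcBl dotcDl dotcZl.
have s3 u : dotc u (sol g0 gamma) = dotc (A' *m u) g0 + (z / a) * dotc (V' *m (A' *m u)) gamma.
  by rewrite /sol dA dotcDr dotcZr dV wa.
have s4 : dotc beta (w *: out g0 gamma) = (z / a) * (dotc (A' *m (V *m beta)) g0 +
    (z / a) * dotc (V' *m (A' *m (V *m beta))) gamma - dotc beta gamma).
  have e v : dotc beta ((w / a) *: (V' *m v - gamma)) = (z / a) * (dotc (V *m beta) v - dotc beta gamma).
    by rewrite dotcZr wa dotcBr dV'.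
  have eo : w *: out g0 gamma = (w / a) *: (V' *m sol g0 gamma - gamma) by exact: scalerA.
  rewrite eo e (s3 (V *m beta)); ring.
have key (x1 x2 x3 x4 x5 x6 x7 x8 x9 p s : C) :
    x1 + p * x3 + p * (x5 + p * x7 - x9) - (x2 + s * x6 + s * (x4 + s * x8 - x9)) =
    x1 - x2 + (p * x3 - s * x4) + (p * x5 - s * x6 + (p * (p * x7 - x9) - s * (s * x8 - x9))).
  ring.
rewrite s1 s2 s3 s4; exact: key.
Qed.

End JumpForm.


Section Jump.
Variables (R : realType) (q d r : nat).
Variables (HC : 'M[R[i]]_d) (V : 'M[R[i]]_(d, r)).
Hypothesis hHC : HC = HC^t*.
Hypothesis ha : 0 < ahop R q.
Local Notation C := R[i].
Local Notation state := (state R d r).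
Local Notation J := (Jop q HC V).
Local Notation a := (ahop R q).
Local Notation F := (Fmx q HC V).
Local Notation S := (Smx q HC V).
Local Notation Y := (Ymx q HC V).
Local Notation x := (xspec (R := R) q).
Variable t : R.
Hypothesis tA : angles t.
Hypothesis treg : regular q HC V t.
Local Notation zt := (expi t).

Let ac0 : a%:C != 0 :> C.
Proof. by rewrite (inj_eq (@complexI R)) gt_eqF. Qed.

Lemma sin_angle_gt0 : 0 < sin t.
Proof.
by move: tA; rewrite /angles /= in_itv /= => h; exact: sin_gt0_pi.
Qed.

Lemma expiV_sub : zt^-1 - zt = - (2 * sin t)%:C * 'i%C.
Proof.
rewrite -expi_conj; apply/eqP; rewrite eq_complex /=; apply/andP; split; apply/eqP; ring.
Qed.

Lemma expiV_sub_neq0 : zt^-1 - zt != 0.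
Proof.
rewrite expiV_sub eq_complex /= negb_and orbC; apply/orP; left.
rewrite mulr0 mulr1 addr0 oppr_eq0 mulf_neq0 ?pnatr_eq0 //.
by rewrite gt_eqF // sin_angle_gt0.
Qed.

(** The value of [PsiPsi_form] off [ThetaF], where W does not enter. *)
Definition PsiPsi_reg (f g : state) : C := \sum_(c < r)
  ip f (Psi q HC V zt (evec R c)) * ip (Psi q HC V zt (evec R c)) g.

Definition jump_coef : C := 'i%C / (2 * a * sin t)%:C.

Lemma jump_coefE : jump_coef = (a%:C * (zt^-1 - zt))^-1.
Proof.
have s0 : (sin t)%:C != 0 :> C by rewrite (inj_eq (@complexI R)) gt_eqF // sin_angle_gt0.
have i2 : 'i%C * 'i%C = -1 :> C by rewrite -expr2 sqr_i.
have i0 : 'i%C != 0 :> C by rewrite neq0Ci.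
apply: (mulIf (x := a%:C * (zt^-1 - zt))); first by rewrite mulf_neq0 // expiV_sub_neq0.
rewrite [RHS]mulVf; last by rewrite mulf_neq0 // expiV_sub_neq0.
rewrite /jump_coef expiV_sub !rmorphM /= rmorph_nat.
transitivity (- ('i%C * 'i%C) * (2 * a%:C * (sin t)%:C) / (2 * a%:C * (sin t)%:C) : C).
  by ring.
by rewrite i2 opprK mul1r divff // !mulf_neq0 // pnatr_eq0.
Qed.

Definition Gmx : 'M[C]_r := zt *: 1%:M + zt^-1 *: S zt.

Definition Psi_adj (f0 : 'cV[C]_d) (beta : 'cV[C]_r) : 'cV[C]_r :=
  (Y zt)^t* *m f0 + Gmx^t* *m beta.

Lemma Psi_gen alpha : (Psi q HC V zt alpha).2 0%N = Gmx *m alpha.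
Proof.
rewrite Psi_E /Gmx; move: (S zt) => B.
by rewrite /= !expr1 mulmxDl -!scalemxAl mul1mx.
Qed.

Lemma dotc_evec (v : 'cV[C]_r) c : dotc v (evec R c) = v c 0.
Proof.
rewrite /dotc (bigD1 c) //= big1 ?addr0; last first.
  by move=> k kc; rewrite mxE eqxx andbT (negbTE kc) rmorph0 mulr0.
by rewrite mxE !eqxx rmorph1 mulr1.
Qed.

Lemma ip_gen_Psi f0 beta c : ip (gen_state f0 beta) (Psi q HC V zt (evec R c)) = Psi_adj f0 beta c 0.
Proof.
rewrite ip_gen_l Psi_gen Psi_E /= -{1}[Y zt]adjmxK -[Gmx]adjmxK -!dotc_adj -dotcDl.
exact: dotc_evec.
Qed.

Lemma PsiPsi_reg_gen f0 beta g0 gamma : PsiPsi_reg (gen_state f0 beta) (gen_state g0 gamma) =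
  dotc (Y zt *m Psi_adj f0 beta) g0 + dotc (Gmx *m Psi_adj f0 beta) gamma.
Proof.
rewrite !dotc_adj -dotcDr; apply: eq_bigr => c _; rewrite ip_gen_Psi; congr (_ * _).
rewrite (proj2 (pairableC (@pairable_finl _ _ _ _ _ (gen_state_finsupp g0 gamma)))).
by rewrite ip_gen_Psi.
Qed.

Lemma conj_k : ((zt^-1 - zt) / a%:C)^*%C = - ((zt^-1 - zt) / a%:C).
Proof.
by rewrite conjcM conjcB !conjcV expi_conj invrK conjc_real -mulNr opprB.
Qed.

Lemma invF_adj : (invmx (F zt))^t* = invmx (F zt^-1).
Proof. by rewrite (adjmx_inv (F zt)) Fmx_adj // expi_conj. Qed.

Lemma YE : Y zt = (a%:C * ((zt^-1 - zt) / a%:C)) *: (invmx (F zt) *m V).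
Proof. by rewrite /Ymx mulrC divfK. Qed.

Lemma YadjE : (Y zt)^t* = - (a%:C * ((zt^-1 - zt) / a%:C)) *: (V^t* *m invmx (F zt^-1)).
Proof.
rewrite YE adjmxZ (adjmxM _ V) invF_adj conjcM conjc_real conj_k mulrN.
by [].
Qed.

Lemma GE : Gmx = ((zt^-1 - zt) / a%:C) *: (zt^-1 *: (V^t* *m invmx (F zt) *m V) - a%:C%:M).
Proof.
rewrite /Gmx /Smx; move: (V^t* *m _ *m V) => B.
rewrite scalerDr scalerN addrA -scalerBl scalerBr !scalerA addrC.
rewrite -[a%:C%:M]scalemx1 scalerA divfK // -scaleNr opprB.
by rewrite [_ / _ * _]mulrC.
Qed.

Lemma GadjE : Gmx^t* = - ((zt^-1 - zt) / a%:C) *: (zt *: (V^t* *m invmx (F zt^-1) *m V) - a%:C%:M).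
Proof.
rewrite GE adjmxZ conj_k adjmxB adjmxZ adjmx_scalar conjc_real conjcV expi_conj invrK.
rewrite (adjmxM _ V) (adjmxM _ (invmx _)) invF_adj adjmxK mulmxA.
by [].
Qed.

(** The limit from below is replaced by the conjugate of the upper limit with arguments exchanged.
    In this shape the property is stable under sums, scalars, J and exchange, so [finsupp_ind]
    applies to each argument in turn. *)
Definition jump_at (f g : state) : Prop := exists Lp Lq : C,
  [/\ upper q HC V t f g Lp, upper q HC V t g f Lq & Lp - Lq^*%C = jump_coef * PsiPsi_reg f g].

Lemma jump_gen f0 beta g0 gamma : jump_at (gen_state f0 beta) (gen_state g0 gamma).
Proof.
do 2! eexists; split; [exact: (upper_gen hHC ha tA treg)|exact: (upper_gen hHC ha tA treg)|].
rewrite PsiPsi_reg_gen conjcD -!dotcC jump_coefE /Psi_adj YadjE GadjE YE GE.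
have kA : ((zt^-1 - zt) / a%:C) *: (invmx (F zt) *m V *m V^t* *m invmx (F zt^-1)) =
    invmx (F zt^-1) - invmx (F zt).
  by rewrite -[LHS]opprK -(invF_sub treg (regularV hHC treg)) opprB.
exact: (jump_form (divff (expi_neq0 t)) ac0 expiV_sub_neq0 (expi_conj t) (conjc_real a) invF_adj kA f0 g0 beta gamma).
Qed.

Let Psi_J alpha : J (Psi q HC V zt alpha) = (2 * a * cos t)%:C *: Psi q HC V zt alpha.
Proof. by rewrite Jop_Psi ?xspec_expi //; exact: expi_neq0. Qed.

Lemma PsiPsi_reg_conj f g : finsupp f -> finsupp g -> PsiPsi_reg g f = (PsiPsi_reg f g)^*%C.
Proof.
move=> ff fg; rewrite /PsiPsi_reg rmorph_sum; apply: eq_bigr => c _ /=.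
by rewrite (ip_finlC (Psi _ _ _ _ _) ff) (ip_finrC (Psi _ _ _ _ _) fg) [RHS]conjcM mulrC.
Qed.

Lemma PsiPsi_regDl f g h : finsupp f -> finsupp g -> PsiPsi_reg (f + g) h = PsiPsi_reg f h + PsiPsi_reg g h.
Proof.
move=> ff fg; rewrite /PsiPsi_reg -big_split; apply: eq_bigr => c _ /=.
by rewrite ip_finlDl // mulrDl.
Qed.

Lemma PsiPsi_regZl b f h : finsupp f -> PsiPsi_reg (b *: f) h = b * PsiPsi_reg f h.
Proof.
by move=> ff; rewrite /PsiPsi_reg mulr_sumr; apply: eq_bigr => c _ /=; rewrite ip_finlZl // mulrA.
Qed.

Lemma PsiPsi_regJl f h : finsupp f -> PsiPsi_reg (J f) h = (2 * a * cos t)%:C * PsiPsi_reg f h.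
Proof.
move=> ff; rewrite /PsiPsi_reg mulr_sumr; apply: eq_bigr => c _ /=.
by rewrite (ip_Jop_finl q V hHC _ ff) Psi_J ip_finlZr // conjc_real mulrA.
Qed.

Lemma jump_coefJ : jump_coef^*%C = - jump_coef.
Proof.
rewrite jump_coefE conjcV conjcM conjcB conjcV expi_conj invrK conjc_real.
by rewrite -(opprB zt^-1 zt) mulrN invrN.
Qed.

Lemma jump_sym f g : finsupp f -> finsupp g -> jump_at f g -> jump_at g f.
Proof.
move=> ff fg [Lp [Lq [h1 h2 h3]]]; exists Lq, Lp; split=> //.
rewrite PsiPsi_reg_conj // -[jump_coef]conjcK jump_coefJ -[LHS]conjcK conjcB conjcK -opprB h3.
by rewrite !(conjcN, conjcM) mulNr.
Qed.

Lemma jumpD f1 f2 g : finsupp f1 -> finsupp f2 -> finsupp g ->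
  jump_at f1 g -> jump_at f2 g -> jump_at (f1 + f2) g.
Proof.
move=> h1 h2 hg [L [K [u1 u2 e]]] [L' [K' [u1' u2' e']]].
exists (L + L'), (K + K'); split.
- exact: (upperD hHC ha tA h1 h2 hg u1 u1').
- exact: (upperDr hHC ha tA hg h1 h2 u2 u2').
- by rewrite PsiPsi_regDl // mulrDr -e -e' conjcD opprD addrACA.
Qed.

Lemma jumpZ b f g : finsupp f -> finsupp g -> jump_at f g -> jump_at (b *: f) g.
Proof.
move=> hf hg [L [K [u1 u2 e]]]; exists (b * L), (b^*%C * K); split.
- exact: (upperZ (c := b) hHC ha tA hf hg u1).
- exact: (upperZr (c := b) hHC ha tA hg hf u2).
- by rewrite PsiPsi_regZl // mulrCA -e conjcM conjcK mulrBr.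
Qed.

(** The term <f, g> in R J = 1 + x R is common to both boundary values and cancels in the
    difference. *)
Lemma jumpJ f g : finsupp f -> finsupp g -> jump_at f g -> jump_at (J f) g.
Proof.
move=> hf hg [L [K [u1 u2 e]]]; exists (ip f g + (2 * a * cos t)%:C * L), (ip g f + (2 * a * cos t)%:C * K); split.
- exact: (upperJ hHC ha tA hf hg u1).
- exact: (upperJr hHC ha tA hg hf u2).
- rewrite PsiPsi_regJl // mulrCA -e conjcD conjcM conjc_real (ip_finlC _ hf) conjcK mulrBr.
  by rewrite opprD addrACA subrr add0r.
Qed.

Lemma jump_all f g : finsupp f -> finsupp g -> jump_at f g.
Proof.
move=> ff; move: g; pattern f; apply: (@finsupp_ind _ q _ _ HC V ha) ff.
- move=> u beta g fg; pattern g; apply: (@finsupp_ind _ q _ _ HC V ha) fg.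
  + by move=> v gamma; exact: jump_gen.
  + move=> g1 g2 h1 h2 j1 j2; have hu := gen_state_finsupp u beta.
    apply: jump_sym => //; first exact: finsuppD.
    by apply: jumpD => //; exact: jump_sym.
  + move=> b g1 h1 j1; have hu := gen_state_finsupp u beta.
    apply: jump_sym => //; first exact: finsuppZ.
    by apply: jumpZ => //; exact: jump_sym.
  + move=> g1 h1 j1; have hu := gen_state_finsupp u beta.
    apply: jump_sym => //; first exact: Jop_finsupp.
    by apply: jumpJ => //; exact: jump_sym.
- by move=> f1 f2 h1 h2 j1 j2 g fg; apply: jumpD => //; [exact: j1|exact: j2].
- by move=> b f1 h1 j1 g fg; apply: jumpZ => //; exact: j1.
- by move=> f1 h1 j1 g fg; apply: jumpJ => //; exact: j1.
Qed.

End Jump.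

(** * Integration over angles *)

Section NiceFunctions.
Variable R : realType.
Local Notation C := R[i].
Local Notation normc := (@Normc.normc R).
Local Notation mu := (@lebesgue_measure R).
Local Notation A := (@angles R).

Lemma measurable_angles : measurable A.
Proof. exact: measurable_itv. Qed.

Lemma mu_angles_lty : (mu A < +oo)%E.
Proof. by rewrite /angles lebesgue_measure_itv /= lte_fin pi_gt0 -EFinB ltry. Qed.

Lemma measurable_fun_fix (E : set R) (h k : R -> R) : finite_set E ->
  (forall t, A t -> ~ E t -> h t = k t) -> measurable_fun A h -> measurable_fun A k.
Proof.
move=> fE hk mh _ B mB.
have -> : A `&` k @^-1` B = (A `&` h @^-1` B) `\` E `|` (A `&` k @^-1` B `&` E).
  rewrite eqEsubset; split=> [t [At Bt]|t].
    case: (pselect (E t)) => Et; [by right|left; split=> //].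
    by split=> //; rewrite /preimage /= hk.
  by move=> [[[At Bt] Et]|[[At Bt] _]]; split=> //; rewrite /preimage /= -hk.
have mE D : finite_set D -> measurable (D : set (measurableTypeR R)).
  by move=> fD; apply: countable_measurable; [exact: measurable_set1|exact: finite_set_countable].
apply: measurableU; last by apply: mE; apply: (sub_finite_set _ fE) => t [].
by apply: measurableD; [exact: (mh measurable_angles)|exact: mE].
Qed.

(** Bounded measurable functions on (0, pi). Unlike integrable ones they are closed under products,
    and all integrands built from finitely supported vectors belong to this class. *)
Definition rnice (h : R -> R) : Prop :=
  measurable_fun A h /\ exists K : R, forall t, A t -> `|h t| <= K.

Lemma rniceD h k : rnice h -> rnice k -> rnice (fun t => h t + k t).
Proof.
move=> [mh [K hK]] [mk [L hL]]; split; first exact: measurable_funD.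
by exists (K + L) => t At; apply: (le_trans (ler_normD _ _)); rewrite lerD ?hK ?hL.
Qed.

Lemma rniceM h k : rnice h -> rnice k -> rnice (fun t => h t * k t).
Proof.
move=> [mh [K hK]] [mk [L hL]]; split; first exact: measurable_funM.
by exists (K * L) => t At; rewrite normrM ler_pM ?hK ?hL.
Qed.

Lemma rnice_cst c : rnice (fun=> c).
Proof. by split; [exact: measurable_cst|exists `|c|]. Qed.

Lemma rniceN h : rnice h -> rnice (fun t => - h t).
Proof.
move=> [mh [K hK]]; split; first exact: (measurableT_comp (@oppr_measurable R setT) mh).
by exists K => t At; rewrite normrN hK.
Qed.

Lemma rnice_cos : rnice cos.
Proof.
split; last by exists 1 => t _; rewrite ler_norml cos_geN1 cos_le1.
by apply: measurable_funTS; apply: continuous_measurable_fun; exact: continuous_cos.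
Qed.

Lemma rnice_sin : rnice sin.
Proof.
split; last by exists 1 => t _; rewrite ler_norml sin_geN1 sin_le1.
by apply: measurable_funTS; apply: continuous_measurable_fun; exact: continuous_sin.
Qed.

Lemma rnice_integrable h : rnice h -> mu.-integrable A (EFin \o h).
Proof.
move=> [mh [K hK]]; apply: measurable_bounded_integrable => //.
- exact: measurable_angles.
- exact: mu_angles_lty.
- exists K; split; first exact: num_real.
  by move=> L KL t /= At; apply: le_trans (hK t At) (ltW KL).
Qed.

Definition Cmeas (h : R -> C) : Prop :=
  measurable_fun A (fun t => complex.Re (h t)) /\ measurable_fun A (fun t => complex.Im (h t)).

Definition nice (h : R -> C) : Prop :=
  rnice (fun t => complex.Re (h t)) /\ rnice (fun t => complex.Im (h t)).

Lemma nice_Cmeas h : nice h -> Cmeas h.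
Proof. by move=> [[? _] [? _]]. Qed.

Lemma niceP h : nice h <-> Cmeas h /\ bddC A h.
Proof.
split=> [[[mr [K hK]] [mi [L hL]]]|[[mr mi] [K hK]]].
  split=> //; exists (K + L) => t At.
  by apply: (le_trans (normc_le_ReIm _)); rewrite lerD ?hK ?hL.
split; split=> //; exists K => t At; apply: le_trans (hK t At).
  exact: Re_le_normc.
exact: Im_le_normc.
Qed.

Lemma ReD (z w : C) : complex.Re (z + w) = complex.Re z + complex.Re w.
Proof. by case: z; case: w. Qed.

Lemma ImD (z w : C) : complex.Im (z + w) = complex.Im z + complex.Im w.
Proof. by case: z; case: w. Qed.

Lemma ReM (z w : C) : complex.Re (z * w) = complex.Re z * complex.Re w - complex.Im z * complex.Im w.
Proof. by case: z; case: w. Qed.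

Lemma ImM (z w : C) : complex.Im (z * w) = complex.Re z * complex.Im w + complex.Im z * complex.Re w.
Proof. by case: z; case: w. Qed.

Lemma ReJ (z : C) : complex.Re (z^*%C) = complex.Re z.
Proof. by case: z. Qed.

Lemma ImJ (z : C) : complex.Im (z^*%C) = - complex.Im z.
Proof. by case: z. Qed.

Lemma CmeasD h k : Cmeas h -> Cmeas k -> Cmeas (fun t => h t + k t).
Proof.
move=> [h1 h2] [k1 k2]; split.
  by under eq_fun do rewrite ReD; exact: measurable_funD.
by under eq_fun do rewrite ImD; exact: measurable_funD.
Qed.

Lemma CmeasM h k : Cmeas h -> Cmeas k -> Cmeas (fun t => h t * k t).
Proof.
move=> [h1 h2] [k1 k2]; split.
  by under eq_fun do rewrite ReM; apply: measurable_funB; exact: measurable_funM.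
by under eq_fun do rewrite ImM; apply: measurable_funD; exact: measurable_funM.
Qed.

Lemma Cmeas_cst c : Cmeas (fun=> c).
Proof. by split; exact: measurable_cst. Qed.

Lemma Cmeas_conj h : Cmeas h -> Cmeas (fun t => (h t)^*%C).
Proof.
move=> [h1 h2]; split; first by under eq_fun do rewrite ReJ.
by under eq_fun do rewrite ImJ; exact: (measurableT_comp (@oppr_measurable R setT) h2).
Qed.

Lemma Cmeas_inv h : Cmeas h -> Cmeas (fun t => (h t)^-1).
Proof.
move=> mh; have [h1 h2] := mh.
(* The inverse is |h|^-2 times the conjugate. On nonnegative reals [powR] with exponent -1 is
   inversion, including the value 0 at 0, which matches the convention for the complex inverse. *)
pose n t := (complex.Re (h t) ^+ 2 + complex.Im (h t) ^+ 2) `^ (-1).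
have mn : measurable_fun A n.
  apply: (measurableT_comp (measurable_powR (-1))).
  by apply: measurable_funD; under eq_fun do rewrite expr2; exact: measurable_funM.
apply: (_ : (fun t => (h t)^-1) = (fun t => (n t)%:C * (h t)^*%C) -> _); last first.
  apply/funext => t; rewrite /n powR_inv1 ?addr_ge0 ?sqr_ge0 // -sqr_normcE invc_norm.
  by rewrite normC_E -!rmorphXn fmorphV.
move=> ->; apply: CmeasM; last exact: Cmeas_conj.
by split=> //=; exact: measurable_cst.
Qed.

Lemma Cmeas_ext h k : (forall t, h t = k t) -> Cmeas h -> Cmeas k.
Proof. by move=> /funext ->. Qed.

Lemma Cmeas_fix (E : set R) h k : finite_set E -> (forall t, A t -> ~ E t -> h t = k t) ->
  Cmeas h -> Cmeas k.
Proof.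
move=> fE hk [h1 h2]; split; [apply: (measurable_fun_fix fE _ h1)|apply: (measurable_fun_fix fE _ h2)];
  by move=> t At Et; rewrite hk.
Qed.

Lemma bddC_fix (E : set R) (h : R -> C) : finite_set E ->
  bddC (fun t => A t /\ ~ E t) h -> bddC A h.
Proof.
move=> fE [K hK]; have [L hL] : exists L : R, forall t, E t -> normc (h t) <= L.
  have [s ->] : exists s : seq R, E = [set` s] by apply/finite_seqP.
  exists (\sum_(t <- s) normc (h t)) => t ts.
  by rewrite (big_rem t) //= lerDl sumr_ge0 // => u _; exact: normc_ge0.
exists (Num.max K L) => t At; rewrite le_max.
case: (pselect (E t)) => Et; first by rewrite hL // orbT.
by rewrite hK.
Qed.

Lemma nice_fix (E : set R) h k : finite_set E -> (forall t, A t -> ~ E t -> h t = k t) ->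
  Cmeas h -> bddC (fun t => A t /\ ~ E t) h -> nice k.
Proof.
move=> fE hk mh [K hK]; apply/niceP; split; first exact: (Cmeas_fix fE hk).
by apply: (bddC_fix fE); exists K => t [At Et]; rewrite -hk // hK.
Qed.

Lemma nice_ext h k : (forall t, A t -> h t = k t) -> nice h -> nice k.
Proof.
move=> hk hn; have [mh [K hK]] := (niceP h).1 hn.
by apply: (nice_fix (finite_set0 _) (fun t At _ => hk t At) mh); exists K => t [At _]; exact: hK.
Qed.

Lemma niceD h k : nice h -> nice k -> nice (fun t => h t + k t).
Proof.
move=> /niceP [h1 h2] /niceP [k1 k2]; apply/niceP; split; first exact: CmeasD.
exact: bddCD.
Qed.

Lemma niceM h k : nice h -> nice k -> nice (fun t => h t * k t).
Proof.
move=> /niceP [h1 h2] /niceP [k1 k2]; apply/niceP; split; first exact: CmeasM.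
exact: bddCM.
Qed.

Lemma nice_cst c : nice (fun=> c).
Proof. by apply/niceP; split; [exact: Cmeas_cst|exact: bddC_cst]. Qed.

Lemma nice_conj h : nice h -> nice (fun t => (h t)^*%C).
Proof.
by move=> /niceP [h1 h2]; apply/niceP; split; [exact: Cmeas_conj|exact: bddC_conj].
Qed.

Lemma nice_sum I (s : seq I) (h : I -> R -> C) :
  (forall i, nice (h i)) -> nice (fun t => \sum_(i <- s) h i t).
Proof.
move=> hh; elim: s => [|i s ih].
  by apply: (nice_ext _ (nice_cst 0)) => t _; rewrite big_nil.
by apply: (nice_ext _ (niceD (hh i) ih)) => t _; rewrite big_cons.
Qed.

Lemma nice_real h : rnice h -> nice (fun t => (h t)%:C).
Proof. by move=> hh; split=> //=; exact: rnice_cst. Qed.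

Lemma nice_expi : nice (@expi R).
Proof. by split=> /=; [exact: rnice_cos|exact: rnice_sin]. Qed.

Lemma nice_expiV : nice (fun t => (@expi R t)^-1).
Proof. by apply: nice_ext (nice_conj nice_expi) => t _; exact: expi_conj. Qed.

Lemma niceX h n : nice h -> nice (fun t => h t ^+ n).
Proof.
move=> hn; elim: n => [|n ih].
  by apply: nice_ext (nice_cst 1) => t _; rewrite expr0.
by apply: nice_ext (niceM hn ih) => t _; rewrite exprS.
Qed.

Lemma nice_Cintegrable h : nice h -> Cintegrable h.
Proof. by move=> [h1 h2]; split; exact: rnice_integrable. Qed.

(** This removes from the integrals both the arbitrary values W and the default values of [invmx] at
    singular angles. *)
Lemma Cint_fix (E : set R) h k : finite_set E -> (forall t, A t -> ~ E t -> h t = k t) ->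
  nice h -> Cintegral h = Cintegral k.
Proof.
move=> fE hk hn; have mE : mu.-negligible E.
  exists E; split=> //.
    by apply: countable_measurable; [exact: measurable_set1|exact: finite_set_countable].
  by apply: countable_lebesgue_measure0; exact: finite_set_countable.
have kn : Cmeas k := Cmeas_fix fE hk (nice_Cmeas hn).
have main (f g : R -> R) : measurable_fun A f -> measurable_fun A g ->
    (forall t, A t -> ~ E t -> f t = g t) -> Rintegral mu A f = Rintegral mu A g.
  move=> mf mg fg; rewrite /Rintegral; congr fine; apply: ae_eq_integral.
  - exact: measurable_angles.
  - exact/measurable_EFinP.
  - exact/measurable_EFinP.
  apply: negligibleS mE => t /= ht; apply: contrapT => Et; apply: ht => At.
  by rewrite fg.
have [[r1 _] [i1 _]] := hn; have [r2 i2] := kn.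
by rewrite /Cintegral; congr Complex; apply: main => // t At Et; rewrite hk.
Qed.

Lemma eq_Cint h k : (forall t, A t -> h t = k t) -> Cintegral h = Cintegral k.
Proof.
move=> hk; rewrite /Cintegral; congr Complex; apply: eq_Rintegral => t;
  by rewrite inE => At; rewrite hk.
Qed.

Let mA := measurable_angles.

Lemma CintD h k : nice h -> nice k ->
  Cintegral (fun t => h t + k t) = Cintegral h + Cintegral k.
Proof.
move=> [h1 h2] [k1 k2]; rewrite /Cintegral; apply/eqP; rewrite eq_complex /=.
apply/andP; split; apply/eqP.
  by rewrite -RintegralD //; [apply: eq_Rintegral => t _; exact: ReD|exact: rnice_integrable|exact: rnice_integrable].
by rewrite -RintegralD //; [apply: eq_Rintegral => t _; exact: ImD|exact: rnice_integrable|exact: rnice_integrable].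
Qed.

Lemma RintZ c h : rnice h -> Rintegral mu A (fun t => c * h t) = c * Rintegral mu A h.
Proof. by move=> hn; rewrite RintegralZl //; exact: rnice_integrable. Qed.

Lemma RintN h : rnice h -> Rintegral mu A (fun t => - h t) = - Rintegral mu A h.
Proof.
by move=> hn; rewrite -mulN1r -RintZ //; apply: eq_Rintegral => t _; rewrite mulN1r.
Qed.

Lemma CintZ c h : nice h -> Cintegral (fun t => c * h t) = c * Cintegral h.
Proof.
move=> [h1 h2]; have rn b k : rnice k -> rnice (fun t => b * k t).
  by move=> kn; apply: rniceM => //; exact: rnice_cst.
rewrite /Cintegral; apply/eqP; rewrite eq_complex.
case: c => a b /=; apply/andP; split; apply/eqP.
  rewrite -!RintZ // -RintegralB //; [|exact: rnice_integrable (rn _ _ _)|exact: rnice_integrable (rn _ _ _)].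
  by apply: eq_Rintegral => t _; case: (h t).
rewrite -!RintZ // -RintegralD //; [|exact: rnice_integrable (rn _ _ _)|exact: rnice_integrable (rn _ _ _)].
by apply: eq_Rintegral => t _; case: (h t).
Qed.

Lemma Cint_conj h : nice h -> Cintegral (fun t => (h t)^*%C) = (Cintegral h)^*%C.
Proof.
move=> [h1 h2]; rewrite /Cintegral; apply/eqP; rewrite eq_complex /= -RintN //.
by apply/andP; split; apply/eqP; apply: eq_Rintegral => t _; [exact: ReJ|exact: ImJ].
Qed.

Lemma Cint_sum I (s : seq I) (h : I -> R -> C) : (forall i, nice (h i)) ->
  Cintegral (fun t => \sum_(i <- s) h i t) = \sum_(i <- s) Cintegral (h i).
Proof.
move=> hh; elim: s => [|i s ih].
  rewrite big_nil (eq_Cint (k := fun=> 0 * 0)); last by move=> t _; rewrite big_nil mul0r.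
  by rewrite CintZ ?mul0r //; exact: nice_cst.
rewrite big_cons -ih -CintD //; last exact: nice_sum.
by apply: eq_Cint => t _; rewrite big_cons.
Qed.

Lemma Cint_real h : Cintegral (fun t => (h t)%:C) = (Rintegral mu A h)%:C.
Proof.
rewrite /Cintegral /=; congr Complex.
by rewrite Rintegral_cst ?mul0r //.
Qed.

Lemma Rint_ge0 h : (forall t, A t -> 0 <= h t) -> 0 <= Rintegral mu A h.
Proof. by move=> h0; apply: Rintegral_ge0. Qed.

Lemma le_Rint h k : rnice h -> rnice k -> (forall t, A t -> h t <= k t) ->
  Rintegral mu A h <= Rintegral mu A k.
Proof. by move=> hn kn hk; apply: le_Rintegral => //; exact: rnice_integrable. Qed.

Lemma expi_X (t : R) n : expi t ^+ n = expi (n%:R * t).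
Proof.
elim: n => [|n ih]; first by rewrite expr0 mul0r /expi cos0 sin0.
rewrite exprS ih /expi -natr1 mulrDl mul1r cosD sinD.
by apply/eqP; rewrite eq_complex /=; apply/andP; split; apply/eqP; ring.
Qed.

Lemma sin_nat_pi (n : nat) : sin (n%:R * pi) = 0 :> R.
Proof.
elim: n => [|n ih]; first by rewrite mul0r sin0.
by rewrite -natr1 mulrDl mul1r sinD ih sinpi mul0r mulr0 addr0.
Qed.

Lemma Rint_cos (n : nat) : (0 < n)%N -> Rintegral mu A (fun t => cos (n%:R * t)) = 0.
Proof.
move=> n0; have nR : (n%:R : R) != 0 by rewrite pnatr_eq0 -lt0n.
have cF : continuous (fun t : R => cos (n%:R * t)).
  by move=> t; apply: continuous_comp; [exact: mulrl_continuous|exact: continuous_cos].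
have der (x : R) : is_derive x 1 (fun t => n%:R^-1 * sin (n%:R * t)) (cos (n%:R * x)).
  apply: trigger_derive; rewrite /GRing.scale /=; field.
  by [].
have cG : continuous (fun t : R => n%:R^-1 * sin (n%:R * t)).
  by move=> t; apply: differentiable_continuous; apply/derivable1_diffP; exact: ex_derive.
have iF : mu.-integrable `[0, pi]%classic (EFin \o (fun t : R => cos (n%:R * t))).
  by apply: continuous_compact_integrable; [exact: segment_compact|exact: continuous_subspaceT].
rewrite /angles Rintegral_itv_obnd_cbnd; last first.
  apply: (integrableS _ _ _ iF) => //; exact: subset_itv_oo_cc.
rewrite Rintegral_itv_bndo_bndc; last first.
  apply: (integrableS _ _ _ iF) => //; exact: subset_itv_co_cc.
rewrite /Rintegral (continuous_FTC2 (F := fun t => n%:R^-1 * sin (n%:R * t))).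
- by rewrite mulr0 sin0 mulr0 sin_nat_pi mulr0 -EFinB subr0.
- exact: pi_gt0.
- exact: continuous_subspaceT.
- split; first by move=> x _; exact: ex_derive.
  + by apply: cvg_at_right_filter; exact: cG.
  + by apply: cvg_at_left_filter; exact: cG.
- by move=> x _; rewrite derive1E; exact: derive_val.
Qed.

(** The integrand is 2 cos((k - n) t). The second summand is essential: over (0, pi) an odd power of
    e^{it} alone has nonzero integral. *)
Lemma Cint_pow (n k : nat) :
  Cintegral (fun t : R => expi t ^- n * expi t ^+ k + (expi t)^-1 ^- n * (expi t)^-1 ^+ k) =
  (if n == k then 2 * pi else 0 : R)%:C.
Proof.
wlog nk : n k / (n <= k)%N.
  move=> H; case: (leqP n k) => [/H//|/ltnW kn].
  rewrite eq_sym -H //; apply: eq_Cint => t _.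
  by rewrite !exprVn !invrK addrC; congr (_ + _); rewrite mulrC.
have -> : Cintegral (fun t : R => expi t ^- n * expi t ^+ k + (expi t)^-1 ^- n * (expi t)^-1 ^+ k) =
   Cintegral (fun t : R => (2 * cos ((k - n)%:R * t))%:C).
  apply: eq_Cint => t _; rewrite -[in LHS](subnK nk) !exprD.
  have e0 := expi_neq0 t.
  have en : expi t ^+ n != 0 by rewrite expf_neq0.
  rewrite !exprVn !invrK mulrCA mulVf // mulr1 mulrCA mulfV // mulr1.
  rewrite expi_X -expi_conj; apply/eqP; rewrite eq_complex /=; apply/andP; split; apply/eqP; ring.
rewrite Cint_real; congr (_%:C).
case: eqP => [->|/eqP nk'].
  rewrite subnn; under eq_Rintegral do rewrite mul0r cos0 mulr1.
  rewrite Rintegral_cst //.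
  suff e : lebesgue_measure A = pi%:E :> \bar R by exact: (congr1 (fun y => 2 * fine y) e).
  by rewrite /angles lebesgue_measure_itv /= lte_fin pi_gt0 -EFinB subr0.
rewrite RintZ; last first.
  split; last by exists 1 => t _; rewrite ler_norml cos_geN1 cos_le1.
  apply: measurable_funTS; apply: continuous_measurable_fun => t.
  by apply: continuous_comp; [exact: mulrl_continuous|exact: continuous_cos].
by rewrite Rint_cos ?mulr0 // subn_gt0 ltn_neqAle nk' nk.
Qed.

Lemma nice_invX n : nice (fun t : R => expi t ^- n).
Proof. by apply: nice_ext (niceX n nice_expiV) => t _; rewrite exprVn. Qed.

Lemma nice_invVX n : nice (fun t : R => (expi t)^-1 ^- n).
Proof. by apply: nice_ext (niceX n nice_expi) => t _; rewrite exprVn invrK. Qed.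

Lemma Cint_laurent (N : nat) (s : {poly C}) :
  Cintegral (fun t : R => expi t ^- N * s.[expi t] + (expi t)^-1 ^- N * s.[(expi t)^-1]) =
  (2 * pi)%:C * s`_N.
Proof.
have pn k : nice (fun t : R => expi t ^- N * expi t ^+ k + (expi t)^-1 ^- N * (expi t)^-1 ^+ k).
  apply: niceD; apply: niceM.
  - exact: nice_invX.
  - exact: niceX nice_expi.
  - exact: nice_invVX.
  - exact: niceX nice_expiV.
pose h k (t : R) := s`_k * (expi t ^- N * expi t ^+ k + (expi t)^-1 ^- N * (expi t)^-1 ^+ k).
have hn k : nice (h k) by exact: (niceM (nice_cst _) (pn k)).
(* The range is widened so that the index N occurs even when it exceeds the degree of s. *)
have -> : Cintegral (fun t : R => expi t ^- N * s.[expi t] + (expi t)^-1 ^- N * s.[(expi t)^-1]) =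
    Cintegral (fun t : R => \sum_(0 <= k < maxn (size s) N.+1) h k t).
  apply: eq_Cint => t _.
  have hc (z : C) : s.[z] = \sum_(0 <= k < maxn (size s) N.+1) s`_k * z ^+ k.
    rewrite (@horner_coef_wide _ (maxn (size s) N.+1)) ?leq_maxl //.
    by rewrite [RHS](big_mkord xpredT (fun k => s`_k * z ^+ k)).
  rewrite !hc !mulr_sumr -big_split; apply: eq_bigr => k _ /=.
  by rewrite /h mulrDr; congr (_ + _); rewrite mulrCA.
rewrite (Cint_sum _ hn).
have hI k : Cintegral (h k) = s`_k * (if N == k then 2 * pi else 0 : R)%:C.
  by rewrite (CintZ _ (pn k)) Cint_pow.
under eq_bigr do rewrite hI.
rewrite (bigD1_seq N) ?iota_uniq ?mem_index_iota //=; last by rewrite leq_max ltnSn orbT.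
rewrite eqxx big1 ?addr0 1?mulrC // => k kN.
by rewrite eq_sym (negbTE kN) mulr0.
Qed.

End NiceFunctions.

(** * The form Q *)

Section SpectralForm.
Variables (R : realType) (q d r : nat).
Variables (HC : 'M[R[i]]_d) (V : 'M[R[i]]_(d, r)).
Hypothesis hHC : HC = HC^t*.
Hypothesis ha : 0 < ahop R q.
Hypothesis hd : (0 < d)%N.
Variable W : R -> {linear 'cV[R[i]]_r -> state R d r}.
Local Notation C := R[i].
Local Notation state := (state R d r).
Local Notation J := (Jop q HC V).
Local Notation a := (ahop R q).
Local Notation F := (Fmx q HC V).
Local Notation S := (Smx q HC V).
Local Notation Y := (Ymx q HC V).
Local Notation T := (Tmx q HC V).
Local Notation A := (@angles R).
Local Notation Theta := (ThetaF q HC V).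
Local Notation regular := (regular q HC V).
Local Notation PsiPsi_reg := (PsiPsi_reg q HC V).

Let ac0 : a%:C != 0 :> C.
Proof. by rewrite (inj_eq (@complexI R)) gt_eqF. Qed.

Lemma Theta_finite : finite_set Theta.
Proof. exact: ThetaF_finite. Qed.

Lemma Theta_regular t : A t -> ~ Theta t -> regular t.
Proof. exact: ThetaF_unit. Qed.

Lemma bddC_sub (P P' : R -> Prop) (h : R -> C) : (forall t, P' t -> P t) -> bddC P h -> bddC P' h.
Proof. by move=> PsiPsi_reg' [K hK]; exists K => t /PsiPsi_reg'; exact: hK. Qed.

Lemma Cmeas_laurent L h : laurent L h -> Cmeas (fun t : R => h (expi t)).
Proof.
move=> [p _ hp].
have m1 : nice (fun t : R => expi t ^- L * p.[expi t]).
  apply: niceM; first exact: nice_invX.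
  have ns : nice (fun t : R => \sum_(i < size p) p`_i * expi t ^+ i).
    apply: nice_sum => i; apply: niceM; [exact: nice_cst|exact: (niceX _ (nice_expi R))].
  by apply: nice_ext ns => t _; rewrite horner_coef.
by apply: Cmeas_ext (nice_Cmeas m1) => t; rewrite hp // expi_neq0.
Qed.

Lemma Cmeas_sum I (s : seq I) (h : I -> R -> C) :
  (forall i, Cmeas (h i)) -> Cmeas (fun t => \sum_(i <- s) h i t).
Proof.
move=> hh; elim: s => [|i s ih].
  by apply: (Cmeas_ext _ (Cmeas_cst 0)) => t; rewrite big_nil.
by apply: (Cmeas_ext _ (CmeasD (hh i) ih)) => t; rewrite big_cons.
Qed.

(** Measurability and boundedness come from different expressions: k is a quotient of Laurent
    polynomials, h the matrix function known to be bounded at regular angles. *)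
Lemma nice_regular (h k : R -> C) : (forall t, A t -> regular t -> k t = h t) ->
  Cmeas k -> bddC regular h -> nice h.
Proof.
move=> kh mk bh; apply/niceP; split.
  by apply: (Cmeas_fix Theta_finite _ mk) => t At Tt; apply: kh => //; exact: Theta_regular.
apply: (bddC_fix Theta_finite); apply: bddC_sub bh => t [At Tt].
exact: Theta_regular.
Qed.

Lemma nice_Smx i j : nice (fun t => S (expi t) i j).
Proof.
apply: (@nice_regular _ (fun t => (\det (F (expi t)))^-1 * T (expi t) i j)).
- move=> t At rt; by rewrite (Tmx_Smx rt) mxE mulKf.
- apply: CmeasM.
    by apply: Cmeas_inv; exact: (Cmeas_laurent (laurent_detF q HC V)).
  exact: (Cmeas_laurent (laurent_Tmx q HC V hd i j)).
- exact: bddC_Smx.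
Qed.

Lemma nice_Ymx i j : nice (fun t => Y (expi t) i j).
Proof.
pose L (z : C) := (\adj (F z) *m V) i j.
apply: (@nice_regular _ (fun t => ((expi t)^-1 - expi t) * ((\det (F (expi t)))^-1 * L (expi t)))).
- move=> t At rt; rewrite /L /Ymx /invmx [_ \in _]rt -scalemxAl.
  by move: (\adj _ *m V) => B; rewrite !mxE.
- apply: CmeasM.
    apply: CmeasD; first exact: nice_Cmeas (@nice_expiV R).
    by apply: (Cmeas_ext _ (CmeasM (Cmeas_cst (-1)) (nice_Cmeas (nice_expi R)))) => t; rewrite mulN1r.
  apply: CmeasM; first by apply: Cmeas_inv; exact: (Cmeas_laurent (laurent_detF q HC V)).
  rewrite /L; under eq_fun do rewrite mxE.
  apply: Cmeas_sum => k; apply: CmeasM (Cmeas_cst _).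
  exact: (Cmeas_laurent (@laurent_adj _ _ F i k (laurent_Fmx q HC V))).
- exact: bddC_Ymx.
Qed.

(** The component of [Psi] at index n, which stands for site n + 1; hence the exponents [n.+1]. *)
Definition Gn (n : nat) (t : R) : 'M[C]_r :=
  expi t ^+ n.+1 *: 1%:M + expi t ^- n.+1 *: S (expi t).

(* [fhat] without the arbitrary values on ThetaF; it is what all integrals are computed with. *)
Definition fcoef (f : state) (t : R) : 'cV[C]_r := \col_c ip f (Psi q HC V (expi t) (evec R c)).

Lemma PsiE t alpha n : (Psi q HC V (expi t) alpha).2 n = Gn n t *m alpha.
Proof.
rewrite Psi_E /Gn; move: (S (expi t)) => B.
by rewrite /= mulmxDl -!scalemxAl mul1mx.
Qed.

Lemma fcoefE f t N : (forall n, (N <= n)%N -> f.2 n = 0) ->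
  fcoef f t = (Y (expi t))^t* *m f.1 + \sum_(0 <= n < N) (Gn n t)^t* *m f.2 n.
Proof.
move=> h; apply/matrixP => c j; rewrite ord1 mxE (ip_finl _ h) /psum.
rewrite [RHS]mxE summxE; congr (_ + _).
  rewrite Psi_E /= -[Y _ in LHS]adjmxK -dotc_adj; exact: dotc_evec.
by apply: eq_bigr => n _; rewrite PsiE -[Gn _ _ in LHS]adjmxK -dotc_adj; exact: dotc_evec.
Qed.

Lemma fcoefD f g t : finsupp f -> finsupp g -> fcoef (f + g) t = fcoef f t + fcoef g t.
Proof. by move=> ff fg; apply/matrixP => c j; rewrite !mxE ip_finlDl. Qed.

Lemma fcoefZ b f t : finsupp f -> fcoef (b *: f) t = b *: fcoef f t.
Proof. by move=> ff; apply/matrixP => c j; rewrite !mxE ip_finlZl. Qed.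

Lemma fcoefJ f t : finsupp f -> regular t -> fcoef (J f) t = (2 * a * cos t)%:C *: fcoef f t.
Proof.
move=> ff rt; apply/matrixP => c j; rewrite !mxE (ip_Jop_finl q V hHC _ ff).
by rewrite Jop_Psi ?expi_neq0 // xspec_expi ip_finlZr // conjc_real.
Qed.

Lemma fcoef_sum I (s : seq I) (f : I -> state) t : (forall i, finsupp (f i)) ->
  fcoef (\sum_(i <- s) f i) t = \sum_(i <- s) fcoef (f i) t.
Proof.
move=> h; elim: s => [|i s ih].
  by rewrite !big_nil; apply/matrixP => c j; rewrite !mxE ip0l.
by rewrite !big_cons fcoefD ?ih //; exact: finsupp_sum.
Qed.

Lemma PsiPsi_reg_dotc f g t : finsupp g -> PsiPsi_reg t f g = dotc (fcoef f t) (fcoef g t).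
Proof.
move=> fg; apply: eq_bigr => c _; rewrite !mxE; congr (_ * _).
exact: ip_finlC.
Qed.

Lemma nice_fcoef f c : finsupp f -> nice (fun t => fcoef f t c 0).
Proof.
move=> [N h].
apply: (@nice_ext _ (fun t => \sum_k (Y (expi t) k c)^*%C * f.1 k 0 +
    \sum_(0 <= n < N) \sum_k ((expi t ^+ n.+1 * (k == c)%:R + expi t ^- n.+1 * S (expi t) k c))^*%C * f.2 n k 0)).
  move=> t _; rewrite (fcoefE _ h) [RHS]mxE summxE; congr (_ + _).
    by rewrite mxE; apply: eq_bigr => k _; rewrite adjmxE.
  by apply: eq_bigr => n _; rewrite mxE; apply: eq_bigr => k _; rewrite adjmxE !mxE.
apply: niceD.
  by apply: nice_sum => k; apply: niceM; [apply: nice_conj; exact: nice_Ymx|exact: nice_cst].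
apply: nice_sum => n; apply: nice_sum => k; apply: niceM; last exact: nice_cst.
apply: nice_conj; apply: niceD; apply: niceM.
- exact: (niceX _ (nice_expi R)).
- exact: nice_cst.
- exact: nice_invX.
- exact: nice_Smx.
Qed.

Lemma nice_dotc_fcoef f g : finsupp f -> finsupp g -> nice (fun t => dotc (fcoef f t) (fcoef g t)).
Proof.
move=> ff fg; apply: nice_sum => c; apply: niceM; first exact: nice_fcoef.
by apply: nice_conj; exact: nice_fcoef.
Qed.

Lemma PsiPsi_regular t f g : ~ Theta t -> PsiPsi_form q HC V W t f g = PsiPsi_reg t f g.
Proof.
move=> Tt; rewrite /PsiPsi_form /PsiPsi_reg; apply: eq_bigr => c _.
by rewrite /rank1_form /Psith; case: asboolP.
Qed.

Lemma nice_PsiPsi f g : finsupp f -> finsupp g -> nice (fun t => PsiPsi_form q HC V W t f g).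
Proof.
move=> ff fg; have /niceP [m1 [K hK]] := nice_dotc_fcoef ff fg.
apply: (nice_fix Theta_finite _ m1); last by exists K => t [At _]; exact: hK.
by move=> t _ Tt; rewrite PsiPsi_regular // PsiPsi_reg_dotc.
Qed.

Definition Qform (f g : state) : C := cont_form q HC V W f g.

Lemma QformE f g : finsupp f -> finsupp g ->
  Qform f g = ((2 * pi)^-1)%:C * Cintegral (fun t => dotc (fcoef f t) (fcoef g t)).
Proof.
move=> ff fg; rewrite /Qform /cont_form; congr (_ * _); apply/esym.
apply: (Cint_fix Theta_finite _ (nice_dotc_fcoef ff fg)) => t _ Tt.
by rewrite PsiPsi_regular // PsiPsi_reg_dotc.
Qed.

Lemma QformDl f g h : finsupp f -> finsupp g -> finsupp h ->
  Qform (f + g) h = Qform f h + Qform g h.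
Proof.
move=> ff fg fhh; rewrite !QformE //; last exact: finsuppD.
rewrite -mulrDr -CintD; [|exact: nice_dotc_fcoef|exact: nice_dotc_fcoef].
by congr (_ * _); apply: eq_Cint => t _; rewrite fcoefD // dotcDl.
Qed.

Lemma QformZl c f h : finsupp f -> finsupp h -> Qform (c *: f) h = c * Qform f h.
Proof.
move=> ff fhh; rewrite !QformE //; last exact: finsuppZ.
rewrite mulrCA -(CintZ c (nice_dotc_fcoef ff fhh)).
by congr (_ * _); apply: eq_Cint => t _; rewrite fcoefZ // dotcZl.
Qed.

Lemma QformC f g : finsupp f -> finsupp g -> Qform g f = (Qform f g)^*%C.
Proof.
move=> ff fg; rewrite !QformE // conjcM conjc_real -(Cint_conj (nice_dotc_fcoef ff fg)).
by congr (_ * _); apply: eq_Cint => t _; exact: dotcC.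
Qed.

Lemma Qformff f : finsupp f -> Qform f f =
  ((2 * pi)^-1 * Rintegral lebesgue_measure A (fun t => vsqnorm (fcoef f t)))%:C.
Proof.
move=> ff; rewrite QformE // rmorphM /= -Cint_real; congr (_ * _).
by apply: eq_Cint => t _; rewrite dotcvv.
Qed.

Lemma Qform_ge0 f : finsupp f -> 0 <= Qform f f.
Proof.
move=> ff; rewrite Qformff // lecR mulr_ge0 //; first by rewrite invr_ge0 mulr_ge0 // pi_ge0.
by apply: Rint_ge0 => t _; exact: vsqnorm_ge0.
Qed.

(** At a regular angle J acts on the transform as multiplication by the real number 2 a cos t. *)
Lemma QformJ f g : finsupp f -> finsupp g -> Qform (J f) g = Qform f (J g).
Proof.
move=> ff fg; have fJf := Jop_finsupp q HC V ff; have fJg := Jop_finsupp q HC V fg.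
rewrite (QformE fJf fg) (QformE ff fJg).
have -> // : Cintegral (fun t => dotc (fcoef (J f) t) (fcoef g t)) =
             Cintegral (fun t => dotc (fcoef f t) (fcoef (J g) t)).
apply: (Cint_fix Theta_finite _ (nice_dotc_fcoef fJf fg)) => t At Tt.
have rt := Theta_regular At Tt.
by rewrite (fcoefJ ff rt) (fcoefJ fg rt) dotcZl dotcZr conjc_real.
Qed.

Lemma rnice_vsq_fcoef f : finsupp f -> rnice (fun t => vsqnorm (fcoef f t)).
Proof.
move=> ff; have [h _] := nice_dotc_fcoef ff ff.
rewrite (_ : (fun t => _) = (fun t => complex.Re (dotc (fcoef f t) (fcoef f t)))) //.
by apply/funext => t; rewrite dotcvv.
Qed.

End SpectralForm.

(** * Boundedness of Q *)

Section SpectralFormBounded.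
Variables (R : realType) (q d r : nat).
Variables (HC : 'M[R[i]]_d) (V : 'M[R[i]]_(d, r)).
Hypothesis hHC : HC = HC^t*.
Hypothesis ha : 0 < ahop R q.
Hypothesis hd : (0 < d)%N.
Variable W : R -> {linear 'cV[R[i]]_r -> state R d r}.
Local Notation C := R[i].
Local Notation normc := (@Normc.normc R).
Local Notation state := (state R d r).
Local Notation S := (Smx q HC V).
Local Notation Y := (Ymx q HC V).
Local Notation A := (@angles R).
Local Notation Theta := (ThetaF q HC V).
Local Notation regular := (regular q HC V).
Local Notation fcoef := (fcoef q HC V).
Local Notation Gn := (Gn q HC V).
Local Notation Q := (Qform q HC V W).

Definition inpart (f : state) (N : nat) (t : R) : 'cV[C]_r :=
  \sum_(0 <= n < N) expi t ^- n.+1 *: f.2 n.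

Definition outpart (f : state) (N : nat) (t : R) : 'cV[C]_r :=
  \sum_(0 <= n < N) expi t ^+ n.+1 *: f.2 n.

Lemma Gn_adj n t : (Gn n t)^t* = expi t ^- n.+1 *: 1%:M + expi t ^+ n.+1 *: (S (expi t))^t*.
Proof.
rewrite /Gn; move: (S (expi t)) => B; rewrite adjmxD !adjmxZ adjmx_scalar conjc1.
by rewrite conjcV conjcX !expi_conj exprVn invrK.
Qed.

Lemma fcoef_parts f N t : (forall n, (N <= n)%N -> f.2 n = 0) ->
  fcoef f t = (Y (expi t))^t* *m f.1 + (inpart f N t + (S (expi t))^t* *m outpart f N t).
Proof.
move=> h; rewrite (fcoefE _ _ _ _ h); congr (_ + _); rewrite /inpart /outpart.
under eq_bigr do rewrite Gn_adj.
move: ((S (expi t))^t* ) => B; rewrite mulmx_sumr -big_split; apply: eq_bigr => n _ /=.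
by rewrite mulmxDl -!scalemxAl mul1mx scalemxAr.
Qed.

Lemma vsq_Sadj t w : regular t -> vsqnorm ((S (expi t))^t* *m w) = vsqnorm w.
Proof.
move=> rt; apply: complexI; rewrite -!dotcvv dotc_adj adjmxK mulmxA.
by rewrite (Smx_expi_unitary hHC rt) mul1mx.
Qed.

Lemma dotc_suml m I (s : seq I) (v : I -> 'cV[C]_m) w :
  dotc (\sum_(i <- s) v i) w = \sum_(i <- s) dotc (v i) w.
Proof. by apply: (big_morph (fun v => dotc v w)); [move=> ? ?; exact: dotcDl|exact: dotc0l]. Qed.

Lemma dotc_sumr m I (s : seq I) (v : I -> 'cV[C]_m) w :
  dotc w (\sum_(i <- s) v i) = \sum_(i <- s) dotc w (v i).
Proof. by apply: (big_morph (dotc w)); [move=> ? ?; exact: dotcDr|exact: dotc0r]. Qed.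

(** By unitarity of S, the contribution of the half-lines to the squared norm of the transform is at
    most twice this sum. It contains the powers of z together with those of 1/z, so Parseval holds
    on the half circle. *)
Definition fourier_sum f N t := vsqnorm (inpart f N t) + vsqnorm (outpart f N t).

Lemma fourier_sumE f N t : (fourier_sum f N t)%:C =
  \sum_(0 <= n < N) \sum_(0 <= m < N) dotc (f.2 n) (f.2 m) *
    (expi t ^- n.+1 * expi t ^+ m.+1 + (expi t)^-1 ^- n.+1 * (expi t)^-1 ^+ m.+1).
Proof.
rewrite /fourier_sum rmorphD /= -!dotcvv !dotc_suml -big_split; apply: eq_bigr => n _.
rewrite !dotc_sumr -big_split; apply: eq_bigr => m _ /=.
rewrite !dotcZl !dotcZr conjcV !conjcX !expi_conj.
rewrite mulrDr !exprVn !invrK; congr (_ + _); rewrite mulrA mulrC //.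
Qed.

Lemma nice_fourier f N : nice (fun t => (fourier_sum f N t)%:C).
Proof.
under eq_fun do rewrite fourier_sumE.
apply: nice_sum => n; apply: nice_sum => m; apply: niceM; first exact: nice_cst.
apply: niceD; apply: niceM.
- exact: nice_invX.
- exact: (niceX _ (nice_expi R)).
- exact: nice_invVX.
- exact: (niceX _ (nice_expiV R)).
Qed.

Lemma Rint_fourier f N : Rintegral lebesgue_measure A (fourier_sum f N) =
  2 * pi * \sum_(0 <= n < N) vsqnorm (f.2 n).
Proof.
apply: complexI; rewrite -Cint_real; under eq_Cint do rewrite fourier_sumE.
rewrite Cint_sum => [|n]; last first.
  apply: nice_sum => m; apply: niceM; first exact: nice_cst.
  apply: niceD; apply: niceM.
  - exact: nice_invX.
  - exact: (niceX _ (nice_expi R)).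
  - exact: nice_invVX.
  - exact: (niceX _ (nice_expiV R)).
rewrite rmorphM rmorph_sum /= mulr_sumr; apply: eq_big_nat => n /andP[_ nN].
have nn m : nice (fun t : R => expi t ^- n.+1 * expi t ^+ m.+1 + (expi t)^-1 ^- n.+1 * (expi t)^-1 ^+ m.+1).
  apply: niceD; apply: niceM.
  - exact: nice_invX.
  - exact: (niceX _ (nice_expi R)).
  - exact: nice_invVX.
  - exact: (niceX _ (nice_expiV R)).
rewrite Cint_sum => [|m]; last by apply: niceM; [exact: nice_cst|exact: nn].
under eq_bigr do rewrite (CintZ _ (nn _)) Cint_pow eqSS.
rewrite (bigD1_seq n) ?mem_index_iota ?iota_uniq //= eqxx big1 => [|m mn].
  by rewrite addr0 dotcvv mulrC.
by rewrite eq_sym (negbTE mn) mulr0.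
Qed.

Lemma rnice_fourier f N : rnice (fourier_sum f N).
Proof. by have [] := nice_fourier f N. Qed.

Lemma fine_mu_angles : fine (@lebesgue_measure R A) = pi.
Proof. by rewrite /angles lebesgue_measure_itv /= lte_fin pi_gt0 -EFinB /= subr0. Qed.

Lemma le_Rint_fix (E : set R) h k : finite_set E -> rnice h -> rnice k ->
  (forall t, A t -> ~ E t -> h t <= k t) ->
  Rintegral lebesgue_measure A h <= Rintegral lebesgue_measure A k.
Proof.
move=> fE hn kn hk; pose h' t := if `[< E t >] then k t else h t.
have hh t : A t -> ~ E t -> h t = h' t by rewrite /h'; case: asboolP.
have hn' : rnice h'.
  split; first exact: (measurable_fun_fix fE hh hn.1).
  have [[K hK] [L hL]] := (hn.2, kn.2); exists (Num.max K L) => t At.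
  by rewrite /h' le_max; case: asboolP => _; rewrite ?hK ?hL ?orbT.
have -> : Rintegral lebesgue_measure A h = Rintegral lebesgue_measure A h'.
  apply: complexI; rewrite -!Cint_real.
  by apply: (Cint_fix fE _ (nice_real hn)) => t At Et; rewrite hh.
apply: le_Rint => // t At; rewrite /h'; case: asboolP => // Et; exact: hk.
Qed.

Lemma Qform_bounded : exists2 K : R, 0 <= K &
  forall f, finsupp f -> complex.Re (Q f f) <= K * sqnormH f.
Proof.
have [K hK] : exists K : R, forall (f : state) t, regular t ->
    vsqnorm ((Y (expi t))^t* *m f.1) <= K * vsqnorm f.1.
  have [b hb] : exists b : 'I_d -> 'I_r -> R, forall i j t, regular t -> normc (Y (expi t) i j) <= b i j.
    have [b hb] := choice (fun ij => bddC_Ymx V hHC ha ij.1 ij.2).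
    by exists (fun i j => b (i, j)) => i j t rt; exact: (hb (i, j)).
  exists (\sum_i \sum_j d%:R * (b j i) ^+ 2) => f t rt.
  apply: (le_trans (vsqnorm_mul_le _ _)); rewrite ler_wpM2r ?vsqnorm_ge0 //.
  apply: ler_sum => i _; apply: ler_sum => j _; rewrite ler_wpM2l // ?ler0n //.
  by rewrite adjmxE normc_conj lerXn2r ?nnegrE ?normc_ge0 ?(le_trans (normc_ge0 _) (hb _ _ t rt)) ?hb.
have pi0 : 0 < (2 * pi : R) by rewrite mulr_gt0 // pi_gt0.
(* Applying [vsqnormD] twice puts the factor 4 before the Fourier sum, whose integral is 2 pi times
   the half-line norm. The absolute value is taken because the sign of K is unknown. *)
exists (`|K| + 4) => [|f ff]; first by rewrite addr_ge0.
have [N h] := ff.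
have le1 : Rintegral lebesgue_measure A (fun t => vsqnorm (fcoef f t)) <=
    Rintegral lebesgue_measure A (fun t => 2 * K * vsqnorm f.1 + 4 * fourier_sum f N t).
  have fT : finite_set Theta by apply: Theta_finite.
  have rv : rnice (fun t => vsqnorm (fcoef f t)) by apply: rnice_vsq_fcoef.
  apply: (le_Rint_fix fT rv) => [|t At Tt].
    apply: rniceD; first exact: rnice_cst.
    by apply: rniceM; [exact: rnice_cst|exact: rnice_fourier].
  have rt := Theta_regular At Tt.
  rewrite (fcoef_parts _ h); apply: (le_trans (vsqnormD _ _)).
  have := hK f t rt; have := vsqnormD (inpart f N t) ((S (expi t))^t* *m outpart f N t).
  rewrite vsq_Sadj // /fourier_sum; lra.
have e1 : Rintegral lebesgue_measure A (fun t => 2 * K * vsqnorm f.1 + 4 * fourier_sum f N t) =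
  (2 * pi) * (K * vsqnorm f.1 + 4 * \sum_(0 <= n < N) vsqnorm (f.2 n)).
  rewrite RintegralD //=; last 3 first.
  - exact: measurable_angles.
  - by apply: rnice_integrable; exact: rnice_cst.
  - by apply: rnice_integrable; apply: rniceM; [exact: rnice_cst|exact: rnice_fourier].
  rewrite (RintZ 4 (rnice_fourier f N)) Rint_fourier.
  rewrite Rintegral_cst //; last exact: measurable_angles.
  rewrite fine_mu_angles; ring.
have -> : Q f f = ((2 * pi)^-1 * Rintegral lebesgue_measure A (fun t => vsqnorm (fcoef f t)))%:C.
  by apply: Qformff.
rewrite [complex.Re _]/=.
have := psum_le_sqnormH N (finsupp_inH ff).
have s0 : 0 <= \sum_(0 <= n < N) vsqnorm (f.2 n) by apply: sumr_ge0 => n _; exact: vsqnorm_ge0.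
have u0 := vsqnorm_ge0 f.1.
move=> le2; rewrite e1 in le1.
rewrite mulrC ler_pdivrMr //; apply: (le_trans le1); rewrite mulrC ler_wpM2r ?(ltW pi0) //.
apply: (@le_trans _ _ ((`|K| + 4) * (vsqnorm f.1 + \sum_(0 <= n < N) vsqnorm (f.2 n)))).
  have k0 : 0 <= (`|K| - K) * vsqnorm f.1 by rewrite mulr_ge0 // subr_ge0 ler_norm.
  have k1 : 0 <= `|K| * \sum_(0 <= n < N) vsqnorm (f.2 n) by rewrite mulr_ge0.
  nra.
by rewrite ler_wpM2l // addr_ge0.
Qed.

End SpectralFormBounded.

#[local] Opaque Smx Tmx Fmx Ymx determinant.

(** * Combinations of sites on which Q is the inner product *)

Section Hankel.
Variables (R : realType) (q d r : nat).
Variables (HC : 'M[R[i]]_d) (V : 'M[R[i]]_(d, r)).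
Hypothesis hHC : HC = HC^t*.
Hypothesis ha : 0 < ahop R q.
Hypothesis hd : (0 < d)%N.
Variable W : R -> {linear 'cV[R[i]]_r -> state R d r}.
Local Notation C := R[i].
Local Notation state := (state R d r).
Local Notation F := (Fmx q HC V).
Local Notation S := (Smx q HC V).
Local Notation T := (Tmx q HC V).
Local Notation Theta := (ThetaF q HC V).
Local Notation regular := (regular q HC V).
Local Notation fcoef := (fcoef q HC V).
Local Notation Gn := (Gn q HC V).
Local Notation Q := (Qform q HC V W).

Lemma nice_horner (s : {poly C}) (h : R -> C) : nice h -> nice (fun t => s.[h t]).
Proof.
move=> hn; have ns : nice (fun t : R => \sum_(i < size s) s`_i * h t ^+ i).
  by apply: nice_sum => i; apply: niceM; [exact: nice_cst|exact: niceX].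
by apply: nice_ext ns => t _; rewrite horner_coef.
Qed.

Lemma nice_laurent N (s : {poly C}) :
  nice (fun t : R => expi t ^- N * s.[expi t] + (expi t)^-1 ^- N * s.[(expi t)^-1]).
Proof.
apply: niceD; apply: niceM.
- exact: nice_invX.
- exact: (nice_horner _ (nice_expi R)).
- exact: nice_invVX.
- exact: (nice_horner _ (nice_expiV R)).
Qed.

Lemma fcoef_delta n (alpha : 'cV[C]_r) t : fcoef (delta d n alpha) t = (Gn n t)^t* *m alpha.
Proof.
rewrite (@fcoefE _ _ _ _ _ _ _ _ n.+1); last by move=> k nk; rewrite /= gtn_eqF.
move: (fun n => (Gn n t)^t* ) => B; rewrite /= mulmx0 add0r big_nat_recr //= eqxx.
by rewrite big_nat big1 ?add0r // => k /andP[_ kn]; rewrite ltn_eqF // mulmx0.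
Qed.

(* With [p] the polynomial [z^d det F(z)], the Fourier transform of this combination is free of
   poles, so that [Q] agrees with the inner product against every [delta m beta]. *)
Definition hankel_comb (p : {poly C}) n (alpha : 'cV[C]_r) : state :=
  \sum_(k < size p) p`_k *: delta d (n + d.*2 - k) alpha.

Lemma hankel_comb_finsupp p n alpha : finsupp (hankel_comb p n alpha).
Proof. by apply: finsupp_sum => k; apply: finsuppZ; exact: delta_finsupp. Qed.

Section OfPoly.
Variable p : {poly C}.
Hypothesis sp : (size p <= d.*2.+1)%N.
Hypothesis hp : forall z, z != 0 -> \det (F z) = z ^- d * p.[z].

(** The sites are numbered downwards in k, so that the negative powers reassemble p(z) with the
    common factor z^-(n + 2 d + 1). The subtraction is a true one because k <= 2 d. *)
Lemma sum_rev_pow (z : C) n : z != 0 ->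
  \sum_(k < size p) p`_k * z ^- (n + d.*2 - k).+1 = z ^- (n + d).+1 * \det (F z).
Proof.
move=> z0; rewrite hp // horner_coef !mulr_sumr; apply: eq_bigr => k _.
have kd : (k <= d.*2)%N by have := ltn_ord k; lia.
have -> : (n + d).+1 = ((n + d.*2 - k).+1 + k - d)%N by lia.
rewrite mulrA mulrCA; congr (_ * _); rewrite -invfM -exprD.
have -> : ((n + d.*2 - k).+1 + k - d + d = (n + d.*2 - k).+1 + k)%N by lia.
by rewrite exprD invfM -mulrA mulVf ?mulr1 // expf_neq0.
Qed.

Lemma sum_comb (x y : 'I_(size p) -> C) (u v : 'cV[C]_r) :
  \sum_(k < size p) (x k *: u + y k *: v) =
  (\sum_(k < size p) x k) *: u + (\sum_(k < size p) y k) *: v.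
Proof. by rewrite big_split !scaler_suml. Qed.

(** On the circle S^* is S(w), and the powers multiplying it sum up to det F(w). Hence the pole
    cancels and T(w) appears. *)
Lemma fcoef_hank n alpha t w : regular t -> w = (expi t)^-1 ->
  fcoef (hankel_comb p n alpha) t = (expi t ^- (n + d).+1 * \det (F (expi t))) *: alpha +
    expi t ^+ (n + d).+1 *: (T w *m alpha).
Proof.
move=> rt hw; have e0 := expi_neq0 t.
have e1 : w != 0 by rewrite hw invr_eq0.
have uw : F w \in unitmx by rewrite hw; exact: (regularV hHC rt).
have eS : (S (expi t))^t* = S w by rewrite hw; exact: Smx_expi_adj.
have ew k : expi t ^+ k = w ^- k by rewrite hw exprVn invrK.
rewrite (Tmx_Smx uw) /hankel_comb fcoef_sum; last first.
  by move=> k; apply: finsuppZ; exact: delta_finsupp.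
have e k : fcoef (p`_k *: delta d (n + d.*2 - k) alpha) t =
    (p`_k * expi t ^- (n + d.*2 - k).+1) *: alpha +
    (p`_k * w ^- (n + d.*2 - k).+1) *: (S w *m alpha).
  rewrite fcoefZ; last exact: delta_finsupp.
  rewrite fcoef_delta Gn_adj eS; move: (S w) => B.
  by rewrite mulmxDl -!scalemxAl mul1mx scalerDr !scalerA ew.
under eq_bigr do rewrite e.
rewrite -scalemxAl; move: (S w *m alpha) => B.
by rewrite sum_comb (sum_rev_pow n e0) (sum_rev_pow n e1) scalerA ew.
Qed.

Lemma Gn_mul m t (v : 'cV[C]_r) : Gn m t *m v = expi t ^+ m.+1 *: v + expi t ^- m.+1 *: (S (expi t) *m v).
Proof. by rewrite mulmxDl -!scalemxAl mul1mx. Qed.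

Lemma mulmx_comb m n (B : 'M[C]_(m, n)) x y (u v : 'cV_n) :
  B *m (x *: u + y *: v) = x *: (B *m u) + y *: (B *m v).
Proof. by rewrite mulmxDr -!scalemxAr. Qed.

Lemma hankel_comb_alg n m (z w D1 D2 p1 p2 : C) (B : 'M[C]_r) (alpha b c beta : 'cV[C]_r) :
  let v := (z ^- (n + d).+1 * D1) *: alpha + z ^+ (n + d).+1 *: b in
  z != 0 -> w = z^-1 -> D1 = z ^- d * p1 -> D2 = w ^- d * p2 ->
  B *m b = D2 *: alpha -> c = D1 *: (B *m alpha) ->
  dotc (z ^+ m.+1 *: v + z ^- m.+1 *: (B *m v)) beta =
  (z ^- (n + d.*2).+1 * (z ^+ m.+1 * p1) + w ^- (n + d.*2).+1 * (w ^+ m.+1 * p2)) *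
    dotc alpha beta +
  (z ^- (m + n + d).+2 * dotc c beta + w ^- (m + n + d).+2 * dotc b beta).
Proof.
move=> v z0 -> hD1 hD2 eb ->; rewrite /v {v} mulmx_comb eb hD2 hD1; move: (B *m alpha) => {eb} B'.
rewrite !(dotcDl, dotcZl).
move: (dotc alpha beta) (dotc B' beta) (dotc b beta) => x y b'.
rewrite -!addnn !exprVn !invrK !exprS !exprD.
have := expf_neq0 m z0; have := expf_neq0 n z0; have := expf_neq0 d z0.
move: (z ^+ m) (z ^+ n) (z ^+ d) => zm zn zd *; field.
by apply/and4P; split.
Qed.

(** Where both factors carry S, unitarity removes it and only p remains. Where one S remains, det F
    turns it into T, whose exponents are at most d; the prefactor z^-(m + n + d + 2) leaves only
    negative powers, without a constant Fourier coefficient. *)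
Lemma dotc_hank n alpha m beta t w : regular t -> w = (expi t)^-1 ->
  dotc (fcoef (hankel_comb p n alpha) t) (fcoef (delta d m beta) t) =
  (expi t ^- (n + d.*2).+1 * ('X^(m.+1) * p).[expi t] +
   w ^- (n + d.*2).+1 * ('X^(m.+1) * p).[w]) * dotc alpha beta +
  (expi t ^- (m + n + d).+2 * dotc (T (expi t) *m alpha) beta +
   w ^- (m + n + d).+2 * dotc (T w *m alpha) beta).
Proof.
move=> rt hw; have e0 := expi_neq0 t.
have e1 : w != 0 by rewrite hw invr_eq0.
have uw : F w \in unitmx by rewrite hw; exact: (regularV hHC rt).
have eS : S w = (S (expi t))^t* by apply/esym; rewrite hw; exact: Smx_expi_adj.
have eST : S (expi t) *m (T w *m alpha) = \det (F w) *: alpha.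
  rewrite mulmxA (Tmx_Smx uw) -scalemxAr eS.
  by rewrite (Smx_expi_unitary hHC rt) -scalemxAl mul1mx.
have eT : T (expi t) *m alpha = \det (F (expi t)) *: (S (expi t) *m alpha).
  by rewrite (Tmx_Smx rt) -scalemxAl.
rewrite fcoef_delta -(dotc_adj (Gn m t)) (fcoef_hank _ _ rt hw) (Gn_mul m t) !hornerM !hornerXn.
exact: (hankel_comb_alg n m beta e0 hw (hp e0) (hp e1) eST eT).
Qed.

Lemma cancel_2pi (x y : C) :
  ((2 * pi)^-1)%:C * (x * ((2 * pi)%:C * y) + (2 * pi)%:C * 0) = x * y.
Proof.
have h : ((2 * pi)^-1)%:C * (2 * pi)%:C = 1 :> C.
  by rewrite -rmorphM /= mulVf // gt_eqF // mulr_gt0 // pi_gt0.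
by move: h; move: (((2 * pi)^-1)%:C) ((2 * pi)%:C) => u v h; rewrite mulr0 addr0 mulrCA [u * _]mulrA h mul1r.
Qed.

Lemma Qform_hankel_comb n alpha m beta :
  Q (hankel_comb p n alpha) (delta d m beta) = ip (hankel_comb p n alpha) (delta d m beta).
Proof.
have fh1 := hankel_comb_finsupp p n alpha; have fd := @delta_finsupp R d r m beta.
have -> : Q (hankel_comb p n alpha) (delta d m beta) = ((2 * pi)^-1)%:C *
    Cintegral (fun t => dotc (fcoef (hankel_comb p n alpha) t) (fcoef (delta d m beta) t)) by apply: QformE.
have [s ss hs] : laurent d (fun z => dotc (T z *m alpha) beta).
  apply: laurent_sum => i.
  apply: (@laurent_ext _ _ (fun z => (beta i 0)^*%C * \sum_j alpha j 0 * T z i j)).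
    by move=> z _; rewrite mxE mulrC; congr (_ * _); apply: eq_bigr => j _; rewrite mulrC.
  by apply: laurentZ; apply: laurent_sum => j; apply: laurentZ; exact: laurent_Tmx.
have e : Cintegral (fun t => dotc (fcoef (hankel_comb p n alpha) t) (fcoef (delta d m beta) t)) =
   Cintegral (fun t : R =>
    dotc alpha beta * (expi t ^- (n + d.*2).+1 * ('X^(m.+1) * p).[expi t] +
     (expi t)^-1 ^- (n + d.*2).+1 * ('X^(m.+1) * p).[(expi t)^-1]) +
    (expi t ^- (m + n + d.*2).+2 * s.[expi t] + (expi t)^-1 ^- (m + n + d.*2).+2 * s.[(expi t)^-1])).
  have fT : finite_set Theta by apply: Theta_finite.
  have nd : nice (fun t => dotc (fcoef (hankel_comb p n alpha) t) (fcoef (delta d m beta) t)) by apply: nice_dotc_fcoef.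
  apply: (Cint_fix fT _ nd) => t At Tt.
  have e0 := expi_neq0 t; have [w hw] : {w | w = (expi t)^-1} by exists (expi t)^-1.
  rewrite (dotc_hank n alpha m beta (Theta_regular At Tt) hw) -hw.
  have e1 : w != 0 by rewrite hw invr_eq0.
  have ex z y : z ^- (m + n + d).+2 * (z ^- d * y) = z ^- (m + n + d.*2).+2 * y :> C.
    by rewrite mulrA -invfM -exprD; congr (_ ^- _ * _); lia.
  have a1 := etrans (congr1 (fun y => expi t ^- (m + n + d).+2 * y) (hs _ e0)) (ex _ _).
  have a2 := etrans (congr1 (fun y => w ^- (m + n + d).+2 * y) (hs _ e1)) (ex _ _).
  exact: (congr2 +%R (mulrC _ _) (congr2 +%R a1 a2)).
rewrite e CintD; [|by apply: niceM; [exact: nice_cst|exact: nice_laurent]|exact: nice_laurent].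
rewrite (CintZ _ (nice_laurent _ _)) !Cint_laurent.
have -> : s`_(m + n + d.*2).+2 = 0 by apply: nth_default; apply: (leq_trans ss); lia.
rewrite cancel_2pi.
rewrite coefXnM.
have ipd k : ip (delta d k alpha) (delta d m beta) = if k == m then dotc alpha beta else 0.
  rewrite (@ip_finr _ _ _ _ _ m.+1); last by move=> l lm; rewrite /= gtn_eqF.
  rewrite /psum /= dotc0l add0r big_nat_recr //= eqxx big_nat big1 ?add0r //.
    by rewrite eq_sym; case: eqP => // _; rewrite dotc0l.
  by move=> l /andP[_ lm]; rewrite (ltn_eqF lm) dotc0r.
have -> : ip (hankel_comb p n alpha) (delta d m beta) =
    \sum_(k < size p) p`_k * ip (delta d (n + d.*2 - k) alpha) (delta d m beta).
  rewrite /hankel_comb ip_suml; last exact: finsupp_inH.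
    by apply: eq_bigr => k _; rewrite ip_finlZl //; exact: delta_finsupp.
  by move=> k; apply: finsupp_inH; apply: finsuppZ; exact: delta_finsupp.
under [RHS]eq_bigr do rewrite ipd.
(* Both sides select the coefficient of p with index n + 2 d - m; the cases are this index being
   negative, below [size p], or beyond it. *)
case: ltnP => h.
  rewrite mulr0 big1 //  => k _; rewrite ifF ?mulr0 //; apply/eqP; lia.
case: (ltnP ((n + d.*2).+1 - m.+1) (size p)) => h2.
  rewrite (bigD1 (Ordinal h2)) //= ifT; last by apply/eqP; lia.
  rewrite big1 ?addr0 1?mulrC // => k /eqP kn; rewrite ifF ?mulr0 //.
  have kd := leq_trans (ltn_ord k) sp; apply/eqP => e2; apply: kn; apply/ord_inj.
  rewrite [RHS]/=; lia.
rewrite (nth_default _ h2) mulr0 big1 // => k _; rewrite ifF ?mulr0 //.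
by apply/eqP; have := ltn_ord k; lia.
Qed.
End OfPoly.

End Hankel.
#[local] Transparent Smx Tmx Fmx Ymx determinant.

#[local] Opaque ip sqnormH.

(** * The pure point subspace *)

Section Subspaces.
Variables (R : realType) (d r : nat).
Local Notation C := R[i].
Local Notation normc := (@Normc.normc R).
Local Notation state := (state R d r).

Lemma state_sum1 I (s : seq I) (F : I -> state) : (\sum_(i <- s) F i).1 = \sum_(i <- s) (F i).1.
Proof. exact: (big_morph (@fst _ _)). Qed.

Lemma state_sum2 I (s : seq I) (F : I -> state) n :
  (\sum_(i <- s) F i).2 n = \sum_(i <- s) (F i).2 n.
Proof. exact: (big_morph (fun g : state => g.2 n)). Qed.

(** The coordinates of h are the conjugate-linear functional's values on the coordinate vectors. On
    the N-th truncation of h both the functional and the squared norm equal the partial sum s N, so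
    s N ^ 2 <= K s N, which bounds the norm of h. *)
Lemma riesz (phi : state -> C) (K : R) : 0 <= K ->
  (forall f g, finsupp f -> finsupp g -> phi (f + g) = phi f + phi g) ->
  (forall c f, finsupp f -> phi (c *: f) = c^*%C * phi f) ->
  (forall f, finsupp f -> normc (phi f) ^+ 2 <= K * sqnormH f) ->
  exists2 h, inH h & forall g, finsupp g -> ip h g = phi g.
Proof.
move=> K0 pD pZ pK.
have p_sum I (s : seq I) (F : I -> state) : (forall i, finsupp (F i)) ->
    phi (\sum_(i <- s) F i) = \sum_(i <- s) phi (F i).
  move=> hF; elim: s => [|i s ih].
    by rewrite !big_nil -(scale0r 0) pZ ?conjc0 ?mul0r //; exact: finsupp0.
  by rewrite !big_cons pD ?ih //; exact: finsupp_sum.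
pose e1 i : state := gen_state (delta_mx i 0) 0.
pose e2 n c : state := delta d n (delta_mx c 0).
have fe1 i : finsupp (e1 i) by exact: gen_state_finsupp.
have fe2 n c : finsupp (e2 n c) by exact: delta_finsupp.
pose h : state := (\col_i phi (e1 i), fun n => \col_c phi (e2 n c)).
have hh g : finsupp g -> ip h g = phi g.
  (* The decomposition carries a positive hopping constant as an argument; no q is present here, and
     q = 1 supplies one. *)
  have h1 : 0 < ahop R 1 by rewrite /ahop sqrtr1.
  move=> fg; have [N hN] := fg; rewrite (ip_finr _ hN) [in RHS](finsupp_decomp h1 hN).
  rewrite pD; [|exact: gen_state_finsupp|by apply: finsupp_sum => n; exact: delta_finsupp].
  rewrite /psum big_mkord p_sum; last by move=> n; exact: delta_finsupp.
  congr (_ + _).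
    rewrite (_ : gen_state g.1 0 = \sum_i g.1 i 0 *: e1 i).
      rewrite p_sum; last by move=> i; exact: finsuppZ.
      by apply: eq_bigr => i _; rewrite pZ // mxE mulrC.
    rewrite [RHS]surjective_pairing state_sum1; congr pair; first by rewrite [LHS]matrix_sum_delta; under eq_bigr do rewrite big_ord1.
    apply/funext => k; rewrite -[RHS]/((\sum_i g.1 i 0 *: e1 i).2 k) state_sum2 big1 => [|i _]; first by case: k.
    by rewrite stateZ2 /e1; case: k => [|k] /=; rewrite scaler0.
  apply: eq_bigr => n _.
  rewrite (_ : delta d n (g.2 n) = \sum_c g.2 n c 0 *: e2 n c).
    rewrite p_sum; last by move=> c; exact: finsuppZ.
    by apply: eq_bigr => c _; rewrite pZ // mxE mulrC.
  rewrite [RHS]surjective_pairing state_sum1; congr pair; first by rewrite big1 // => c _; rewrite /= scaler0.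
  apply/funext => k; rewrite -[RHS]/((\sum_c g.2 n c 0 *: e2 n c).2 k) state_sum2.
  under [RHS]eq_bigr do rewrite stateZ2.
  rewrite /=; case: eqP => kn; last by rewrite big1 // => c _; rewrite /= scaler0.
  by rewrite [LHS]matrix_sum_delta; apply: eq_bigr => c _; rewrite big_ord1.
suff : inH h by exists h.
pose s N := vsqnorm h.1 + \sum_(0 <= n < N) vsqnorm (h.2 n).
have hs N : s N <= K.
  have ft := trunc_finsupp N h.
  have eq1 : ip h (trunc N h) = (s N)%:C.
    rewrite (@ip_finr _ _ _ _ _ N); last by move=> n nN; rewrite /= ltnNge nN.
    rewrite /psum /s dotcvv rmorphD; congr (_ + _).
    by rewrite rmorph_sum; apply: eq_big_nat => n /andP[_ nN]; rewrite /= nN dotcvv.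
  have eq2 : sqnormH (trunc N h) = s N.
    apply: complexI; rewrite -ipff; last exact: finsupp_inH.
    rewrite (@ip_finr _ _ _ _ _ N); last by move=> n nN; rewrite /= ltnNge nN.
    rewrite /psum /s dotcvv rmorphD; congr (_ + _).
    by rewrite rmorph_sum; apply: eq_big_nat => n /andP[_ nN]; rewrite /= nN dotcvv.
  have s0 : 0 <= s N.
    by rewrite addr_ge0 ?vsqnorm_ge0 // sumr_ge0 // => n _; exact: vsqnorm_ge0.
  have := pK _ ft; rewrite -hh // eq1 eq2 normc_real ger0_norm // expr2.
  have [->//|sn] := eqVneq (s N) 0; by rewrite ler_pM2r // lt_neqAle eq_sym sn.
exact: (proj1 (inH_bound hs)).
Qed.

Definition subspace (M : state -> Prop) :=
  [/\ forall f, M f -> inH f, M 0 & forall c f g, M f -> M g -> M (f + c *: g)].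

Lemma subspace_sum M I (s : seq I) (x : I -> C) (F : I -> state) :
  subspace M -> (forall i, M (F i)) -> M (\sum_(i <- s) x i *: F i).
Proof.
move=> [_ M0 MD] hF; elim: s => [|i s ih]; first by rewrite big_nil.
by rewrite big_cons addrC; exact: MD.
Qed.

Definition proj n (phi : 'I_n -> state) (f : state) : state := \sum_j ip f (phi j) *: phi j.

Section Orthonormal.
Variables (n : nat) (phi : 'I_n -> state).
Hypothesis hphi : forall j, inH (phi j).
Hypothesis ophi : forall j k, ip (phi j) (phi k) = (j == k)%:R.

Lemma inH_comb (x : 'I_n -> C) : inH (\sum_j x j *: phi j).
Proof. by apply: inH_sum => j; apply: inHZ. Qed.

Lemma proj_inH f : inH (proj phi f).
Proof. exact: inH_comb. Qed.

Lemma ip_comb (x : 'I_n -> C) k : ip (\sum_j x j *: phi j) (phi k) = x k.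
Proof.
rewrite ip_suml => [|j|//]; last by apply: inHZ.
have e j : ip (x j *: phi j) (phi k) = x j * (j == k)%:R.
  by rewrite (ipZl _ (@hphi j) (@hphi k)) ophi.
under eq_bigr do rewrite e.
rewrite (bigD1 k) //= eqxx mulr1 big1 ?addr0 // => j jk.
by rewrite (negbTE jk) mulr0.
Qed.

Lemma ip_proj f g : inH g -> ip (proj phi f) g = \sum_j ip f (phi j) * ip (phi j) g.
Proof.
move=> hg; rewrite /proj ip_suml => [|j|//]; last by apply: inHZ.
by apply: eq_bigr => j _; rewrite ipZl.
Qed.

Lemma proj_orth f k : inH f -> ip (f - proj phi f) (phi k) = 0.
Proof. by move=> hf; rewrite ipBl ?ip_comb ?subrr //; exact: proj_inH. Qed.

Lemma proj_orth_comb f (x : 'I_n -> C) : inH f ->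
  ip (f - proj phi f) (\sum_j x j *: phi j) = 0.
Proof.
move=> hf; have hb : inH (f - proj phi f) by apply: inHB => //; exact: proj_inH.
rewrite ip_sumr => [|j|//]; last by apply: inHZ.
by rewrite big1 // => j _; rewrite ipZr // proj_orth // mulr0.
Qed.

Lemma pythagoras (f g : state) : inH f -> inH g -> ip f g = 0 -> sqnormH (f + g) = sqnormH f + sqnormH g.
Proof.
move=> hf hg e; have hfg : inH (f + g) by apply: inHD.
apply: complexI; rewrite rmorphD /= -!ipff // ipDl // !ipDr // e (ipC hf hg) e.
by rewrite conjc0 addr0 add0r.
Qed.

Lemma proj_min f (x : 'I_n -> C) : inH f ->
  sqnormH (f - proj phi f) <= sqnormH (f - \sum_j x j *: phi j).
Proof.
move=> hf; set w := \sum_j _.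
have hb : inH (f - proj phi f) by apply: inHB => //; exact: proj_inH.
have -> : f - w = (f - proj phi f) + \sum_j (ip f (phi j) - x j) *: phi j.
  rewrite -addrA; congr (_ + _); rewrite -[LHS](addKr (proj phi f)); congr (_ + _).
  by rewrite /proj /w -sumrB; apply: eq_bigr => j _; rewrite scalerBl.
have hc := @inH_comb (fun j => ip f (phi j) - x j).
rewrite (pythagoras hb hc (proj_orth_comb _ hf)).
by rewrite lerDl (sqnormH_ge0 hc).
Qed.

End Orthonormal.

Lemma subspaceB M f g : subspace M -> M f -> M g -> M (f - g).
Proof. by move=> [_ _ h] hf hg; rewrite -scaleN1r; exact: h. Qed.

(** The Gram matrix of phi is the identity of size n and factors through dimension m. *)
Lemma orthonormal_size n m (phi : 'I_n -> state) (b : 'I_m -> state) (x : 'I_n -> 'I_m -> C) :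
  (forall i, inH (b i)) -> (forall j k, ip (phi j) (phi k) = (j == k)%:R) ->
  (forall j, phi j = \sum_i x j i *: b i) -> (n <= m)%N.
Proof.
move=> hb ophi hx; pose X := \matrix_(j, i) x j i.
pose G := \matrix_(i, k) ip (b i) (b k).
have e : X *m G *m X^t* = 1%:M.
  apply/matrixP => j k; rewrite !mxE -ophi !hx ip_suml => [|i|]; last 2 first.
  - by apply: inHZ.
  - by apply: inH_sum => i; apply: inHZ.
  under eq_bigr do rewrite mxE mulr_suml.
  rewrite exchange_big; apply: eq_bigr => i _; rewrite ipZl //; last first.
    by apply: inH_sum => l; apply: inHZ.
  rewrite ip_sumr //; last by move=> l; apply: inHZ.
  rewrite mulr_sumr; apply: eq_bigr => l _; rewrite ipZr // !mxE /= mulrAC.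
  by rewrite -mulrA.
rewrite -(mxrank1 C n) -e -mulmxA; apply: (leq_trans (mxrankM_maxl _ _)).
exact: rank_leq_col.
Qed.

(** If no orthonormal family spanned M, Gram-Schmidt steps would extend it to m + 1 members, against
    [orthonormal_size]. The b only have to span a space containing M, as is the case for the range
    of P. *)
Lemma onb_exists M m (b : 'I_m -> state) :
  subspace M -> (forall i, inH (b i)) ->
  (forall f, M f -> exists x : 'I_m -> C, f = \sum_i x i *: b i) ->
  exists n (phi : 'I_n -> state), is_onb M phi.
Proof.
move=> hM hb hspan; apply: contrapT => hno.
have ext n : exists phi : 'I_n -> state, (forall j, M (phi j)) /\
    forall j k, ip (phi j) (phi k) = (j == k)%:R.
  elim: n => [|n [phi [hphi ophi]]]; first by exists (fun=> 0); split; case.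
  have Hphi j : inH (phi j) by case: hM => h _ _; exact: h.
  have [f [Mf fE]] : exists f, M f /\ f - proj phi f <> 0.
    apply: contrapT => h; apply: hno; exists n, phi; split=> // f Mf.
    by apply: contrapT => hf; apply: h; exists f; split => // /eqP; rewrite subr_eq0 => /eqP.
  set g := f - proj phi f in fE.
  have Mg : M g by apply: subspaceB => //; exact: subspace_sum.
  have [hf hg] : inH f /\ inH g by case: hM => h _ _; split; exact: h.
  have s0 : 0 < sqnormH g.
    rewrite lt_neqAle sqnormH_ge0 // andbT eq_sym; apply/eqP => e; exact: (fE (sqnormH_eq0 hg e)).
  pose psi := ((Num.sqrt (sqnormH g))^-1)%:C *: g.
  have hpsi : inH psi by apply: inHZ.
  have Mpsi : M psi.
    by case: hM => _ M0 MD; rewrite -[psi]add0r; exact: MD.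
  have npsi : ip psi psi = 1.
    rewrite /psi ipZl ?ipZr // ipff // conjc_real -!rmorphM /= mulrA -invfM -expr2 sqr_sqrtr ?(ltW s0) //.
    by rewrite mulVf // gt_eqF.
  have opsi j : ip psi (phi j) = 0 by rewrite /psi ipZl // /g proj_orth // mulr0.
  have opsi' j : ip (phi j) psi = 0 by rewrite (ipC hpsi) // opsi conjc0.
  exists (fun j => if unlift ord_max j is Some k then phi k else psi); split.
    by move=> j; case: unliftP.
  move=> j k; case: unliftP => [j' ->|->]; case: unliftP => [k' ->|->].
  - by rewrite ophi (inj_eq lift_inj).
  - by rewrite opsi' eq_sym (negbTE (neq_lift _ _)).
  - by rewrite opsi (negbTE (neq_lift _ _)).
  - by rewrite npsi eqxx.
have [phi [hphi ophi]] := ext m.+1.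
have [x hx] := choice (fun j => hspan _ (hphi j)).
by have := orthonormal_size hb ophi hx; rewrite ltnn.
Qed.

End Subspaces.

Section FiniteSpan.
Variables (R : realType) (d r : nat).
Local Notation C := R[i].
Local Notation state := (state R d r).

Definition lspan (I : finType) (b : I -> state) (h : state) := exists x : I -> C, h = \sum_i x i *: b i.

Section Lspan.
Variables (I : finType) (b : I -> state).

Lemma lspanD c f g : lspan b f -> lspan b g -> lspan b (f + c *: g).
Proof.
move=> [x ->] [y ->]; exists (fun i => x i + c * y i); rewrite scaler_sumr -big_split.
by apply: eq_bigr => i _; rewrite scalerDl scalerA.
Qed.

Lemma lspan0 : lspan b 0.
Proof. by exists (fun=> 0); rewrite big1 // => i _; rewrite scale0r. Qed.

Lemma lspan_sum K (s : seq K) (P : pred K) (x : K -> C) (F : K -> state) :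
  (forall k, P k -> lspan b (F k)) -> lspan b (\sum_(k <- s | P k) x k *: F k).
Proof.
move=> h; elim/big_ind: _ => [|f g hf hg|k Pk]; first exact: lspan0.
  by rewrite -[g]scale1r; exact: lspanD.
by rewrite -[_ *: _]add0r; apply: lspanD; [exact: lspan0|exact: h].
Qed.

Lemma lspan_mem i : lspan b (b i).
Proof.
exists (fun j => (j == i)%:R); rewrite (bigD1 i) //= eqxx scale1r big1 ?addr0 // => j ji.
by rewrite (negbTE ji) scale0r.
Qed.

Lemma lspan_enum h : lspan b h -> exists x : 'I_#|I| -> C, h = \sum_k x k *: b (enum_val k).
Proof.
move=> [x ->]; exists (fun k => x (enum_val k)).
by rewrite (reindex _ (onW_bij _ (enum_val_bij I))).
Qed.
End Lspan.

Lemma gen_state0_sum (u : 'cV[C]_d) :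
  gen_state u 0 = \sum_i u i 0 *: gen_state (delta_mx i 0) 0 :> state.
Proof.
rewrite [RHS]surjective_pairing state_sum1; congr pair.
  by rewrite [LHS]matrix_sum_delta; apply: eq_bigr => i _; rewrite big_ord1.
apply/funext => k; rewrite -[RHS]/((\sum_i _ : state).2 k) state_sum2 big1 => [|i _]; first by case: k.
by rewrite stateZ2; case: k => [|k] /=; rewrite scaler0.
Qed.

Lemma delta_sum n (alpha : 'cV[C]_r) :
  delta d n alpha = \sum_c alpha c 0 *: delta d n (delta_mx c 0).
Proof.
rewrite [RHS]surjective_pairing state_sum1; congr pair; first by rewrite big1 // => c _; rewrite /= scaler0.
apply/funext => k; rewrite -[RHS]/((\sum_c _ : state).2 k) state_sum2.
under [RHS]eq_bigr do rewrite stateZ2.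
rewrite /=; case: eqP => kn; last by rewrite big1 // => c _; rewrite /= scaler0.
by rewrite [LHS]matrix_sum_delta; apply: eq_bigr => c _; rewrite big_ord1.
Qed.

End FiniteSpan.


Lemma normcN (R : realType) (x : R[i]) : Normc.normc (- x) = Normc.normc x.
Proof. by rewrite -sub0r normcB subr0. Qed.

Lemma normcB_sqr (R : realType) (u v : R[i]) :
  Normc.normc (u - v) ^+ 2 <= 2 * (Normc.normc u ^+ 2 + Normc.normc v ^+ 2).
Proof.
have := normcD u (- v); have := normc_ge0 (u - v); rewrite normcN.
move: (Normc.normc _) (Normc.normc u) (Normc.normc v) => x y z x0 xyz.
have : x ^+ 2 <= (y + z) ^+ 2 by rewrite lerXn2r ?nnegrE // (le_trans x0 xyz).
by have := sqr_ge0 (y - z); nra.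
Qed.

(** * The operator P and its finite rank *)

Section PointSpectrum.
Variables (R : realType) (q d r : nat).
Variables (HC : 'M[R[i]]_d) (V : 'M[R[i]]_(d, r)).
Hypothesis hHC : HC = HC^t*.
Hypothesis ha : 0 < ahop R q.
Hypothesis hd : (0 < d)%N.
Variable W : R -> {linear 'cV[R[i]]_r -> state R d r}.
Local Notation C := R[i].
Local Notation normc := (@Normc.normc R).
Local Notation state := (state R d r).
Local Notation J := (Jop q HC V).
Local Notation Q := (Qform q HC V W).

Let QDl := QformDl V hHC ha hd W.
Let QZl := QformZl V hHC ha hd W.
Let QC := QformC V hHC ha hd W.
Let QJ := QformJ V hHC ha hd W.
Let Q0 := Qform_ge0 V hHC ha hd W.

#[local] Opaque Qform Jop.

Lemma QformRe f : finsupp f -> Q f f = (complex.Re (Q f f))%:C.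
Proof. by move=> ff; rewrite (Qformff V hHC ha hd W ff). Qed.

Lemma Qform_CS f g : finsupp f -> finsupp g ->
  normc (Q f g) ^+ 2 <= complex.Re (Q f f) * complex.Re (Q g g).
Proof.
move=> ff fg.
have := @hermitian_form_CS R state (@finsupp R d r) Q.
move=> /(_ (fun c f g hf hg => @finsuppD _ _ _ _ _ hf (@finsuppZ _ _ _ c _ hg))) h.
have {h} : `|Q f g| ^+ 2 <= Q f f * Q g g.
  apply: h; [| | |exact: ff|exact: fg].
  - by move=> c k l m hk hl hm; rewrite (QDl hk (@finsuppZ _ _ _ c _ hl) hm) (QZl c hl hm).
  - by move=> k l hk hl; exact: QC.
  - by move=> k hk; exact: Q0.
move: (QformRe ff) (QformRe fg); move: (Q f g) (Q f f) (Q g g) => x y z -> ->.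
by rewrite normC_E -rmorphXn -rmorphM lecR.
Qed.

(* Turns out to be the orthogonal projection of [f] onto the pure point subspace ([Hpp_onb]). *)
Definition pp_part (f : state) : state :=
  xget 0 [set h | inH h /\ forall g, finsupp g -> ip h g = ip f g - Q f g].

Lemma pp_part_spec f : finsupp f -> inH (pp_part f) /\ forall g, finsupp g -> ip (pp_part f) g = ip f g - Q f g.
Proof.
move=> ff; rewrite /pp_part; case: xgetP => [h _ [? ?] //|] nh.
have [K K0 hK] := Qform_bounded V hHC ha hd W.
have hf := finsupp_inH ff.
(* The constant combines |u - v|^2 <= 2 (|u|^2 + |v|^2), Cauchy-Schwarz for both forms, and the
   bound K on Q. *)
have [|g h fg fcoef|c g fg|g fg|h hh hg] := @riesz R d r (fun g => ip f g - Q f g)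
   (2 * (sqnormH f + complex.Re (Q f f) * K)).
- rewrite mulr_ge0 // addr_ge0 ?(sqnormH_ge0 hf) // mulr_ge0 //.
  by rewrite -lecR -QformRe //; exact: Q0.
- have [fD [hg hh]] := (finsuppD fg fcoef, (finsupp_inH fg, finsupp_inH fcoef)).
  rewrite (ipDr hg hh hf) (QC fD ff) (QDl fg fcoef ff) conjcD.
  by rewrite -!QC // opprD addrACA.
- rewrite (ipZr c (finsupp_inH fg) hf) (QC (@finsuppZ _ _ _ c _ fg) ff).
  by rewrite QZl // conjcM -QC // mulrBr.
- have hg := finsupp_inH fg; have c1 := ip_CS hf hg; have c2 := Qform_CS ff fg.
  have c3 := hK g fg; have Qf0 : 0 <= complex.Re (Q f f).
    by rewrite -lecR -QformRe //; exact: Q0.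
  have c4 : complex.Re (Q f f) * complex.Re (Q g g) <= complex.Re (Q f f) * (K * sqnormH g).
    exact: ler_wpM2l.
  apply: (@le_trans _ _ (2 * (normc (ip f g) ^+ 2 + normc (Q f g) ^+ 2))).
    exact: normcB_sqr.
  rewrite -mulrA ler_wpM2l // mulrDl; apply: lerD => //.
  by apply: (le_trans c2); rewrite -mulrA.
- by case: (nh h).
Qed.

Lemma pp_part_inH f : finsupp f -> inH (pp_part f).
Proof. by move=> /pp_part_spec []. Qed.

Lemma pp_part_ip f g : finsupp f -> finsupp g -> ip (pp_part f) g = ip f g - Q f g.
Proof. by move=> /pp_part_spec [_]; exact. Qed.

Lemma pp_part_uniq f h : finsupp f -> inH h -> (forall g, finsupp g -> ip h g = ip f g - Q f g) -> pp_part f = h.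
Proof.
move=> ff hh e; apply/eqP; rewrite -subr_eq0; apply/eqP.
have hP := pp_part_inH ff; apply: ip_nondeg => [|g fg]; first exact: inHB.
by rewrite (ipBl hP hh (finsupp_inH fg)) pp_part_ip // e // subrr.
Qed.

#[local] Opaque pp_part.

Lemma pp_partD c f g : finsupp f -> finsupp g -> pp_part (f + c *: g) = pp_part f + c *: pp_part g.
Proof.
move=> ff fg; have fcg := @finsuppZ _ _ _ c _ fg; have hf := pp_part_inH ff; have hg := pp_part_inH fg.
have hcg := @inHZ _ _ _ c _ hg.
apply: pp_part_uniq; [exact: finsuppD|exact: inHD|move=> k fk].
have hk := finsupp_inH fk.
have e1 := etrans (ipDl hf hcg hk) (congr2 +%R (pp_part_ip ff fk)
  (etrans (ipZl c hg hk) (congr1 ( *%R c) (pp_part_ip fg fk)))).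
have e2 := etrans (ipDl (finsupp_inH ff) (finsupp_inH fcg) hk)
  (congr1 (fun x => ip f k + x) (ipZl c (finsupp_inH fg) hk)).
have e3 := etrans (QDl ff fcg fk) (congr1 (fun x => Q f k + x) (QZl c fg fk)).
apply: etrans e1 (etrans _ (esym (congr2 (fun x y => x - y) e2 e3))).
by move: (ip f k) (ip g k) (Q f k) (Q g k) => x y z w; ring.
Qed.

Lemma pp_part0 : pp_part 0 = 0.
Proof.
have f0 := @finsupp0 R d r.
by apply: pp_part_uniq => // [|g fg]; [exact: inH0|rewrite ip0l (_ : Q 0 g = 0) ?subr0 // -(scale0r 0) QZl // mul0r].
Qed.

Lemma pp_part_sum I (s : seq I) (x : I -> C) (F : I -> state) : (forall i, finsupp (F i)) ->
  pp_part (\sum_(i <- s) x i *: F i) = \sum_(i <- s) x i *: pp_part (F i).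
Proof.
move=> hF; elim: s => [|i s ih]; first by rewrite !big_nil pp_part0.
rewrite !big_cons addrC pp_partD ?ih 1?addrC //.
by apply: finsupp_sum => j; exact: finsuppZ.
Qed.

Lemma pp_partJ f : finsupp f -> J (pp_part f) = pp_part (J f).
Proof.
move=> ff; apply/esym; have fJ := Jop_finsupp q HC V ff; have hP := pp_part_inH ff.
apply: pp_part_uniq => // [|g fg]; first exact: (@Jop_inH _ q _ _ HC V _ hP).
have fJg := Jop_finsupp q HC V fg.
rewrite (ip_Jop_finr q V hHC _ fg) (pp_part_ip ff fJg) (ip_Jop_finr q V hHC _ fg).
by rewrite (QJ ff fg).
Qed.

Definition pp_range (h : state) := exists2 f, finsupp f & h = pp_part f.

Lemma pp_range_subspace : subspace pp_range.
Proof.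
split=> [_ [f ff ->]||c _ _ [f ff ->] [g fg ->]]; first exact: pp_part_inH.
  by exists 0; [exact: finsupp0|rewrite pp_part0].
exists (f + c *: g); last by rewrite pp_partD.
by apply: finsuppD => //; exact: finsuppZ.
Qed.

Lemma pp_range_J h : pp_range h -> pp_range (J h).
Proof. by move=> [f ff ->]; exists (J f); [exact: Jop_finsupp|exact: pp_partJ]. Qed.

(** Q and the inner product agree on [hankel_comb] against every site, so its image under P has no
    half-line component. *)
Lemma pp_part_hank (p : {poly C}) n alpha : (size p <= d.*2.+1)%N ->
  (forall z, z != 0 -> \det (Fmx q HC V z) = z ^- d * p.[z]) ->
  pp_part (hankel_comb d p n alpha) = gen_state (pp_part (hankel_comb d p n alpha)).1 0.
Proof.
move=> sp hp; have fcoef := hankel_comb_finsupp d p n alpha; set h := pp_part _.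
rewrite [LHS]surjective_pairing; congr pair; apply/funext => m.
have h0 : h.2 m = 0.
  apply: vsqnorm_eq0; apply: complexI; rewrite -dotcvv.
  have := pp_part_ip fcoef (delta_finsupp d m (h.2 m)).
  rewrite (Qform_hankel_comb hHC ha hd W sp hp) subrr -/h (@ip_finr _ _ _ _ _ m.+1); last first.
    by move=> k km; rewrite /= gtn_eqF.
  rewrite /psum /= dotc0r add0r big_nat_recr //= eqxx big_nat big1 ?add0r //.
  by move=> l /andP[_ lm]; rewrite (ltn_eqF lm) dotc0r.
by rewrite -[LHS]/(h.2 m) h0; case: m {h0}.
Qed.

(** [pp_part_hank] is a recurrence modulo C^d for the images of the sites. So the range lies in the
    span of C^d, the image of C^d, and the images of the first 2 d sites of each half-line. *)
Lemma pp_range_lspan : exists m (b : 'I_m -> state),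
  (forall i, inH (b i)) /\ forall f, pp_range f -> exists x : 'I_m -> C, f = \sum_i x i *: b i.
Proof.
have [p [p0 sp] hp] := detF_poly V hHC ha.
pose b (i : 'I_d + ('I_d + 'I_(d.*2) * 'I_r)) : state := match i with
  | inl i => gen_state (delta_mx i 0) 0
  | inr (inl i) => pp_part (gen_state (delta_mx i 0) 0)
  | inr (inr (n, c)) => pp_part (delta d n (delta_mx c 0)) end.
have hb i : inH (b i).
  case: i => [i|[i|[n c]]] /=.
  - exact: (finsupp_inH (gen_state_finsupp _ _)).
  - exact: (pp_part_inH (gen_state_finsupp _ _)).
  - exact: (pp_part_inH (delta_finsupp _ _ _)).
exists #|{: 'I_d + ('I_d + 'I_(d.*2) * 'I_r)}|, (fun k => b (enum_val k)).
split=> [k|h Ph]; first exact: hb.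
apply: lspan_enum; move: h Ph => _ [f ff ->].
have lg u : lspan b (gen_state u 0).
  by rewrite gen_state0_sum; apply: lspan_sum => i _; exact: (lspan_mem b (inl i)).
have lPg u : lspan b (pp_part (gen_state u 0)).
  rewrite gen_state0_sum pp_part_sum => [|i]; last exact: gen_state_finsupp.
  by apply: lspan_sum => i _; exact: (lspan_mem b (inr (inl i))).
(* The lowest nonzero coefficient of p belongs to the farthest site of the combination. With the
   shift j - 2 d + k0 below, this site is j, and the recurrence can be solved for its image. *)
have [k0 pk0 mink0] : exists2 k0, p`_k0 != 0 & forall k, (k < k0)%N -> p`_k = 0.
  have e : exists k, p`_k != 0 by exists (size p).-1; rewrite -/(lead_coef p) lead_coef_eq0.
  exists (ex_minn e); case: ex_minnP => k // hk min j jk; apply/eqP; apply: contraTT jk => /min.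
  by rewrite -leqNgt.
have k0p : (k0 < size p)%N by rewrite ltnNge; apply: contra pk0 => h; rewrite nth_default.
have lPd j alpha : lspan b (pp_part (delta d j alpha)).
  elim/ltn_ind: j alpha => j ih alpha; case: (ltnP j d.*2) => jd.
    rewrite delta_sum pp_part_sum => [|c]; last exact: delta_finsupp.
    by apply: lspan_sum => c _; exact: (lspan_mem b (inr (inr (Ordinal jd, c)))).
  have := pp_part_hank (j - d.*2 + k0) alpha sp hp; set u := (pp_part _).1.
  rewrite /hankel_comb pp_part_sum => [|k]; last exact: delta_finsupp.
  rewrite (bigD1 (Ordinal k0p)) //= => e.
  have -> : pp_part (delta d j alpha) = (p`_k0)^-1 *: (gen_state u 0 + (-1) *:
      \sum_(i < size p | i != Ordinal k0p) p`_i *: pp_part (delta d (j - d.*2 + k0 + d.*2 - i) alpha)).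
    rewrite -e scaleN1r addrK scalerA mulVf // scale1r.
    by have -> : (j - d.*2 + k0 + d.*2 - k0 = j)%N by lia.
  rewrite -[X in lspan _ X]add0r; apply: lspanD; first exact: lspan0.
  apply: lspanD => //.
  rewrite (eq_bigr (fun i : 'I_(size p) => p`_i *: (if (i < k0)%N then 0 else
      pp_part (delta d (j - d.*2 + k0 + d.*2 - i) alpha)))); last first.
    by move=> i _; case: ltnP => // ik0; rewrite mink0 // !scale0r.
  apply: lspan_sum => i ik; case: ltnP => ik0; first exact: lspan0.
  have kp := leq_trans k0p sp; have ip := leq_trans (ltn_ord i) sp.
  by apply: ih; have : (i != k0 :> nat) by []; lia.
have [N hN] := ff; rewrite (finsupp_decomp ha hN).
rewrite -[X in _ + X]scale1r pp_partD; [|exact: gen_state_finsupp|by apply: finsupp_sum => n; exact: delta_finsupp].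
apply: lspanD => //.
have -> : \sum_(n < N) delta d n (f.2 n) = \sum_(n < N) 1 *: delta d n (f.2 n).
  by apply: eq_bigr => n _; rewrite scale1r.
rewrite pp_part_sum => [|n]; last exact: delta_finsupp.
by apply: lspan_sum.
Qed.

End PointSpectrum.


Section EigenBasis.
Variables (R : realType) (q d r : nat).
Variables (HC : 'M[R[i]]_d) (V : 'M[R[i]]_(d, r)).
Hypothesis hHC : HC = HC^t*.
Local Notation C := R[i].
Local Notation state := (state R d r).
Local Notation J := (Jop q HC V).

(** In an orthonormal basis the restriction of J is a Hermitian matrix, hence unitarily
    diagonalisable. *)
Lemma eigenbasis M n (phi : 'I_n -> state) : subspace M -> is_onb M phi ->
  (forall h, M h -> M (J h)) ->
  exists psi : 'I_n -> state, (forall i, is_eigenvector q HC V (psi i)) /\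
    forall h, M h -> exists x : 'I_n -> C, h = \sum_i x i *: psi i.
Proof.
move=> [MH M0 MD] [Mphi ophi span] MJ.
have hphi j : inH (phi j) by exact: MH.
pose A := \matrix_(j, k) ip (J (phi j)) (phi k).
have AA : A^t* = A.
  apply/matrixP => j k; rewrite adjmxE !mxE.
  by rewrite (ip_Jop q V hHC (@hphi k) (@hphi j)) -(ipC (@hphi k) (Jop_inH (@hphi j))).
have /orthomx_spectralP AE : A \is normalmx by apply/normalmxP; rewrite AA.
set P := spectralmx A in AE; set sp := spectral_diag A in AE.
have uP : P \in unitmx by exact: spectral_unit.
(* Coordinates are row vectors: J maps phi_j to the combination with the j-th row of A. So the rows
   of P are the coordinates of eigenvectors. *)
have PA : P *m A = diag_mx sp *m P by rewrite [in LHS]AE !mulmxA mulmxV // mul1mx.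
pose psi i := \sum_j P i j *: phi j.
have hpsi i : inH (psi i) by apply: inH_sum => j; apply: inHZ.
exists psi; split=> [i|h Mh].
  split; first exact: hpsi.
    move=> psi0; have Pi k : P i k = 0.
      by rewrite -(@ip_comb _ _ _ _ _ (@hphi) ophi (P i) k) -/(psi i) psi0 ip0l.
    have := congr1 (fun B : 'M[C]_n => B i i) (mulmxV uP); rewrite !mxE eqxx big1 => [/eqP|k _].
      by rewrite eq_sym oner_eq0.
    by rewrite Pi mul0r.
  exists (sp 0 i); rewrite /psi Jop_sum scaler_sumr.
  transitivity (\sum_k (P *m A) i k *: phi k).
    under [RHS]eq_bigr do rewrite mxE scaler_suml.
    rewrite exchange_big; apply: eq_bigr => j _; rewrite JopZ {1}(span _ (MJ _ (Mphi j))) scaler_sumr.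
    by apply: eq_bigr => k _; rewrite scalerA !mxE.
  by apply: eq_bigr => k _; rewrite PA mul_diag_mx mxE scalerA.
exists (fun i => \sum_j ip h (phi j) * invmx P j i).
transitivity (\sum_j ip h (phi j) *: \sum_i invmx P j i *: psi i); last first.
  under [RHS]eq_bigr do rewrite scaler_suml.
  rewrite [RHS]exchange_big; apply: eq_bigr => j _; rewrite scaler_sumr.
  by apply: eq_bigr => i _; rewrite scalerA.
rewrite {1}(span _ Mh); apply: eq_bigr => j _; congr (_ *: _).
transitivity (\sum_k (invmx P *m P) j k *: phi k).
  rewrite mulVmx // (bigD1 j) //= mxE eqxx scale1r big1 ?addr0 // => k kj.
  by rewrite mxE eq_sym (negbTE kj) scale0r.
under eq_bigr do rewrite mxE scaler_suml.
rewrite exchange_big; apply: eq_bigr => i _; rewrite scaler_sumr.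
by apply: eq_bigr => k _; rewrite scalerA.
Qed.

End EigenBasis.

(** * Polynomial functional calculus *)

Section PolynomialsInJ.
Variables (R : realType) (q d r : nat).
Variables (HC : 'M[R[i]]_d) (V : 'M[R[i]]_(d, r)).
Hypothesis hHC : HC = HC^t*.
Local Notation C := R[i].
Local Notation J := (Jop q HC V).
Local Notation pJ := (polyJ q HC V).

Lemma polyJ_wide (p : {poly R}) n f : (size p <= n)%N ->
  pJ p f = \sum_(i < n) (p`_i)%:C *: iter i J f.
Proof.
move=> sp; rewrite /polyJ -(big_mkord xpredT (fun i => (p`_i)%:C *: iter i J f)).
rewrite -(big_mkord xpredT (fun i => (p`_i)%:C *: iter i J f)).
rewrite (@big_cat_nat _ _ _ (size p) 0 n) //= -[LHS]addr0; congr (_ + _); apply/esym.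
by rewrite big_nat big1 // => i /andP[pi _]; rewrite nth_default // scale0r.
Qed.

Lemma polyJD (p s : {poly R}) f : pJ (p + s) f = pJ p f + pJ s f.
Proof.
rewrite (polyJ_wide f (leq_maxl (size p) (size s))) (polyJ_wide f (leq_maxr (size p) (size s))).
rewrite (polyJ_wide f (size_polyD p s)) -big_split; apply: eq_bigr => i _ /=.
by rewrite coefD rmorphD scalerDl.
Qed.

Lemma polyJC (c : R) f : pJ c%:P f = c%:C *: f.
Proof. by rewrite (@polyJ_wide _ 1) ?size_polyC_leq1 // big_ord1 coefC. Qed.

Lemma polyJMX (p : {poly R}) f : pJ (p * 'X) f = J (pJ p f).
Proof.
rewrite (@polyJ_wide _ (size p).+1); last first.
  by apply: (leq_trans (size_polyMleq _ _)); rewrite size_polyX addn2.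
rewrite big_ord_recl coefMX /= scale0r add0r /polyJ Jop_sum; apply: eq_bigr => i _.
by rewrite coefMX JopZ.
Qed.

Lemma polyJ_inH (p : {poly R}) f : inH f -> inH (pJ p f).
Proof.
move=> hf; elim/poly_ind: p => [|p c ih].
  by rewrite -polyC0 polyJC; exact: inHZ.
rewrite polyJD polyJMX polyJC; apply: inHD; last exact: inHZ.
exact: Jop_inH.
Qed.

Lemma polyJ_finsupp (p : {poly R}) f : finsupp f -> finsupp (pJ p f).
Proof.
move=> hf; elim/poly_ind: p => [|p c ih].
  by rewrite -polyC0 polyJC; exact: finsuppZ.
rewrite polyJD polyJMX polyJC; apply: finsuppD; last exact: finsuppZ.
exact: Jop_finsupp.
Qed.

Lemma polyJ_J (p : {poly R}) f : pJ p (J f) = J (pJ p f).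
Proof.
elim/poly_ind: p => [|p c ih]; first by rewrite -polyC0 !polyJC JopZ.
by rewrite !polyJD !polyJMX !polyJC ih JopD JopZ.
Qed.

Lemma polyJ_comb (p : {poly R}) c f g : pJ p (f + c *: g) = pJ p f + c *: pJ p g.
Proof.
elim/poly_ind: p => [|p b ih].
  by rewrite -polyC0 !polyJC scalerDr !scalerA mulrC.
by rewrite !polyJD !polyJMX !polyJC ih JopD JopZ !scalerDr !scalerA [c * _]mulrC addrACA.
Qed.

Lemma polyJM (p s : {poly R}) f : pJ (p * s) f = pJ p (pJ s f).
Proof.
elim/poly_ind: p => [|p c ih].
  by rewrite mul0r -polyC0 !polyJC !scale0r.
rewrite mulrDl polyJD -mulrA [_ * s]mulrC mulrA polyJMX ih polyJD polyJMX polyJC.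
congr (_ + _); elim/poly_ind: s {ih} => [|s b ih].
  by rewrite mulr0 -polyC0 !polyJC !scale0r scaler0.
rewrite mulrDr polyJD mulrA polyJMX ih polyJD polyJMX polyJC -polyCM polyJC.
by rewrite JopZ scalerDr scalerA rmorphM.
Qed.

Lemma ip_polyJ (p : {poly R}) f g : inH f -> inH g -> ip (pJ p f) g = ip f (pJ p g).
Proof.
elim/poly_ind: p f g => [|p c ih] f g hf hg.
  by rewrite -polyC0 !polyJC (ipZl _ hf hg) (ipZr _ hg hf) conjc_real.
rewrite !polyJD !polyJMX !polyJC.
have [hpf hpg] := (@polyJ_inH p _ hf, @polyJ_inH p _ hg).
have [hJf hJg] := (@Jop_inH _ q _ _ HC V _ hpf, @Jop_inH _ q _ _ HC V _ hpg).
have hJ := @Jop_inH _ q _ _ HC V _ hg.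
have [cf cg] := (@inHZ _ _ _ c%:C _ hf, @inHZ _ _ _ c%:C _ hg).
apply: (etrans (ipDl hJf cf hg)); apply/esym; apply: (etrans (ipDr hJg cg hf)).
have e1 : ip f (J (pJ p g)) = ip (J (pJ p f)) g.
  have e0 : ip f (J (pJ p g)) = ip f (pJ p (J g)) by rewrite polyJ_J.
  exact: (etrans e0 (etrans (esym (ih f (J g) hf hJ)) (esym (ip_Jop q V hHC hpf hg)))).
have e2 : ip f (c%:C *: g) = ip (c%:C *: f) g.
  apply: (etrans (ipZr _ hg hf) (etrans _ (esym (ipZl _ hf hg)))).
  by congr (_ * _); exact: conjc_real.
exact: (congr2 +%R e1 e2).
Qed.

Lemma polyJ_eigen (p : {poly R}) f (l : R) : J f = l%:C *: f -> pJ p f = (p.[l])%:C *: f.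
Proof.
move=> e; elim/poly_ind: p => [|p c ih]; first by rewrite -polyC0 polyJC hornerC.
rewrite polyJD polyJMX polyJC ih JopZ e scalerA -scalerDl -rmorphM -rmorphD.
by rewrite hornerMXaddC.
Qed.

End PolynomialsInJ.

(** * Peaking polynomials *)

Section Bump.
Variable R : realType.
Local Notation A := (@angles R).

(* A power of a parabola peaking at l: as n grows it tends to the indicator of {l}. *)
Definition peak (l c : R) (n : nat) : {poly R} := (1 - (c ^- 2) *: ('X - l%:P) ^+ 2) ^+ n.

Lemma peakE l c n x : (peak l c n).[x] = (1 - ((x - l) / c) ^+ 2) ^+ n.
Proof.
rewrite /peak horner_exp; congr (_ ^+ n).
by rewrite !hornerE exprMn exprVn [in RHS]mulrC [(x - l) ^+ 2]expr2 mulrA.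
Qed.

Lemma peak_at l c n : (peak l c n).[l] = 1.
Proof. by rewrite peakE subrr mul0r expr0n subr0 expr1n. Qed.

Lemma peak_base (l c x : R) : 0 < c -> `|x - l| <= c -> 0 <= ((x - l) / c) ^+ 2 <= 1.
Proof.
move=> c0 h; rewrite sqr_ge0 /= -real_normK ?num_real // exprn_ile1 //.
by rewrite normrM normfV (gtr0_norm c0) ler_pdivrMr // mul1r.
Qed.

Lemma peak_le1 (l c : R) n (x : R) : 0 < c -> `|x - l| <= c -> `|(peak l c n).[x]| <= 1.
Proof.
move=> c0 /(peak_base c0) /andP[h0 h1]; rewrite peakE normrX exprn_ile1 //.
by rewrite ler_norml; move: h0 h1; set y := _ ^+ 2; lra.
Qed.

Lemma peak_cvg0 (l c x : R) : 0 < c -> `|x - l| <= c -> x != l -> (peak l c n).[x] @[n --> \oo] --> (0 : R).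
Proof.
move=> c0 h xl; have /andP[h0 h1] := peak_base c0 h.
under eq_fun do rewrite peakE; apply: cvg_expr.
have : 0 < ((x - l) / c) ^+ 2 by rewrite exprn_even_gt0 // mulf_neq0 ?subr_eq0 // invr_eq0 gt_eqF.
by rewrite ltr_norml; move: h0 h1; set y := _ ^+ 2; lra.
Qed.

Lemma Rint_cvg0 (l : R) (x : R -> R) (s : nat -> R -> R) (w : R -> R) : rnice w ->
  (forall n, rnice (s n)) -> (forall n t, A t -> `|s n t| <= 1) ->
  finite_set [set t | A t /\ x t = l] ->
  (forall t, A t -> x t != l -> s n t @[n --> \oo] --> (0 : R)) ->
  Rintegral lebesgue_measure A (fun t => s n t * w t) @[n --> \oo] --> (0 : R).
Proof.
move=> hw hs s1 fE s0; have [mw [K hK]] := hw.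
have mA := @measurable_angles R.
have [] := @dominated_convergence _ _ R lebesgue_measure A mA
   (fun n t => (s n t * w t)%:E) (fun=> 0%E) (fun=> (`|K|)%:E).
- move=> n; apply/measurable_EFinP; exact: (rniceM (hs n) hw).1.
- exact: measurable_cst.
- have nE : lebesgue_measure.-negligible [set t | A t /\ x t = l].
    have cE := finite_set_countable fE.
    exists [set t | A t /\ x t = l]; split=> //; first exact: countable_measurable.
    exact: countable_lebesgue_measure0.
  apply: negligibleS nE => t /= h; apply: contrapT => h2; apply: h => At.
  have xl : x t != l by apply/eqP => e; apply: h2.
  have := s0 t At xl => c; apply/fine_cvgP; split; first exact: nearW.
  by have := cvgM c (cvg_cst (w t)); rewrite mul0r; exact.
- exact: (rnice_integrable (rnice_cst `|K|)).
- apply: aeW => t n At; rewrite lee_fin normrM -[X in _ <= X]mul1r.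
  by rewrite ler_pM // ?s1 // (le_trans (hK t At)) // ler_norm.
move=> _ _; rewrite integral0 => h.
have := fine_cvg h => /=; exact.
Qed.

End Bump.


Lemma sqnormH0 (R : realType) (d r : nat) : sqnormH (0 : state R d r) = 0.
Proof. by apply: complexI; rewrite -ipff ?ip0l //; exact: inH0. Qed.

(** Converse of Cauchy-Schwarz, tested on the truncations of h. *)
Lemma sqnormH_bound (R : realType) (d r : nat) (h : state R d r) (K : R) : 0 <= K -> inH h ->
  (forall g, finsupp g -> Normc.normc (ip h g) ^+ 2 <= K * sqnormH g) -> sqnormH h <= K.
Proof.
move=> K0 hh hK; have ht N := finsupp_inH (trunc_finsupp N h).
pose s N := vsqnorm h.1 + \sum_(0 <= n < N) vsqnorm (h.2 n).
have e1 N : ip h (trunc N h) = (s N)%:C.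
  rewrite (@ip_finr _ _ _ _ _ N); last by move=> n nN; rewrite /= ltnNge nN.
  rewrite /psum /s dotcvv rmorphD; congr (_ + _).
  by rewrite rmorph_sum; apply: eq_big_nat => n /andP[_ nN]; rewrite /= nN dotcvv.
have e2 N : sqnormH (trunc N h) = s N.
  apply: complexI; rewrite -ipff //.
  rewrite (@ip_finr _ _ _ _ _ N); last by move=> n nN; rewrite /= ltnNge nN.
  rewrite /psum /s dotcvv rmorphD; congr (_ + _).
  by rewrite rmorph_sum; apply: eq_big_nat => n /andP[_ nN]; rewrite /= nN dotcvv.
have s0 N : 0 <= s N by rewrite -e2 sqnormH_ge0.
suff : forall N, s N <= K by move=> hs; exact: (proj2 (inH_bound hs)).
move=> N; have := hK _ (trunc_finsupp N h); rewrite e1 e2 normc_real ger0_norm // expr2.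
have [-> //|sn] := eqVneq (s N) 0.
by rewrite ler_pM2r // lt_neqAle eq_sym sn s0.
Qed.

Lemma proj_symm (R : realType) (d r : nat) n (phi : 'I_n -> state R d r) f g :
  (forall j, inH (phi j)) -> inH f -> inH g -> ip (proj phi f) g = ip f (proj phi g).
Proof.
move=> hphi hf hg; apply: (etrans (ip_proj hphi f hg)); apply/esym.
have hz j : inH (ip g (phi j) *: phi j) by apply: inHZ.
apply: (etrans (ip_sumr _ hz hf)); apply: eq_bigr => j _.
apply: (etrans (ipZr _ (hphi j) hf)).
exact: (etrans (mulrC _ _) (congr1 ( *%R _) (esym (ipC hg (hphi j))))).
Qed.

(** * Orthogonality to eigenvectors and the basis of the pure point subspace *)

Section Eigenvectors.
Variables (R : realType) (q d r : nat).
Variables (HC : 'M[R[i]]_d) (V : 'M[R[i]]_(d, r)).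
Hypothesis hHC : HC = HC^t*.
Hypothesis ha : 0 < ahop R q.
Hypothesis hd : (0 < d)%N.
Variable W : R -> {linear 'cV[R[i]]_r -> state R d r}.
Local Notation C := R[i].
Local Notation normc := (@Normc.normc R).
Local Notation state := (state R d r).
Local Notation J := (Jop q HC V).
Local Notation pJ := (polyJ q HC V).
Local Notation a := (ahop R q).
Local Notation A := (@angles R).
Local Notation Theta := (ThetaF q HC V).
Local Notation regular := (regular q HC V).
Local Notation fcoef := (fcoef q HC V).
Local Notation Q := (Qform q HC V W).
Local Notation pp_part := (pp_part q HC V W).
Local Notation pp_range := (pp_range q HC V W).

Lemma fcoef_polyJ p f t : finsupp f -> regular t -> fcoef (pJ p f) t = (p.[2 * a * cos t])%:C *: fcoef f t.
Proof.
move=> ff rt; elim/poly_ind: p => [|p c ih].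
  by rewrite -polyC0 polyJC fcoefZ // hornerC.
have fp := polyJ_finsupp q HC V p ff.
rewrite polyJD polyJMX polyJC fcoefD; [|exact: Jop_finsupp|exact: finsuppZ].
rewrite fcoefZ // (fcoefJ hHC ha fp rt) ih scalerA -scalerDl -rmorphM -rmorphD.
by rewrite hornerMXaddC mulrC.
Qed.

Lemma rnice_horner (p : {poly R}) (h : R -> R) : rnice h -> rnice (fun t => p.[h t]).
Proof.
move=> hh; elim/poly_ind: p => [|p c ih].
  by under eq_fun do rewrite horner0; exact: rnice_cst.
under eq_fun do rewrite hornerMXaddC.
by apply: rniceD; [exact: rniceM|exact: rnice_cst].
Qed.

Lemma rnice_x : rnice (fun t => 2 * a * cos t).
Proof. by apply: rniceM; [exact: rnice_cst|exact: rnice_cos]. Qed.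

Lemma Qform_polyJ p s f : finsupp f -> Q (pJ p f) (pJ s f) =
  ((2 * pi)^-1 * Rintegral lebesgue_measure A
     (fun t => p.[2 * a * cos t] * s.[2 * a * cos t] * vsqnorm (fcoef f t)))%:C.
Proof.
move=> ff; have fp := polyJ_finsupp q HC V p ff; have fs := polyJ_finsupp q HC V s ff.
have -> : Q (pJ p f) (pJ s f) = ((2 * pi)^-1)%:C *
    Cintegral (fun t => dotc (fcoef (pJ p f) t) (fcoef (pJ s f) t)) by apply: QformE.
transitivity (((2 * pi)^-1)%:C * (Rintegral lebesgue_measure A
     (fun t => p.[2 * a * cos t] * s.[2 * a * cos t] * vsqnorm (fcoef f t)))%:C); last by rewrite -rmorphM.
rewrite -Cint_real.
have -> // : Cintegral (fun t => dotc (fcoef (pJ p f) t) (fcoef (pJ s f) t)) =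
   Cintegral (fun t => (p.[2 * a * cos t] * s.[2 * a * cos t] * vsqnorm (fcoef f t))%:C).
have fT : finite_set Theta by apply: Theta_finite.
have nd : nice (fun t => dotc (fcoef (pJ p f) t) (fcoef (pJ s f) t)) by apply: nice_dotc_fcoef.
apply: (Cint_fix fT _ nd) => t At Tt; have rt := Theta_regular At Tt.
rewrite (fcoef_polyJ p ff rt) (fcoef_polyJ s ff rt) dotcZl dotcZr conjc_real dotcvv.
by rewrite -!rmorphM mulrA.
Qed.

Lemma QformDr f g h : finsupp f -> finsupp g -> finsupp h -> Q h (f + g) = Q h f + Q h g.
Proof.
move=> ff fg fhh; have fD := finsuppD ff fg.
have e1 := QformC V hHC ha hd W fD fhh; have e2 := QformDl V hHC ha hd W ff fg fhh.
have e3 := QformC V hHC ha hd W ff fhh; have e4 := QformC V hHC ha hd W fg fhh.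
apply: (etrans e1); apply: (etrans (congr1 (fun z : C => z^*%C) e2)).
by apply: (etrans (conjcD _ _)); exact: (congr2 +%R (esym e3) (esym e4)).
Qed.

Lemma QformZr c f h : finsupp f -> finsupp h -> Q h (c *: f) = c^*%C * Q h f.
Proof.
move=> ff fhh; have fZ := @finsuppZ _ _ _ c _ ff.
have e1 := QformC V hHC ha hd W fZ fhh; have e2 := QformZl V hHC ha hd W c ff fhh.
have e3 := QformC V hHC ha hd W ff fhh.
apply: (etrans e1); apply: (etrans (congr1 (fun z : C => z^*%C) e2)).
by apply: (etrans (conjcM _ _)); exact: (congr1 ( *%R _) (esym e3)).
Qed.

Lemma Qform_pJ p f g : finsupp f -> finsupp g -> Q (pJ p f) g = Q f (pJ p g).
Proof.
elim/poly_ind: p f g => [|p c ih] f g ff fg.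
  by rewrite -polyC0 !polyJC QformZl // QformZr // conjc_real.
rewrite !polyJD !polyJMX !polyJC.
have [fpf fpg] := (polyJ_finsupp q HC V p ff, polyJ_finsupp q HC V p fg).
have [fJf fJg] := (Jop_finsupp q HC V fpf, Jop_finsupp q HC V fpg).
have [cf cg] := (@finsuppZ _ _ _ c%:C _ ff, @finsuppZ _ _ _ c%:C _ fg).
have fJ := Jop_finsupp q HC V fg.
apply: (etrans (QformDl V hHC ha hd W fJf cf fg)); apply/esym; apply: (etrans (QformDr fJg cg ff)).
have e0 : Q f (J (pJ p g)) = Q f (pJ p (J g)) by rewrite polyJ_J.
have e1 := etrans e0 (etrans (esym (ih f (J g) ff fJ)) (esym (QformJ V hHC ha hd W fpf fg))).
have e2 : Q f (c%:C *: g) = Q (c%:C *: f) g.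
  apply: (etrans (QformZr _ fg ff) (etrans _ (esym (QformZl V hHC ha hd W _ ff fg)))).
  by congr (_ * _); exact: conjc_real.
exact: (congr2 +%R e1 e2).
Qed.

Lemma eigenvalueR psi : is_eigenvector q HC V psi -> exists l : R, J psi = l%:C *: psi.
Proof.
move=> [hpsi psi0 [z Jz]]; exists (complex.Re z); rewrite Jz; congr (_ *: _).
have := eigenvalue_real hHC hpsi Jz psi0; case: z {Jz} => x y /= -> //.
Qed.

Lemma cos_level l : finite_set [set t | A t /\ 2 * a * cos t = l].
Proof.
have [[t0 [At0 e0]]|h] := pselect (exists t, A t /\ 2 * a * cos t = l); last first.
  by rewrite (_ : [set _ | _] = set0) //; apply/seteqP; split=> t // ht; apply: h; exists t.
apply: (sub_finite_set _ (finite_set1 t0)) => t [At e] /=.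
move: At At0; rewrite /angles /= !in_itv /= => /andP[s0 s1] /andP[u0 u1].
apply: (@cos_inj R); rewrite ?in_itv /= ?ltW //.
have a0 : 2 * a != 0 by rewrite mulf_neq0 // gt_eqF.
by apply: (mulfI a0); rewrite e e0.
Qed.

(** If p(l) = 1 then <h, psi> = <p(J) h, psi>. Since p(J) h represents Q(p(J) f, .), its squared
    norm is at most K Q(p(J) f, p(J) f), and along the peaking polynomials this integral tends to
    0. *)
Lemma orth_eigen h f psi : inH h -> finsupp f -> (forall g, finsupp g -> ip h g = Q f g) ->
  is_eigenvector q HC V psi -> ip h psi = 0.
Proof.
move=> hh ff hQ epsi; have [l Jl] := eigenvalueR epsi; have [hpsi _ _] := epsi.
have [K K0 hK] := Qform_bounded V hHC ha hd W.
(* The width of the peak must exceed the distance from l to every value 2 a cos t. *)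
pose c := 2 * a + `|l| + 1.
have c0 : 0 < c by rewrite /c; move: ha (normr_ge0 l); move: (ahop R q) (`|l|) => u v; lra.
have xc t : `|2 * a * cos t - l| <= c.
  apply: (le_trans (ler_normB _ _)); rewrite /c -addrA lerD //; last by rewrite lerDl.
  rewrite normrM gtr0_norm ?mulr_gt0 // ler_piMr ?mulr_ge0 ?(ltW ha) //.
  by rewrite ler_norml cos_geN1 cos_le1.
pose I n := Rintegral lebesgue_measure A (fun t =>
  (peak l c n).[2 * a * cos t] * (peak l c n).[2 * a * cos t] * vsqnorm (fcoef f t)).
have hI : I n @[n --> \oo] --> (0 : R).
  apply: (@Rint_cvg0 _ l (fun t => 2 * a * cos t)
    (fun n t => (peak l c n).[2 * a * cos t] * (peak l c n).[2 * a * cos t])).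
  - exact: rnice_vsq_fcoef.
  - by move=> n; apply: rniceM; apply: rnice_horner; exact: rnice_x.
  - by move=> n t _; rewrite normrM mulr_ile1 // peak_le1.
  - exact: cos_level.
  - move=> t _ xl; have b0 := peak_cvg0 c0 (xc t) xl.
    by have := cvgM b0 b0; rewrite mulr0; exact.
have bnd n : normc (ip h psi) ^+ 2 <= (K * (2 * pi)^-1 * sqnormH psi) * I n.
  have hp := @polyJ_inH _ q _ _ HC V (peak l c n) _ hh.
  have fp := polyJ_finsupp q HC V (peak l c n) ff.
  have e : ip h psi = ip (pJ (peak l c n) h) psi.
    rewrite (ip_polyJ q V hHC _ hh hpsi) (polyJ_eigen _ Jl) peak_at.
    by rewrite scale1r.
  rewrite e; apply: (le_trans (ip_CS hp hpsi)).
  rewrite mulrAC ler_wpM2r ?sqnormH_ge0 //.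
  have QE := Qform_polyJ (peak l c n) (peak l c n) ff.
  have QR : complex.Re (Q (pJ (peak l c n) f) (pJ (peak l c n) f)) = (2 * pi)^-1 * I n.
    by rewrite QE.
  rewrite -mulrA -QR.
  apply: sqnormH_bound => // [|g fg].
    by rewrite mulr_ge0 // -lecR -QformRe // Qform_ge0.
  have fpg := polyJ_finsupp q HC V (peak l c n) fg.
  have -> : ip (pJ (peak l c n) h) g = Q (pJ (peak l c n) f) g.
    rewrite (ip_polyJ q V hHC _ hh (finsupp_inH fg)) (hQ _ fpg).
    by rewrite Qform_pJ.
  apply: (le_trans (Qform_CS V hHC ha hd W fp fg)).
  rewrite [K * _]mulrC -mulrA; apply: ler_wpM2l; last exact: hK.
  by rewrite -lecR -QformRe // Qform_ge0.
have z0 : normc (ip h psi) ^+ 2 <= 0.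
  have cv : (K * (2 * pi)^-1 * sqnormH psi) * I n @[n --> \oo] --> (0 : R).
    by have := cvgM (cvg_cst (K * (2 * pi)^-1 * sqnormH psi)) hI; rewrite mulr0; exact.
  rewrite -(cvg_lim (@norm_hausdorff _ _) cv); apply: limr_ge; last exact: nearW.
  by apply/cvg_ex; exists 0.
have : normc (ip h psi) ^+ 2 == 0 by rewrite eq_le z0 sqr_ge0.
by rewrite sqrf_eq0 => /eqP; exact: Normc.eq0_normc.
Qed.

Lemma pp_part_orth_eigen f psi : finsupp f -> is_eigenvector q HC V psi -> ip (f - pp_part f) psi = 0.
Proof.
move=> ff epsi; have hP := @pp_part_inH R q d r HC V hHC ha hd W _ ff; have hf := finsupp_inH ff.
apply: (orth_eigen _ ff _ epsi) => [|g fg]; first exact: inHB.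
have e := etrans (ipBl hf hP (finsupp_inH fg)) (congr1 (fun z => ip f g - z) (@pp_part_ip R q d r HC V hHC ha hd W _ _ ff fg)).
by apply: (etrans e); rewrite subKr.
Qed.

Lemma pp_range_inH h : pp_range h -> inH h.
Proof. by have [h0 _ _] := pp_range_subspace V hHC ha hd W; exact: h0. Qed.

Lemma pp_part_orth f w : finsupp f -> pp_range w -> ip (f - pp_part f) w = 0.
Proof.
move=> ff Pw; have Psub := pp_range_subspace V hHC ha hd W.
have [m [b [hb hspan]]] := pp_range_lspan V hHC ha hd W.
have [n [phi ophi]] := onb_exists Psub hb hspan.
have [psi [epsi spsi]] := eigenbasis hHC Psub ophi (@pp_range_J R q d r HC V hHC ha hd W).
have [x ->] := spsi _ Pw.
have hP := @pp_part_inH R q d r HC V hHC ha hd W _ ff; have hf := finsupp_inH ff.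
have hpsi i : inH (psi i) by case: (epsi i).
rewrite ip_sumr => [|i|]; [|by apply: inHZ|exact: inHB].
rewrite big1 // => i _; apply: (etrans (ipZr _ (@hpsi i) (inHB hf hP))).
by rewrite pp_part_orth_eigen // mulr0.
Qed.

Lemma ip_eq0_sym (f g : state) : inH f -> inH g -> ip f g = 0 -> ip g f = 0.
Proof. by move=> hf hg e; rewrite (ipC hf hg) e conjc0. Qed.

(** Orthogonality of f - P f to the range identifies P with the projection onto it. An eigenvector
    is also orthogonal to every f - P f, so the projection fixes it: the range already contains all
    eigenvectors. *)
Lemma Hpp_onb : exists n (phi : 'I_n -> state), [/\ is_onb (Hpp q HC V) phi,
  forall f, Hpp q HC V (proj phi f) & forall f, finsupp f -> pp_part f = proj phi f].
Proof.
have Psub := pp_range_subspace V hHC ha hd W.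
have [m [b [hb hspan]]] := pp_range_lspan V hHC ha hd W.
have [n [phi ophi]] := onb_exists Psub hb hspan.
have [psi [epsi spsi]] := eigenbasis hHC Psub ophi (@pp_range_J R q d r HC V hHC ha hd W).
have [Mphi dphi sphi] := ophi.
have hphi j : inH (phi j) by exact: pp_range_inH.
have PE f : finsupp f -> pp_part f = proj phi f.
  move=> ff; have Pf : pp_range (pp_part f) by exists f.
  have hP := @pp_part_inH R q d r HC V hHC ha hd W _ ff; have hf := finsupp_inH ff.
  apply: (etrans (sphi _ Pf)); apply: eq_bigr => j _; congr (_ *: _).
  have := pp_part_orth ff (Mphi j); rewrite (ipBl hf hP (@hphi j)) => /eqP.
  by rewrite subr_eq0 => /eqP ->.
have eig k : is_eigenvector q HC V k -> k = proj phi k.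
  move=> ek; have [hk _ _] := ek; have hpk : inH (proj phi k) by exact: proj_inH.
  apply/eqP; rewrite -subr_eq0; apply/eqP; apply: ip_nondeg => [|g fg]; first exact: inHB.
  have hg := finsupp_inH fg; have hpg : inH (proj phi g) by exact: proj_inH.
  apply: (etrans (ipBl hk hpk hg)); apply/eqP; rewrite subr_eq0; apply/eqP.
  have e1 : ip g k = ip (proj phi g) k.
    have := pp_part_orth_eigen fg ek; rewrite PE // (ipBl hg hpg hk) => /eqP.
    by rewrite subr_eq0 => /eqP.
  exact: (etrans (ipC hg hk) (etrans (congr1 (fun z : C => z^*%C) e1)
    (etrans (esym (ipC hpg hk)) (esym (proj_symm (@hphi) hk hg))))).
have PH h : pp_range h -> Hpp q HC V h.
  move=> Ph; split; first exact: pp_range_inH.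
  move=> e e0; have [x xE] := spsi _ Ph; exists n, x, psi; split=> //.
  by rewrite {1}xE subrr sqnormH0.
exists n, phi; split=> // [|f]; last by apply: PH; exact: subspace_sum.
split=> [j||f [hf fE]] //; first exact: PH.
have hpf : inH (proj phi f) by exact: proj_inH.
apply/eqP; rewrite -subr_eq0; apply/eqP; apply: sqnormH_eq0; first exact: inHB.
apply/eqP; rewrite eq_le sqnormH_ge0 ?andbT; last exact: inHB.
(* Approximating combinations of eigenvectors are combinations of phi, and the projection of f is at
   least as close to f as any of these. *)
apply/ler_addgt0Pr => e e0; rewrite add0r.
have [k [c [psi' [epsi' lte]]]] := fE e e0.
apply: le_trans (ltW lte).
have -> : \sum_i c i *: psi' i = \sum_j (\sum_i c i * ip (psi' i) (phi j)) *: phi j.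
  under [RHS]eq_bigr do rewrite scaler_suml.
  rewrite exchange_big; apply: eq_bigr => i _; rewrite {1}(eig _ (epsi' i)) scaler_sumr.
  by apply: eq_bigr => j _; rewrite scalerA.
exact: proj_min.
Qed.

(** Transfers the constructed basis to an arbitrary one, as the expansion is claimed for every
    orthonormal basis. *)
Lemma onb_proj_eq M n1 (phi1 : 'I_n1 -> state) n2 (phi2 : 'I_n2 -> state) f :
  (forall h, M h -> inH h) -> is_onb M phi1 -> is_onb M phi2 -> inH f -> M (proj phi1 f) ->
  proj phi1 f = proj phi2 f.
Proof.
move=> MH [M1 o1 s1] [M2 o2 s2] hf Mp; apply: (etrans (s2 _ Mp)).
have [h1 h2] : (forall j, inH (phi1 j)) /\ (forall j, inH (phi2 j)) by split=> j; exact: MH.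
have hp := MH _ Mp; apply: eq_bigr => j _; congr (_ *: _).
have := proj_orth_comb (@h1) o1 (fun k => ip (phi2 j) (phi1 k)) hf.
rewrite -(s1 _ (M2 j)) (ipBl hf hp (@h2 j)) => /eqP.
by rewrite subr_eq0 => /eqP ->.
Qed.

Section ArbitraryBasis.
Variables (n : nat) (phi : 'I_n -> state).
Hypothesis ophi : is_onb (Hpp q HC V) phi.

Lemma onb_inH j : inH (phi j).
Proof. by case: ophi => h _ _; case: (h j). Qed.

Lemma onb_orth j k : ip (phi j) (phi k) = (j == k)%:R.
Proof. by case: ophi. Qed.

Lemma pp_part_proj f : finsupp f -> pp_part f = proj phi f.
Proof.
move=> ff; have [n1 [phi1 [b1 m1 e1]]] := Hpp_onb; rewrite e1 //.
by apply: (onb_proj_eq _ b1 ophi (finsupp_inH ff) (m1 f)) => h [].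
Qed.

Lemma Qform_proj f g : finsupp f -> finsupp g -> Q f g = ip f g - ip (proj phi f) g.
Proof.
move=> ff fg; rewrite -(pp_part_proj ff) (@pp_part_ip R q d r HC V hHC ha hd W _ _ ff fg).
by rewrite subKr.
Qed.

End ArbitraryBasis.

End Eigenvectors.

(** * Absolutely continuous vectors *)

Section DensityMeasure.
Variable R : realType.
Local Notation mu := (@lebesgue_measure R).
Local Notation RT := (measurableTypeR R).
Local Open Scope ereal_scope.

Section Density.
Variables (w : RT -> R).
Hypothesis mw : measurable_fun setT w.
Hypothesis w0 : forall t, (0 <= w t)%R.
Hypothesis iw : mu.-integrable setT (EFin \o w).

(** The proofs are arguments of the function so that the measure structure, which depends on them,
    can be attached to this name. *)
Definition density_measure of measurable_fun setT w & (forall t, (0 <= w t)%R)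
  & mu.-integrable setT (EFin \o w) := fun B : set RT => \int[mu]_(t in B) (w t)%:E.

Local Notation nu := (density_measure mw w0 iw).

Let nu0 : nu set0 = 0. Proof. by rewrite /density_measure integral_set0. Qed.

Let nu_ge0 B : 0 <= nu B.
Proof. by apply: integral_ge0 => t _; rewrite lee_fin. Qed.

Let nu_sigma : semi_sigma_additive nu.
Proof.
apply: semi_sigma_additive_nng_induced; first exact/measurable_EFinP.
by move=> t; rewrite lee_fin.
Qed.

HB.instance Definition _ := isMeasure.Build _ _ _ nu nu0 nu_ge0 nu_sigma.

Let nu_fin : fin_num_fun nu.
Proof.
by move=> B mB; apply: integrable_fin_num => //; exact: (integrableS measurableT).
Qed.

HB.instance Definition _ := @Measure_isFinite.Build _ _ _ nu nu_fin.

Lemma density_dominates : nu `<< mu.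
Proof.
apply/null_content_dominatesP => B mB muB0; rewrite /density_measure.
by apply: null_set_integral => //; apply: measurable_funTS; exact/measurable_EFinP.
Qed.

(** Uniqueness of densities; it turns the change of variables for the Radon-Nikodym derivative into
    one for w. *)
Lemma density_RN : ae_eq mu setT (Radon_Nikodym (charge_of_finite_measure nu) mu) (EFin \o w).
Proof.
have dom := density_dominates.
apply: integral_ae_eq => //.
- exact: Radon_Nikodym_integrable.
- exact/measurable_EFinP.
- by move=> B _ mB; rewrite -Radon_Nikodym_integral.
Qed.

Lemma integral_density (f : RT -> R) : measurable_fun setT f ->
  (exists K : R, forall t, (`|f t| <= K)%R) ->
  \int[nu]_t (f t)%:E = \int[mu]_t (f t * w t)%:E.
Proof.
move=> mf [K hK]; have dom := density_dominates.
have intf : nu.-integrable setT (EFin \o f).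
  apply: measurable_bounded_integrable => //.
    by rewrite -ge0_fin_numE //; exact: nu_fin.
  exists K; split; first exact: num_real.
  by move=> L KL t /= _; apply: le_trans (hK t) (ltW KL).
rewrite -(Radon_Nikodym_change_of_variables dom measurableT intf).
apply: ae_eq_integral => //.
- apply: emeasurable_funM; first exact/measurable_EFinP.
  by apply: measurable_int; exact: Radon_Nikodym_integrable.
- by apply/measurable_EFinP; exact: measurable_funM.
- by apply: filterS density_RN => t /= h _; rewrite h.
Qed.

End Density.

Section FiniteMeasure.
Variables (m : {measure set RT -> \bar R}) (fin : fin_num_fun m).

Definition as_finite_measure of fin_num_fun m : set RT -> \bar R := m.

HB.instance Definition _ := Measure.copy (as_finite_measure fin) m.
HB.instance Definition _ := @Measure_isFinite.Build _ _ _ (as_finite_measure fin) fin.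

End FiniteMeasure.

Lemma push_density (phi : RT -> RT) (w : RT -> R) : measurable_fun setT phi ->
  measurable_fun setT w -> (forall t, (0 <= w t)%R) -> mu.-integrable setT (EFin \o w) ->
  exists m : {finite_measure set RT -> \bar R},
    (forall B, measurable B -> m B = \int[mu]_(t in phi @^-1` B) (w t)%:E) /\
    forall f : RT -> R, measurable_fun setT f -> (exists K : R, forall t, (`|f (phi t)| <= K)%R) ->
      \int[m]_t (f t)%:E = \int[mu]_t (f (phi t) * w t)%:E.
Proof.
move=> mphi mw w0 iw; pose nu : {finite_measure set RT -> \bar R} := density_measure mw w0 iw.
have mB B : measurable B -> measurable (phi @^-1` B).
  by move=> hB; rewrite -(setTI (phi @^-1` B)); apply: (mphi).
unshelve epose (m := pushforward nu phi : {measure set RT -> \bar R}); first exact: mphi.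
have fin : fin_num_fun m by move=> B hB; exact: (fin_num_measure nu _ (mB _ hB)).
exists (as_finite_measure fin : {finite_measure set RT -> \bar R}); split=> // f mf [K hK].
have mfp : measurable_fun setT (f \o phi) by exact: measurableT_comp.
have intf : nu.-integrable (phi @^-1` setT) (EFin \o (f \o phi)).
  rewrite preimage_setT; apply: measurable_bounded_integrable => //.
    by rewrite -ge0_fin_numE //; exact: fin_num_measure.
  exists K; split; first exact: num_real.
  by move=> L KL t /= _; apply: le_trans (hK t) (ltW KL).
have mEf : measurable_fun setT (EFin \o f) by exact/measurable_EFinP.
have e := integral_pushforward mphi mEf intf measurableT.
apply: (etrans e); rewrite preimage_setT.
by apply: (integral_density mw w0 iw mfp); exists K.
Qed.

End DensityMeasure.

(** * Null sets under the cosine *)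

Section CosineNullSets.
Variable R : realType.
Variable c : R.
Hypothesis c0 : 0 < c.
Local Notation mu := (@lebesgue_measure R).
Local Notation RT := (measurableTypeR R).
Local Notation A := (@angles R).

Lemma continuous_ccos : continuous (fun t : R => c * cos t).
Proof. by move=> t; apply: cvgM; [exact: cvg_cst|exact: continuous_cos]. Qed.

Lemma continuous_csin : continuous (fun t : R => c * sin t).
Proof. by move=> t; apply: cvgM; [exact: cvg_cst|exact: continuous_sin]. Qed.

Lemma integral_csin (s t : R) : s < t ->
  (\int[mu]_(x in `[s, t]) (c * sin x)%:E = (c * cos s - c * cos t)%:E)%E.
Proof.
move=> st; have der (x : R) : is_derive x 1 (fun y => - (c * cos y)) (c * sin x).
  by apply: trigger_derive; rewrite /GRing.scale /=; ring.
have cG : continuous (fun y : R => - (c * cos y)).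
  by move=> y; apply: differentiable_continuous; apply/derivable1_diffP; exact: ex_derive.
rewrite (continuous_FTC2 (F := fun y => - (c * cos y))).
- by rewrite -EFinB opprK addrC.
- exact: st.
- apply: continuous_subspaceT; exact: continuous_csin.
- split; first by move=> x _; exact: ex_derive.
  + by apply: cvg_at_right_filter; exact: cG.
  + by apply: cvg_at_left_filter; exact: cG.
- by move=> x _; rewrite derive1E derive_val.
Qed.

Lemma acos_cos_lt (x t : R) : -1 <= x <= 1 -> A t -> (acos x < t) = (cos t < x).
Proof.
move=> hx; rewrite /angles /= in_itv /= => /andP[t0 tpi].
have hp : t \in `[0, pi] by rewrite in_itv /= !ltW.
have hx' : x \in `[-1, 1] by rewrite in_itv.
have ha : acos x \in `[0, pi] by rewrite in_itv /= acos_ge0 // acos_lepi.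
by rewrite -[in RHS](acosK hx') (ltr_cos ha hp).
Qed.

Lemma acos_cos_gt (x t : R) : -1 <= x <= 1 -> A t -> (t < acos x) = (x < cos t).
Proof.
move=> hx; rewrite /angles /= in_itv /= => /andP[t0 tpi].
have hp : t \in `[0, pi] by rewrite in_itv /= !ltW.
have hx' : x \in `[-1, 1] by rewrite in_itv.
have ha : acos x \in `[0, pi] by rewrite in_itv /= acos_ge0 // acos_lepi.
by rewrite -[in RHS](acosK hx') (ltr_cos hp ha).
Qed.

Let mA : measurable (A : set RT).
Proof. exact: measurable_itv. Qed.

Let w : RT -> R := (fun t => c * sin t) \_ A.

Let w0 t : 0 <= w t.
Proof.
rewrite /w patchE; case: ifPn => // /set_mem; rewrite /angles /= => At.
by rewrite mulr_ge0 ?(ltW c0) // ltW // sin_gt0_pi.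
Qed.

Let mw : measurable_fun setT w.
Proof.
apply: ((measurable_restrictT _ mA).1 _).
exact: (rniceM (rnice_cst c) (rnice_sin R)).1.
Qed.

Let iw : mu.-integrable setT (EFin \o w).
Proof.
have h := @rnice_integrable R (fun t => c * sin t) (rniceM (rnice_cst c) (rnice_sin R)).
have h2 := (integrable_mkcond _ mA).1 h.
rewrite (_ : EFin \o w = (EFin \o (fun t : R => c * sin t)) \_ A) //.
by apply/funext => t; rewrite /= /w !patchE; case: ifP.
Qed.

Lemma acos_cos_pm (t : R) : A t -> -c < c * cos t < c.
Proof.
move=> At; have := At; rewrite /angles /= in_itv /= => /andP[t0 tpi].
have h1 : cos t < 1 by rewrite -acos_cos_lt ?acos1 // lexx andbT; lra.
have h2 : -1 < cos t by rewrite -acos_cos_gt ?acosN1 // lexx /=; lra.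
by rewrite -[X in X < _]mulrN1 -[X in _ && (_ < X)]mulr1 !ltr_pM2l // h2.
Qed.

(** The substitution x = c cos t on half-open intervals: c sin t dt is carried to Lebesgue measure
    on ]-c, c[. *)
Lemma integral_push_itv (u v : R) :
  (\int[mu]_(t in (fun t : R => (c * cos t)%R) @^-1` `]u, v]) (w t)%:E =
   mu (`]u, v]%classic `&` `](- c)%R, c[%classic))%E.
Proof.
set S := _ @^-1` _.
have mS : measurable (S : set RT).
  have : measurable_fun [set: RT] (fun t : R => c * cos t).
    by apply: continuous_measurable_fun; exact: continuous_ccos.
  by move=> /(_ measurableT _ (measurable_itv `]u, v])); rewrite setTI.
have mSA : measurable (S `&` A : set RT) by apply: measurableI => //; exact: mA.
have -> : (\int[mu]_(t in S) (w t)%:E = \int[mu]_(t in S `&` A) (c * sin t)%:E)%E.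
  rewrite integral_mkcondr; apply: eq_integral => t _.
  by rewrite /w !patchE; case: ifP.
(* Clipping to [-c, c] makes [acos] applicable at both ends. The preimage lies between an open and a
   closed interval with the same integral, so the endpoints need no separate treatment. *)
pose u' := Num.max u (- c); pose v' := Num.min v c.
have [uv|vu] := ltP u' v'; last first.
  rewrite (_ : S `&` A = set0) ?integral_set0; last first.
    apply/seteqP; split=> // t [/= St At]; have /andP[h1 h2] := acos_cos_pm At.
    move: St; rewrite /S /= in_itv /= => /andP[h3 h4].
    move: vu; rewrite leNgt => /negP; apply; rewrite /u' /v' lt_min !gt_max.
    by rewrite (lt_le_trans h3 h4) (lt_le_trans h1 h4) (lt_trans h3 h2) (lt_trans h1 h2).
  rewrite (_ : _ `&` _ = set0) ?measure0 //.
  apply/seteqP; split=> // x [/=]; rewrite !in_itv /= => /andP[h3 h4] /andP[h1 h2].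
  move: vu; rewrite leNgt => /negP; apply; rewrite /u' /v' lt_min !gt_max.
  by rewrite (lt_le_trans h3 h4) (lt_le_trans h1 h4) (lt_trans h3 h2) (lt_trans h1 h2).
have /andP[u1 u2] : -1 <= u' / c <= 1.
  rewrite ler_pdivlMr // ler_pdivrMr // mulN1r mul1r /u' le_max lexx orbT /=.
  by rewrite (le_trans (ltW uv)) // /v' ge_min lexx orbT.
have /andP[v1 v2] : -1 <= v' / c <= 1.
  rewrite ler_pdivlMr // ler_pdivrMr // mulN1r mul1r /v' ge_min lexx orbT andbT.
  by rewrite (le_trans _ (ltW uv)) // /u' le_max lexx orbT.
pose a1 := acos (v' / c); pose b1 := acos (u' / c).
have ca : c * cos a1 = v' by rewrite /a1 acosK ?in_itv /= ?v1 // mulrC divfK // gt_eqF.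
have cb : c * cos b1 = u' by rewrite /b1 acosK ?in_itv /= ?u1 // mulrC divfK // gt_eqF.
have a10 : 0 <= a1 by rewrite acos_ge0 ?v1.
have b1pi : b1 <= pi by rewrite acos_lepi ?u1.
have ab : a1 < b1.
  rewrite -(@ltr_cos R) ?in_itv /=; last 2 first.
  - by rewrite a10 acos_lepi ?v1.
  - by rewrite acos_ge0 ?u1.
  by rewrite -(ltr_pM2l c0) ca cb.
have sub1 : `]a1, b1[%classic `<=` S `&` A.
  move=> t /=; rewrite in_itv /= => /andP[t1 t2].
  have At : A t by rewrite /angles /= in_itv /= (le_lt_trans a10 t1) (lt_le_trans t2 b1pi).
  split=> //; rewrite /S /= in_itv /=.
  have : c * cos t < v' by rewrite -ltr_pdivlMl // mulrC -acos_cos_lt ?v1.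
  have : u' < c * cos t by rewrite -ltr_pdivrMl // mulrC -acos_cos_gt ?u1.
  rewrite /u' /v' gt_max lt_min => /andP[-> _] /andP[h _].
  by rewrite ltW.
have sub2 : S `&` A `<=` `[a1, b1]%classic.
  move=> t [/= St At]; have /andP[h1 h2] := acos_cos_pm At.
  move: St; rewrite /S /= !in_itv /= => /andP[h3 h4].
  rewrite leNgt acos_cos_gt ?v1 // -leNgt ler_pdivlMr // mulrC.
  rewrite [X in _ && X]leNgt acos_cos_lt ?u1 // -leNgt ler_pdivrMr // [_ * c]mulrC.
  by rewrite /v' /u' le_min ge_max h4 (ltW h3) (ltW h1) (ltW h2).
have i1 : (\int[mu]_(t in `[a1, b1]) (c * sin t)%:E = (v' - u')%:E)%E.
  by rewrite integral_csin // ca cb.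
have mcsin (B : set RT) : measurable_fun B (fun t : R => (c * sin t)%:E).
  apply/measurable_EFinP; apply: measurable_funTS.
  by apply: continuous_measurable_fun; exact: continuous_csin.
have ge0 t : t \in `[a1, b1] -> (0%E <= (c * sin t)%:E)%E.
  rewrite in_itv /= => /andP[t1 t2]; rewrite lee_fin mulr_ge0 ?(ltW c0) //.
  by apply: sin_ge0_pi; rewrite (le_trans a10) // (le_trans t2).
have i2 : (\int[mu]_(t in `]a1, b1[) (c * sin t)%:E = (v' - u')%:E)%E.
  rewrite -i1 integral_itv_bndo_bndc; last exact: mcsin.
  by rewrite integral_itv_obnd_cbnd; last exact: mcsin.
transitivity (v' - u')%:E.
  apply/eqP; rewrite eq_le; apply/andP; split.
    by rewrite -i1; apply: ge0_subset_integral => //; exact: mcsin.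
  rewrite -i2; apply: ge0_subset_integral => //.
  by move=> t /sub2; exact: ge0.
apply/esym/eqP; rewrite eq_le; apply/andP; split.
  apply: (@le_trans _ _ (mu `[u', v']%classic)).
    apply: le_measure; rewrite ?inE //; first exact: measurableI.
    move=> x [/=]; rewrite !in_itv /= => /andP[h3 h4] /andP[h1 h2].
    by rewrite /u' /v' ge_max le_min (ltW h3) (ltW h1) h4 (ltW h2).
  by rewrite lebesgue_measure_itv /= lte_fin uv -EFinB.
apply: (@le_trans _ _ (mu `]u', v'[%classic)).
  by rewrite lebesgue_measure_itv /= lte_fin uv -EFinB.
apply: le_measure; rewrite ?inE //; first exact: measurableI.
move=> x /=; rewrite !in_itv /= /u' /v' gt_max lt_min => /andP[/andP[h1 h2] /andP[h3 h4]].
by rewrite h1 (ltW h3) h2 h4.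
Qed.

(** By uniqueness of Lebesgue measure on intervals, it is the image of c sin t dt plus its own
    restriction off ]-c, c[. So the preimage of N has no mass for c sin t dt, and this density is
    positive on the angles. *)
Lemma cos_preimage_null (N : set RT) : measurable N -> mu N = 0%E ->
  mu (A `&` (fun t => c * cos t) @^-1` N) = 0%E.
Proof.
move=> mN N0; pose phi : RT -> RT := fun t => c * cos t.
have mphi : measurable_fun setT phi.
  by apply: continuous_measurable_fun; exact: continuous_ccos.
have [m [mE _]] := push_density mphi mw w0 iw.
have mD : measurable (~` `]-c, c[%classic : set RT) by apply: measurableC; exact: measurable_itv.
have key : forall X, measurable X -> mu X = (m X + mu (X `&` ~` `](- c)%R, c[%classic))%E.
  move=> X mX; rewrite -[RHS](measure_addE m (mrestr mu mD)).
  apply: lebesgue_measure_unique => // _ [[u v] _ <-].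
  apply: (etrans _ (esym (measure_addE m (mrestr mu mD) _))).
  rewrite /= mE ?integral_push_itv; last exact: measurable_itv.
  by rewrite /mrestr -setDE addeC -measureDI //; exact: measurable_itv.
have m0 : m N = 0%E.
  have := key N mN; rewrite N0 => /esym /eqP.
  by rewrite padde_eq0 ?measure_ge0 // => /andP[/eqP].
rewrite mE // in m0.
have mSN : measurable (phi @^-1` N) by rewrite -(setTI (phi @^-1` N)); apply: (mphi).
have mwE (B : set RT) : measurable_fun B (EFin \o w).
  by apply: measurable_funTS; exact/measurable_EFinP.
have : ae_eq mu (phi @^-1` N) (EFin \o w) (cst 0%E).
  apply/(ae_eq_integral_abs _ mSN (mwE _)); rewrite -m0; apply: eq_integral => t _.
  by rewrite /= ger0_norm.
move=> h; apply: measure_negligible.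
  by apply: measurableI => //; exact: mA.
apply: negligibleS h => t /= [At Nt] hh.
have /eqP := hh Nt; rewrite /= eqe /w patchE mem_set // mulf_eq0 gt_eqF //=.
by rewrite gt_eqF // sin_gt0_pi //; move: At; rewrite /angles /= in_itv.
Qed.

End CosineNullSets.

(** * Limits of densities in L^1 *)

Section L1Limit.
Variable R : realType.
Local Notation mu := (@lebesgue_measure R).
Local Notation RT := (measurableTypeR R).
Local Notation A := (@angles R).

Let mA : measurable (A : set RT).
Proof. exact: measurable_itv. Qed.

Lemma sum_geo (c : R) n : \sum_(0 <= k < n) c * 2 ^- k = 2 * c - 2 * c * 2 ^- n.
Proof.
elim: n => [|n ih]; first by rewrite big_nil expr0 invr1 mulr1 subrr.
by rewrite big_nat_recr //= ih exprS; field; rewrite expf_neq0.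
Qed.

Lemma rnice_norm (h : R -> R) : rnice h -> rnice (fun t => `|h t|).
Proof.
move=> [mh [K hK]]; split; first exact: measurableT_comp.
by exists K => t At; rewrite normr_id hK.
Qed.

Lemma rnice_EFin_integral (h : R -> R) : rnice h ->
  (\int[mu]_(t in A) (h t)%:E = (Rintegral mu A h)%:E)%E.
Proof.
move=> hn; rewrite /Rintegral fineK //; apply: integrable_fin_num => //.
exact: rnice_integrable.
Qed.

(** The argument for completeness of L^1: geometric increments have an integrable sum g, so w k
    converges almost everywhere and is dominated by w 0 + g. *)
Lemma L1_limit (w : nat -> R -> R) (c : R) :
  (forall k, rnice (w k)) -> (forall k t, A t -> 0 <= w k t) ->
  (forall k, Rintegral mu A (fun t => `|w k.+1 t - w k t|) <= c * 2 ^- k) ->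
  exists v : RT -> R, [/\ measurable_fun setT v, forall t, 0 <= v t,
    mu.-integrable A (EFin \o v) &
    forall b, rnice b ->
      Rintegral mu A (fun t => b t * w k t) @[k --> \oo] --> Rintegral mu A (fun t => b t * v t)].
Proof.
move=> nw w0 wc; pose f k t : R := `|w k.+1 t - w k t|.
have f0 k t : 0 <= f k t by exact: normr_ge0.
have nf k : rnice (f k).
  apply: rnice_norm; apply: rniceD; first exact: nw.
  by apply: rniceN; exact: nw.
have mf k : measurable_fun (A : set RT) (fun t => (f k t)%:E) by apply/measurable_EFinP; exact: (nf k).1.
pose g (t : RT) : \bar R := (\sum_(0 <= k <oo) (f k t)%:E)%E.
have mg : measurable_fun (A : set RT) g.
  apply: (@ge0_emeasurable_sum _ _ _ _ (fun k (t : RT) => (f k t)%:E) xpredT) => [k t _ _|k _].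
    by rewrite lee_fin f0.
  exact: mf.
have g0 t : (0%E <= g t)%E by apply: nneseries_ge0 => k _ _; rewrite lee_fin f0.
have ig : mu.-integrable A g.
  apply/integrableP; split=> //.
  have -> : (\int[mu]_(t in A) `|g t| = \int[mu]_(t in A) g t)%E.
    by apply: eq_integral => t _; rewrite gee0_abs.
  rewrite integral_nneseries //; last by move=> k t _; rewrite lee_fin f0.
  apply: (@le_lt_trans _ _ (2 * c)%:E); last exact: ltry.
  apply: lime_le; first by apply: is_cvg_nneseries => k _ _; apply: integral_ge0 => t _; rewrite lee_fin f0.
  apply: nearW => n; under eq_bigr do rewrite rnice_EFin_integral //.
  rewrite sumEFin lee_fin; apply: (@le_trans _ _ (\sum_(0 <= k < n) c * 2 ^- k)).
    by apply: ler_sum => k _; exact: wc.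
  rewrite sum_geo lerBlDr lerDl.
  have c0 : 0 <= c.
    by have := wc 0%N; rewrite expr0 invr1 mulr1; apply: le_trans; apply: Rint_ge0 => t _.
  by rewrite !mulr_ge0 // invr_ge0 exprn_ge0.
pose G := A `&` [set t | (g t < +oo)%E].
have mG : measurable (G : set RT) by exact: emeasurable_fun_infty_o.
have cw t : G t -> cvgn (fun k => w k t).
  move=> [At gt]; have cf : cvgn (series (fun k => f k t)).
    apply: nondecreasing_is_cvgn.
      by move=> n m nm; rewrite !seriesEnat /= (big_cat_nat _ nm) //= lerDl sumr_ge0.
    exists (fine (g t)) => _ [n _ <-]; rewrite -lee_fin fineK ?ge0_fin_numE //.
    rewrite seriesEnat /= -sumEFin; apply: nneseries_lim_ge => k _ _; by rewrite lee_fin f0.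
  have cs : cvgn (series (telescope (fun k => w k t))).
    exact: (@normed_cvg R R^o (telescope (fun k => w k t)) cf).
  rewrite (_ : (fun k => w k t) = fun k => w 0%N t + series (telescope (fun k => w k t)) k).
    by apply: is_cvgD => //; exact: is_cvg_cst.
  by apply/funext => k; rewrite {1}(eq_sum_telescope (fun k => w k t) k).
(* Cutting off outside G, where the increments may fail to be summable, makes the limit exist
   everywhere, so that v is measurable and nonnegative without exceptions. *)
pose v (t : RT) : R := limn (fun k => (w k \_ G) t).
have hv t : (w k \_ G) t @[k --> \oo] --> v t.
  suff h : cvgn (fun k => (w k \_ G) t) by [].
  have [Gt|Gt] := pselect (G t).
    rewrite (_ : (fun k => _) = fun k => w k t); first exact: cw.
    by apply/funext => k; rewrite patchE mem_set.
  rewrite (_ : (fun k => _) = fun k => 0); first exact: is_cvg_cst.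
  by apply/funext => k; rewrite patchE memNset.
have mv : measurable_fun [set: RT] v.
  apply: (@measurable_fun_cvg _ _ _ _ (fun k => w k \_ G)) => [k|t _]; last exact: hv.
  apply: ((measurable_restrictT _ mG).1 _); apply: (measurable_funS _ _ (nw k).1) => //.
  by move=> t [].
have v0 t : 0 <= v t.
  apply: limr_ge; first by apply/cvg_ex; exists (v t); exact: hv.
  by apply: nearW => k; rewrite patchE; case: ifPn => // /set_mem [At _]; exact: w0.
have aeG : {ae mu, forall t, A t -> G t}.
  have := integrable_ae mA ig; apply: filterS => t h At; split=> //=.
  by rewrite -ge0_fin_numE // h.
have hvG t : G t -> w k t @[k --> \oo] --> v t.
  move=> Gt; have := hv t; rewrite (_ : (fun k => _) = fun k => w k t) //.
  by apply/funext => k; rewrite patchE mem_set.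
have dct b : rnice b -> mu.-integrable A (EFin \o (fun t => b t * v t)) /\
    Rintegral mu A (fun t => b t * w k t) @[k --> \oo] --> Rintegral mu A (fun t => b t * v t).
  move=> nb; have [mb [K hK]] := nb.
  have mvA : measurable_fun (A : set RT) v by apply: measurable_funTS.
  have [] := @dominated_convergence _ _ R mu A mA
     (fun n t => (b t * w n t)%:E) (fun t => (b t * v t)%:E)
     (fun t => ((`|K|)%:E * ((w 0%N t)%:E + g t))%E).
  - by move=> n; apply/measurable_EFinP; exact: (rniceM nb (nw n)).1.
  - by apply/measurable_EFinP; exact: measurable_funM.
  - apply: negligibleS aeG => t /= h1 h2; apply: h1 => At; have c1 := hvG _ (h2 At).
    apply/fine_cvgP; split; first exact: nearW.
    exact: (cvgM (cvg_cst (b t)) c1).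
  - apply: integrableZl => //; apply: integrableD => //.
    exact: (rnice_integrable (nw 0%N)).
  - apply: aeW => t n At; rewrite abse_EFin normrM EFinM.
    apply: lee_pmul; rewrite ?lee_fin ?(le_trans (hK t At)) ?ler_norm //.
    apply: (@le_trans _ _ ((w 0%N t)%:E + (\sum_(0 <= k < n) (f k t)%:E))%E).
      rewrite sumEFin -EFinD lee_fin ger0_norm ?w0 //.
      rewrite [X in X <= _](eq_sum_telescope (fun k => w k t) n) lerD2l seriesEnat /=.
      by apply: ler_sum => k _; exact: ler_norm.
    by rewrite leeD2l // nneseries_lim_ge // => k _ _; rewrite lee_fin f0.
  move=> i1 _ c1; split=> //.
  rewrite /Rintegral; apply: fine_cvg; rewrite fineK; last exact: integrable_fin_num.
  exact: c1.
exists v; split=> //; last by move=> b nb; have [] := dct b nb.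
have [] := dct (fun=> 1) (rnice_cst 1).
by under eq_fun do rewrite mul1r.
Qed.

(** The difference is at most |e|^2 + 2 |u| |e|, and the mixed term is split with weight s by
    Young's inequality. *)
Lemma vsqnorm_diff (m : nat) (u e : 'cV[R[i]]_m) (s : R) : 0 < s ->
  `|vsqnorm (u + e) - vsqnorm u| <= (1 + s) * vsqnorm e + s^-1 * vsqnorm u.
Proof.
move=> s0; rewrite /vsqnorm -sumrB !mulr_sumr -big_split.
apply: (le_trans (ler_norm_sum _ _ _)); apply: ler_sum => i _ /=; rewrite mxE.
have h1 := normcD (u i 0) (e i 0); have h2 := normcD (u i 0 + e i 0) (- e i 0).
rewrite normcN addrK in h2.
have := normc_ge0 (u i 0); have := normc_ge0 (e i 0); have := normc_ge0 (u i 0 + e i 0).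
move: (Normc.normc _) (Normc.normc (u i 0)) (Normc.normc (e i 0)) h1 h2 => p x y h1 h2 p0 y0 x0.
have h3 : 2 * x * y <= s * y ^+ 2 + s^-1 * x ^+ 2.
  have := sqr_ge0 (s * y - x); rewrite -(@pmulr_rge0 _ s^-1) ?invr_gt0 //.
  have -> : s^-1 * (s * y - x) ^+ 2 = s * y ^+ 2 + s^-1 * x ^+ 2 - 2 * x * y.
    by field; rewrite gt_eqF.
  by rewrite subr_ge0.
rewrite ler_norml; apply/andP; split; nra.
Qed.

End L1Limit.


(** * Continuity of the pairing and of bounded operators *)

Section StrongContinuity.
Variables (R : realType) (d r : nat).
Local Notation C := R[i].
Local Notation normc := (@Normc.normc R).
Local Notation state := (state R d r).

Lemma sqnormHN (f : state) : inH f -> sqnormH (- f) = sqnormH f.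
Proof.
move=> hf; have hN := @inHN _ _ _ _ hf.
apply: complexI; rewrite -!ipff //; apply: (etrans (ipNl hf hN)).
by rewrite (ipNr hf hf) opprK.
Qed.

Lemma sqnormHD (f g : state) : inH f -> inH g -> sqnormH (f + g) <= 2 * (sqnormH f + sqnormH g).
Proof.
move=> hf hg; have [hp hm] := (inHD hf hg, inHB hf hg).
suff e : sqnormH (f + g) + sqnormH (f - g) = 2 * (sqnormH f + sqnormH g).
  by rewrite -e lerDl (sqnormH_ge0 hm).
apply: complexI; rewrite rmorphM !rmorphD /= -(ipff hp) -(ipff hm) -(ipff hf) -(ipff hg).
have e1 := etrans (ipDl hf hg hp) (congr2 +%R (ipDr hf hg hf) (ipDr hf hg hg)).
have e2 := etrans (ipBl hf hg hm) (congr2 (fun x y => x - y) (ipBr hf hg hf) (ipBr hf hg hg)).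
apply: (etrans (congr2 +%R e1 e2)); move: (ip f f) (ip f g) (ip g f) (ip g g) => x y z w.
by rewrite rmorph1 /=; ring.
Qed.

Lemma ip_CS_sqrt (f g : state) : inH f -> inH g ->
  normc (ip f g) <= Num.sqrt (sqnormH f) * Num.sqrt (sqnormH g).
Proof.
move=> hf hg; rewrite -sqrtrM ?(sqnormH_ge0 hf) // -[X in X <= _]ger0_norm ?normc_ge0 //.
by rewrite -sqrtr_sqr ler_wsqrtr // (ip_CS hf hg).
Qed.

Lemma cvgH_sqrt (fs : nat -> state) f : cvgH fs f ->
  Num.sqrt (sqnormH (fs k - f)) @[k --> \oo] --> (0 : R).
Proof. by move=> h; rewrite -[X in _ --> X]sqrtr0; apply: (continuous_cvg _ _ h); exact: sqrt_continuous. Qed.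

Lemma cvgH_ip (fs gs : nat -> state) f g : (forall k, inH (fs k)) -> (forall k, inH (gs k)) ->
  inH f -> inH g -> cvgH fs f -> cvgH gs g ->
  (ip (fs k) (gs k) : C^o) @[k --> \oo] --> (ip f g : C^o).
Proof.
move=> hfs hgs hf hg cf cg; apply/cvgC_normc.
have [sf sg] := (cvgH_sqrt cf, cvgH_sqrt cg).
pose F := Num.sqrt (sqnormH f); pose G := Num.sqrt (sqnormH g).
pose u k := Num.sqrt (sqnormH (fs k - f)); pose v k := Num.sqrt (sqnormH (gs k - g)).
have cuv : (u k * v k + u k * G + F * v k) @[k --> \oo] --> (0 : R).
  have := cvgD (cvgD (cvgM sf sg) (cvgM sf (cvg_cst G))) (cvgM (cvg_cst F) sg).
  by rewrite !mulr0 mul0r !addr0; exact.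
apply: (squeeze_cvgr _ (cvg_cst 0) cuv); apply: nearW => k; rewrite normc_ge0 /=.
have [hff hgg] := (inHB (hfs k) hf, inHB (hgs k) hg).
have e : ip (fs k) (gs k) - ip f g =
    ip (fs k - f) (gs k - g) + ip (fs k - f) g + ip f (gs k - g).
  have e1 := etrans (ipBl (hfs k) hf hgg)
    (congr2 (fun x y => x - y) (ipBr (hgs k) hg (hfs k)) (ipBr (hgs k) hg hf)).
  have e2 := ipBl (hfs k) hf hg; have e3 := ipBr (hgs k) hg hf.
  apply: (etrans _ (esym (congr2 +%R (congr2 +%R e1 e2) e3))).
  by move: (ip (fs k) (gs k)) (ip f g) (ip (fs k) g) (ip f (gs k)) => x y z w; ring.
rewrite e; apply: (le_trans (normcD _ _)); apply: lerD; last exact: ip_CS_sqrt.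
by apply: (le_trans (normcD _ _)); apply: lerD; exact: ip_CS_sqrt.
Qed.

Lemma cvgH_bounded (T : state -> state) (K : R) (fs : nat -> state) f :
  (forall g, inH g -> sqnormH (T g) <= K * sqnormH g) ->
  (forall g, inH g -> inH (T g)) ->
  (forall g h, inH g -> inH h -> T (g - h) = T g - T h) ->
  (forall k, inH (fs k)) -> inH f -> cvgH fs f -> cvgH (fun k => T (fs k)) (T f).
Proof.
move=> TK TH TB hfs hf cf; rewrite /cvgH.
have cK : (K * sqnormH (fs k - f)) @[k --> \oo] --> (0 : R).
  by have := cvgM (cvg_cst K) cf; rewrite mulr0; exact.
apply: (squeeze_cvgr _ (cvg_cst 0) cK); apply: nearW => k.
have hd := inHB (hfs k) hf; rewrite -TB // TK // andbT.
by rewrite (sqnormH_ge0 (@TH _ hd)).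
Qed.

Section Proj.
Variables (n : nat) (phi : 'I_n -> state).
Hypothesis hphi : forall j, inH (phi j).
Hypothesis ophi : forall j k, ip (phi j) (phi k) = (j == k)%:R.

Lemma projB f g : inH f -> inH g -> proj phi (f - g) = proj phi f - proj phi g.
Proof.
move=> hf hg; rewrite /proj -sumrB; apply: eq_bigr => j _.
by rewrite (ipBl hf hg (@hphi j)) scalerBl.
Qed.

End Proj.

Variables (q : nat) (HC : 'M[C]_d) (V : 'M[C]_(d, r)).
Hypothesis hHC : HC = HC^t*.

Lemma polyJ_bounded (p : {poly R}) : exists2 K : R, 0 <= K &
  forall g, inH g -> sqnormH (polyJ q HC V p g) <= K * sqnormH g.
Proof.
have [KJ KJ0 hJ] := @Jop_bounded R q d r HC V.
elim/poly_ind: p => [|p c [K K0 hK]].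
  by exists 0 => // g hg; rewrite -polyC0 polyJC scale0r sqnormH0 mul0r.
exists (2 * (KJ * K + c ^+ 2)) => [|g hg].
  exact: (mulr_ge0 (ler0n _ 2) (addr_ge0 (mulr_ge0 KJ0 K0) (sqr_ge0 c))).
have hp := @polyJ_inH _ q _ _ HC V p _ hg; have [hJp Jle] := hJ _ hp.
have hc := @inHZ _ _ _ c%:C _ hg.
rewrite polyJD polyJMX polyJC; apply: (le_trans (sqnormHD hJp hc)).
have ec : sqnormH (c%:C *: g) = c ^+ 2 * sqnormH g.
  apply: complexI; rewrite -(ipff hc); apply: (etrans (ipZl c%:C hg hc)).
  rewrite (ipZr c%:C hg hg) conjc_real (ipff hg) rmorphM rmorphXn /= mulrA -expr2.
  by [].
have Kg := le_trans Jle (ler_wpM2l KJ0 (hK _ hg)).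
rewrite ec; apply: (le_trans (ler_wpM2l (ler0n _ 2) (lerD Kg (lexx _)))).
by rewrite mulrA -mulrDl mulrA.
Qed.

Lemma cvgH_polyJ (p : {poly R}) (fs : nat -> state) f : (forall k, inH (fs k)) -> inH f ->
  cvgH fs f -> cvgH (fun k => polyJ q HC V p (fs k)) (polyJ q HC V p f).
Proof.
have [K K0 hK] := polyJ_bounded p.
apply: (cvgH_bounded hK) => [g hg|g h _ _]; first exact: polyJ_inH.
have e (x y : state) : x - y = x + (-1) *: y by rewrite scaleN1r.
by rewrite (e g h) polyJ_comb -e.
Qed.

End StrongContinuity.


Section Uniqueness.
Variables (R : realType) (d r : nat).
Local Notation C := R[i].
Local Notation state := (state R d r).

(** [Hac] is not known to be a subspace when this is applied. The difference of two candidates is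
    therefore paired with each candidate separately, and is orthogonal to both. *)
Lemma orth_proj_eq (M : state -> Prop) f p : (forall h, M h -> inH h) -> inH f ->
  is_orth_proj_on M f p -> orth_proj M f = p.
Proof.
move=> MH hf hp; apply: xget_subset1; first exact: hp.
move=> x y [Mx Ox] [My Oy].
have [hx hy] := (MH _ Mx, MH _ My); have hxy := inHB hx hy.
apply/eqP; rewrite -subr_eq0; apply/eqP; apply: (sqnormH_eq0 hxy); apply: complexI.
rewrite -(ipff hxy) -[RHS](subrr (0 : C)).
have e k (Mk : M k) : ip (x - y) k = 0.
  have hk := MH _ Mk; apply: (etrans (ipBl hx hy hk)).
  have := etrans (esym (ipBl hf hx hk)) (Ox _ Mk); have := etrans (esym (ipBl hf hy hk)) (Oy _ Mk).
  by move=> /eqP; rewrite subr_eq0 => /eqP <- /eqP; rewrite subr_eq0 => /eqP ->; rewrite subrr.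
by apply: (etrans (ipBr hx hy hxy)); rewrite (e _ Mx) (e _ My).
Qed.
End Uniqueness.

Lemma measurable_horner (R : realType) (p : {poly R}) :
  measurable_fun [set: measurableTypeR R] (fun x : measurableTypeR R => p.[x] : R).
Proof.
elim/poly_ind: p => [|p c ih].
  by under eq_fun do rewrite horner0; exact: measurable_cst.
under eq_fun do rewrite hornerMXaddC.
by apply: measurable_funD => //; apply: measurable_funM.
Qed.

Lemma peak_sq_cvg0 (R : realType) (mu : {finite_measure set (measurableTypeR R) -> \bar R}) (M l c : R) :
  0 < c -> (forall x, `[- M, M]%classic x -> `|x - l| <= c) ->
  mu (~` `[- M, M]%classic) = 0%E -> mu [set l] = 0%E ->
  Rintegral mu [set: R] (fun x => (peak l c n * peak l c n).[x]) @[n --> \oo] --> (0 : R).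
Proof.
move=> c0 hc muM mul.
pose N : set (measurableTypeR R) := [set l] `|` ~` `[- M, M]%classic.
have nN : mu.-negligible N.
  apply: negligibleU; first by apply/negligibleP => //; exact: measurable_set1.
  by apply/negligibleP => //; apply: measurableC; exact: measurable_itv.
have hN x : ~ N x -> `|x - l| <= c /\ x != l.
  move=> h; split; last by apply/eqP => xl; apply: h; left.
  by apply: hc; apply: contrapT => h'; apply: h; right.
have mp n : measurable_fun [set: measurableTypeR R]
    (fun x : measurableTypeR R => ((peak l c n * peak l c n).[x])%:E).
  by apply/measurable_EFinP; exact: measurable_horner.
have hcvg : \forall x \ae mu, [set: measurableTypeR R] x ->
    ((peak l c n * peak l c n).[x])%:E @[n --> \oo] --> cst 0%E x.
  apply: negligibleS nN => x /= h; apply: contrapT => /hN [hx xl]; apply: h => _.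
  apply: cvg_EFin; first by apply: nearW => n.
  have -> : fine \o (fun n => ((peak l c n * peak l c n).[x])%:E) =
      (fun n => (peak l c n).[x] * (peak l c n).[x]) by apply/funext => n /=; rewrite hornerM.
  rewrite -[X in _ --> X](mulr0 (0 : R)).
  by apply: cvgM; exact: peak_cvg0.
have hle : \forall x \ae mu, forall n, [set: measurableTypeR R] x ->
    (`|((peak l c n * peak l c n).[x])%:E| <= (EFin \o cst 1%R) x)%E.
  apply: negligibleS nN => x /= h; apply: contrapT => /hN [hx xl]; apply: h => n _.
  rewrite lee_fin hornerM normrM -[X in _ <= X](mulr1 1).
  by apply: ler_pM; rewrite ?normr_ge0 ?peak_le1.
have [_ _ h] := dominated_convergence measurableT mp (measurable_cst _) hcvg
  (finite_measure_integrable_cst mu 1 measurableT) hle.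
by apply: fine_cvg; rewrite integral0 in h.
Qed.

(** * Absolutely continuous vectors against eigenvectors *)

Section Orthogonality.
Variables (R : realType) (q d r : nat).
Variables (HC : 'M[R[i]]_d) (V : 'M[R[i]]_(d, r)).
Hypothesis hHC : HC = HC^t*.
Local Notation normc := (@Normc.normc R).
Local Notation pJ := (polyJ q HC V).

Lemma Hac_inH h : Hac q HC V h -> inH h.
Proof. by case. Qed.

(** An absolutely continuous spectral measure has no atom at l. The squared norm of p(J) h is the
    integral of p^2, so it tends to 0 along the peaks, while <p(J) h, psi> stays equal to <h,
    psi>. *)
Lemma Hac_orth_eigen h psi : Hac q HC V h -> is_eigenvector q HC V psi -> ip h psi = 0.
Proof.
move=> [hh [mu [[[M muM] mom] dom]]] epsi; have [hpsi _ _] := epsi.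
have [l hl] := eigenvalueR hHC epsi.
have mul : mu [set l] = 0%E.
  apply: ((null_content_dominatesP _ _).1 dom); first exact: measurable_set1.
  exact: lebesgue_measure_set1.
pose c := `|M| + `|l| + 1; have c0 : 0 < c by rewrite ltr_wpDl // addr_ge0.
have hc x : `[- M, M]%classic x -> `|x - l| <= c.
  rewrite /= in_itv /= -ler_norml => xM.
  apply: (le_trans (ler_normB _ _)); rewrite /c -addrA; apply: lerD.
    exact: (le_trans xM (ler_norm _)).
  by rewrite lerDl.
have lim := peak_sq_cvg0 c0 hc muM mul.
have le n : normc (ip h psi) ^+ 2 <= Rintegral mu [set: R] (fun x => (peak l c n * peak l c n).[x]) * sqnormH psi.
  have hp := @polyJ_inH _ q _ _ HC V (peak l c n) _ hh.
  have e1 : ip (pJ (peak l c n) h) psi = ip h psi.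
    by apply: (etrans (ip_polyJ q V hHC _ hh hpsi)); rewrite (polyJ_eigen _ hl) peak_at scale1r.
  have e2 : sqnormH (pJ (peak l c n) h) = Rintegral mu [set: R] (fun x => (peak l c n * peak l c n).[x]).
    apply: complexI; rewrite -(ipff hp) -mom.
    rewrite polyJM; symmetry; exact: (ip_polyJ q V hHC).
  by rewrite -e1 -e2; exact: (ip_CS hp hpsi).
suff : normc (ip h psi) ^+ 2 <= 0 * sqnormH psi.
  rewrite mul0r => h0; have : normc (ip h psi) ^+ 2 == 0 by rewrite eq_le h0 sqr_ge0.
  by rewrite sqrf_eq0 => /eqP /(@Normc.eq0_normc _ _).
by apply: (cvgr_to_ge (cvgM lim (cvg_cst _))); apply: nearW.
Qed.

End Orthogonality.


(** A subsequence of the truncations; the rate 4^-k for squared norms makes consecutive densities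
    differ by O(2^-k) in L^1, as [L1_limit] requires. *)
Lemma fast_approx (R : realType) (d r : nat) (f : state R d r) : inH f ->
  exists fs : nat -> state R d r, [/\ forall k, finsupp (fs k), cvgH fs f &
    forall k, sqnormH (fs k - f) <= 2 ^- k * 2 ^- k].
Proof.
move=> hf; have h k : exists N, sqnormH (trunc N f - f) <= 2 ^- k * 2 ^- k.
  have e0 : (0 : R) < 2 ^- k * 2 ^- k by rewrite mulr_gt0 // invr_gt0 exprn_gt0.
  have [N _ hN] := cvgr_dist_le _ _ (trunc_cvg hf) _ e0.
  exists N; have := hN N (leqnn N); rewrite /= sub0r normrN; exact: le_trans (ler_norm _).
have [Nk hNk] := choice h.
exists (fun k => trunc (Nk k) f); split => //; first by move=> k; exact: trunc_finsupp.
have c4 : (2 ^- k * 2 ^- k : R) @[k --> \oo] --> (0 : R).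
  have c2 : ((2^-1 : R) ^+ k) @[k --> \oo] --> (0 : R).
    by apply: cvg_expr; rewrite ger0_norm ?invr_ge0 // invf_lt1 // ltr1n.
  under eq_fun do rewrite -exprVn.
  by have := cvgM c2 c2; rewrite mulr0; apply.
apply: (squeeze_cvgr _ (cvg_cst 0) c4); apply: nearW => k.
by rewrite hNk andbT sqnormH_ge0 //; apply: inHB => //; apply: finsupp_inH; exact: trunc_finsupp.
Qed.

Lemma half_mul_le (R : realType) (e : R) : 0 < e -> e / 2 * (e / 2) <= e * e.
Proof. by move=> e0; nra. Qed.

Lemma double_add_le (R : realType) (e x y : R) : x <= e * e -> y <= e * e ->
  2 * (x + y) <= 4 * (e * e).
Proof. by move=> h1 h2; lra. Qed.

Lemma step_constE (R : realType) (K e : R) : e != 0 ->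
  (1 + e^-1) * (K * (4 * (e * e))) = K * (4 * (e * e + e)).
Proof. by move=> e0; field. Qed.

Lemma step_const_le (R : realType) (K e s : R) : K * (e * e) <= K * e ->
  K * (4 * (e * e + e)) + e * (K * (2 * (1 + s))) <= K * (8 + 2 * (1 + s)) * e.
Proof. by move=> h; lra. Qed.

Lemma horner_bounded (R : realType) (p : {poly R}) (M : R) :
  exists K : R, forall x, `|x| <= M -> `|p.[x]| <= K.
Proof.
elim/poly_ind: p => [|p c [K hK]]; first by exists 0 => x _; rewrite horner0 normr0.
exists (K * M + `|c|) => x hx; rewrite hornerMXaddC; apply: (le_trans (ler_normD _ _)).
by rewrite lerD2r normrM; apply: ler_pM; rewrite ?hK.
Qed.

(** * Spectral measures of the vectors f - P f *)

Section ContinuousPart.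
Variables (R : realType) (q d r : nat).
Variables (HC : 'M[R[i]]_d) (V : 'M[R[i]]_(d, r)).
Hypothesis hHC : HC = HC^t*.
Hypothesis ha : 0 < ahop R q.
Hypothesis hd : (0 < d)%N.
Variable W : R -> {linear 'cV[R[i]]_r -> state R d r}.
Local Notation C := R[i].
Local Notation mu := (@lebesgue_measure R).
Local Notation RT := (measurableTypeR R).
Local Notation state := (state R d r).
Local Notation pJ := (polyJ q HC V).
Local Notation a := (ahop R q).
Local Notation A := (@angles R).
Local Notation fcoef := (fcoef q HC V).
Local Notation Q := (Qform q HC V W).
Variables (n : nat) (phi : 'I_n -> state).
Hypothesis ophi : is_onb (Hpp q HC V) phi.
Local Notation P := (proj phi).
Local Notation Pc f := (f - P f).

Let hphi j : inH (phi j). Proof. exact: onb_inH ophi j. Qed.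
Let ohphi := onb_orth ophi.

Lemma cont_inH f : inH f -> inH (Pc f).
Proof. by move=> hf; apply: inHB => //; exact: proj_inH. Qed.

Lemma proj_polyJ p f : finsupp f -> P (pJ p f) = pJ p (P f).
Proof.
move=> ff; have hf := finsupp_inH ff.
have fp := @polyJ_finsupp R q d r HC V p f ff; have hp := finsupp_inH fp.
have h1 : inH (P (pJ p f)) by apply: proj_inH.
have hPf : inH (P f) by apply: proj_inH.
have h2 := @polyJ_inH _ q _ _ HC V p _ hPf.
apply/eqP; rewrite -subr_eq0; apply/eqP; apply: (ip_nondeg (inHB h1 h2)) => g fg.
have hg := finsupp_inH fg; have fpg := @polyJ_finsupp R q d r HC V p g fg.
apply: (etrans (ipBl h1 h2 hg)).
rewrite (ip_polyJ q V hHC p hPf hg).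
have aux (x y u v z w : C) : z = x - u -> w = y - v -> z = w -> x = y -> u - v = 0.
  by move=> -> -> h xy; move: h; rewrite xy => /addrI /oppr_inj ->; rewrite subrr.
exact: (aux _ _ _ _ _ _ (Qform_proj hHC ha hd W ophi fp fg)
  (Qform_proj hHC ha hd W ophi ff fpg) (Qform_pJ V hHC ha hd W p ff fg) (ip_polyJ q V hHC p hf hg)).
Qed.

(** The complementary projection is symmetric, idempotent and commutes with p(J). *)
Lemma Qform_moment p f : finsupp f -> Q (pJ p f) f = ip (pJ p (Pc f)) (Pc f).
Proof.
move=> ff; have hf := finsupp_inH ff; have hc := cont_inH hf.
have fp := @polyJ_finsupp R q d r HC V p f ff; have hp := finsupp_inH fp.
have hPf : inH (P f) by apply: proj_inH.
have hPp : inH (P (pJ p f)) by apply: proj_inH.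
have -> : pJ p (Pc f) = pJ p f - P (pJ p f).
  have -> : (Pc f) = f + (-1) *: P f by rewrite scaleN1r.
  by rewrite polyJ_comb scaleN1r -proj_polyJ.
rewrite (Qform_proj hHC ha hd W ophi fp ff).
have e0 : ip (P (pJ p f)) (Pc f) = 0.
  by apply: (ip_eq0_sym hc hPp); exact: (proj_orth_comb hphi ohphi).
apply: esym; apply: (etrans (ipBl hp hPp hc)); rewrite e0 subr0.
by apply: (etrans (ipBr hf hPf hp)); rewrite -(proj_symm hphi hp hf).
Qed.

Lemma cont_le f : inH f -> sqnormH (Pc f) <= 1 * sqnormH f.
Proof.
move=> hf; rewrite mul1r; have hp : inH (P f) by apply: proj_inH.
have hb := inHB hf hp.
have -> : sqnormH f = sqnormH (f - P f) + sqnormH (P f).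
  rewrite -pythagoras // ?subrK //; exact: (proj_orth_comb hphi ohphi).
by rewrite lerDl (sqnormH_ge0 hp).
Qed.

Lemma cvgH_cont (fs : nat -> state) f : (forall k, inH (fs k)) -> inH f -> cvgH fs f ->
  cvgH (fun k => Pc (fs k)) (Pc f).
Proof.
apply: (cvgH_bounded cont_le) => [g hg|g h hg hh]; first exact: cont_inH.
by rewrite (projB hphi hg hh) !opprD !opprK addrACA.
Qed.

Let mA : measurable (A : set RT). Proof. exact: measurable_angles. Qed.

Lemma Rint_vsq_fcoef_le : exists2 K : R, 0 <= K & forall g, finsupp g ->
  Rintegral mu A (fun t => vsqnorm (fcoef g t)) <= K * sqnormH g.
Proof.
have [K K0 hK] := Qform_bounded V hHC ha hd W.
have p0 : 0 < 2 * pi :> R by rewrite mulr_gt0 // pi_gt0.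
exists (2 * pi * K) => [|g fg]; first by rewrite mulr_ge0 // ltW.
have := hK g fg; rewrite (Qformff V hHC ha hd W fg) /=.
by rewrite ler_pdivrMl // mulrA.
Qed.

(** With e = 2^-k, [vsqnorm_diff] is used at s = 1/e: the difference of size 4 e^2 is weighted by 1
    + 1/e and the vector itself by e, so both parts are O(e). The constant collects 4 (e^2 + e) <= 8
    e and the bound 2 (1 + |f|^2) on the approximants. *)
Lemma fcoef_sum_diff f (fs : nat -> state) : inH f -> (forall k, finsupp (fs k)) ->
  (forall k, sqnormH (fs k - f) <= 2 ^- k * 2 ^- k) ->
  exists c : R, forall k,
    Rintegral mu A (fun t => `|vsqnorm (fcoef (fs k.+1) t) - vsqnorm (fcoef (fs k) t)|) <= c * 2 ^- k.
Proof.
move=> hf ffs hfs; have [K K0 hK] := Rint_vsq_fcoef_le.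
have hF k := finsupp_inH (ffs k).
exists (K * (8 + 2 * (1 + sqnormH f))) => k.
set e : R := 2 ^- k; have e0 : 0 < e by rewrite invr_gt0 exprn_gt0.
have e1 : e <= 1 by rewrite invf_le1 ?exprn_gt0 // exprn_ege1 // ler1n.
have fd := finsuppB (ffs k.+1) (ffs k).
have hd1 := inHB (hF k.+1) hf; have hd0 := inHB (hF k) hf.
have le1 : sqnormH (fs k.+1 - fs k) <= 4 * (e * e).
  have -> : fs k.+1 - fs k = (fs k.+1 - f) + - (fs k - f) by rewrite opprB addrA subrK.
  apply: (le_trans (sqnormHD hd1 (@inHN _ _ _ _ hd0))); rewrite (sqnormHN hd0).
  have h1 : sqnormH (fs k.+1 - f) <= e * e.
    apply: (le_trans (hfs k.+1)); rewrite exprSr invfM -/e; exact: half_mul_le.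
  have h0 : sqnormH (fs k - f) <= e * e := hfs k.
  exact: double_add_le.
have le2 : sqnormH (fs k) <= 2 * (1 + sqnormH f).
  have -> : fs k = (fs k - f) + f by rewrite subrK.
  apply: (le_trans (sqnormHD hd0 hf)); rewrite ler_pM2l // lerD2r.
  by apply: (le_trans (hfs k)); apply: mulr_ile1; rewrite ?invr_ge0 ?exprn_ge0.
have r1 := rnice_vsq_fcoef V hHC ha hd fd; have r2 := rnice_vsq_fcoef V hHC ha hd (ffs k).
have r0 := rnice_norm (rniceD (rnice_vsq_fcoef V hHC ha hd (ffs k.+1)) (rniceN r2)).
have r3 := rniceD (rniceM (rnice_cst (1 + e^-1)) r1) (rniceM (rnice_cst e) r2).
apply: (@le_trans _ _ (Rintegral mu A (fun t => (1 + e^-1) * vsqnorm (fcoef (fs k.+1 - fs k) t)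
    + e * vsqnorm (fcoef (fs k) t)))).
  apply: le_Rint => // t At; have := vsqnorm_diff (fcoef (fs k) t) (fcoef (fs k.+1 - fs k) t) (s := e^-1).
  by rewrite invr_gt0 invrK -fcoefD // [fs k + _]addrC subrK; apply.
rewrite RintegralD //; [|exact: rnice_integrable (rniceM (rnice_cst _) _)..]; rewrite !RintZ //.
have I1 := hK _ fd; have I2 := hK _ (ffs k).
have I1' := le_trans I1 (ler_wpM2l K0 le1); have I2' := le_trans I2 (ler_wpM2l K0 le2).
have p1 : 0 <= 1 + e^-1 by rewrite addr_ge0 // invr_ge0 ltW.
apply: (le_trans (lerD (ler_wpM2l p1 I1') (ler_wpM2l (ltW e0) I2'))).
have -> : (1 + e^-1) * (K * (4 * (e * e))) = K * (4 * (e * e + e)) by apply: step_constE; rewrite gt_eqF.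
have h2 : e * e <= e by rewrite ler_piMl // ltW.
have h3 := ler_wpM2l K0 h2.
exact: step_const_le.
Qed.

Lemma density_restrict (v b : RT -> R) (k : R) (B : set RT) :
  (\int[mu]_(t in B) (b t * (k * (v \_ A) t))%:E = \int[mu]_(t in B `&` A) (k * b t * v t)%:E)%E.
Proof.
rewrite integral_mkcondr; apply: eq_integral => t _; rewrite !patchE.
by case: ifP => _; [congr (_%:E); ring | rewrite /point /= !mulr0].
Qed.

Lemma cont_part_Hac f : inH f -> Hac q HC V (Pc f).
Proof.
move=> hf; split; first exact: cont_inH.
have [fs [ffs cfs hfs]] := fast_approx hf.
have [c hc] := fcoef_sum_diff hf ffs hfs.
have [v [mv v0 iv lim]] := L1_limit (fun k => rnice_vsq_fcoef V hHC ha hd (ffs k))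
  (fun k t _ => vsqnorm_ge0 _) hc.
pose X (t : RT) : RT := 2 * a * cos t.
have mX : measurable_fun setT X.
  by apply: measurable_funM => //; apply: continuous_measurable_fun; exact: continuous_cos.
pose k := (2 * pi : R)^-1; have k0 : 0 <= k by rewrite invr_ge0 mulr_ge0 // pi_ge0.
pose w (t : RT) : R := k * (v \_ A) t.
have mvA : measurable_fun setT (v \_ A : RT -> R) by apply: (measurable_restrictT _ mA).1; exact: measurable_funS mv.
have mw : measurable_fun setT w by exact: measurable_funM.
have w0 t : 0 <= w t by apply: mulr_ge0 => //; rewrite patchE; case: ifP.
have iw : mu.-integrable setT (EFin \o w).
  have := integrableZl measurableT k ((integrable_mkcond _ mA).1 iv).
  by rewrite restrict_EFin.
have [m [mE intm]] := push_density mX mw w0 iw.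
have Xle t : `|X t| <= 2 * a by rewrite normrM ger0_norm ?mulr_ge0 ?(ltW ha) // ler_piMr ?mulr_ge0 ?(ltW ha) ?cos_max.
exists m; split; [split; [exists (2 * a)|move=> p]|].
- rewrite mE; last by apply: measurableC; exact: measurable_itv.
  rewrite (_ : X @^-1` _ = set0) ?integral_set0 //; apply/seteqP; split=> t //=; apply.
  by rewrite in_itv /= -ler_norml.
- pose b t := k * p.[X t].
  have rp : rnice (fun t => p.[X t]) := rnice_horner p (rnice_x R q).
  have rb : rnice b := rniceM (rnice_cst k) rp.
  have -> : Rintegral m [set: R] (fun x => p.[x]) = Rintegral mu A (fun t => b t * v t).
    rewrite /Rintegral intm; [|exact: measurable_horner|].
      by rewrite density_restrict setTI.
    by have [K hK] := horner_bounded p (2 * a); exists K => t; exact: hK.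
  (* The moments of the approximants have two limits, one through the densities in L^1 and one
     through strong continuity of p(J) and of the projection; uniqueness equates them. *)
  have l1 := cvgC_real (lim b rb).
  have hF j := finsupp_inH (ffs j); have hcF j := cont_inH (hF j); have hcf := cont_inH hf.
  have cc := cvgH_cont hF hf cfs.
  have l2 := cvgH_ip (fun j => @polyJ_inH _ q _ _ HC V p _ (hcF j)) hcF
    (@polyJ_inH _ q _ _ HC V p _ hcf) hcf (cvgH_polyJ q HC V p hcF hcf cc) cc.
  have mom j : ip (pJ p (Pc (fs j))) (Pc (fs j)) =
      (Rintegral mu A (fun t => b t * vsqnorm (fcoef (fs j) t)))%:C.
    rewrite -(Qform_moment p (ffs j)).
    have := Qform_polyJ V hHC ha hd W p 1 (ffs j).
    rewrite -polyC1 polyJC scale1r => e; apply: (etrans e); congr (_%:C).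
    rewrite -RintZ.
      by apply: eq_Rintegral => t _; rewrite hornerC mulr1 mulrA.
    apply: rniceM (rnice_vsq_fcoef V hHC ha hd (ffs j)); apply: rniceM rp _.
    by under eq_fun do rewrite hornerC; exact: rnice_cst.
  have l2' : ((Rintegral mu A (fun t => b t * vsqnorm (fcoef (fs j) t)))%:C : C^o) @[j --> \oo] -->
      (ip (pJ p (Pc f)) (Pc f) : C^o).
    by apply: cvg_trans l2; apply: near_eq_cvg; apply: nearW => j; exact: mom.
  exact: (cvgC_unique l2' (l1 _)).
- apply/null_content_dominatesP => N mN N0; rewrite mE //.
  have mXN : measurable (X @^-1` N) by rewrite -[X in measurable X]setTI; exact: mX.
  have := density_restrict v (fun=> 1) k (X @^-1` N).
  under eq_integral do rewrite mul1r.
  move=> ->; apply: null_set_integral.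
  + exact: measurableI.
  + apply/measurable_EFinP; apply: measurable_funM => //; exact: measurable_funS mv.
  + rewrite setIC; apply: cos_preimage_null => //; exact: mulr_gt0.
Qed.

End ContinuousPart.


(** The extension by density is automatic for T continuous in norm, since the form then agrees with
    <T f, g> along the approximations. *)
Lemma weak_op_eq_bounded (R : realType) (d r : nat) (T : state R d r -> state R d r)
    (B : state R d r -> state R d r -> R[i]) :
  (forall f, inH f -> inH (T f)) ->
  (forall f fs, inH f -> (forall k, inH (fs k)) -> cvgH fs f -> cvgH (fun k => T (fs k)) (T f)) ->
  (forall f g, finsupp f -> finsupp g -> ip (T f) g = B f g) -> weak_op_eq T B.
Proof.
move=> TH Tc TB; split=> // f g fs gs hf hg ffs fgs cf cg.
have [hfs hgs] := (fun k => finsupp_inH (ffs k), fun k => finsupp_inH (fgs k)).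
have := cvgH_ip (fun k => TH _ (hfs k)) hgs (TH _ hf) hg (Tc _ _ hf hfs cf) cg.
by apply: cvg_trans; apply: near_eq_cvg; apply: nearW => k; exact: TB.
Qed.

(** * The expansion identities *)

Section Expansions.
Variables (R : realType) (q d r : nat).
Variables (HC : 'M[R[i]]_d) (V : 'M[R[i]]_(d, r)).
Hypothesis hHC : HC = HC^t*.
Hypothesis ha : 0 < ahop R q.
Hypothesis hd : (0 < d)%N.
Variable W : R -> {linear 'cV[R[i]]_r -> state R d r}.
Local Notation C := R[i].
Local Notation normc := (@Normc.normc R).
Local Notation mu := (@lebesgue_measure R).
Local Notation state := (state R d r).
Local Notation A := (@angles R).
Local Notation Q := (Qform q HC V W).
Local Notation PsiPsi := (PsiPsi_form q HC V W).

Lemma Hac_orth_Hpp h g : Hac q HC V h -> Hpp q HC V g -> ip h g = 0.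
Proof.
move=> Hh [hg dense]; have hh := Hac_inH Hh.
have [//|ne] := eqVneq (ip h g) 0.
pose x := normc (ip h g) ^+ 2.
have x0 : 0 < x.
  rewrite lt_neqAle sqr_ge0 andbT eq_sym sqrf_eq0; apply: contraNneq ne.
  by move/(@Normc.eq0_normc _ _) => ->.
have s0 := sqnormH_ge0 hh; have s1 : 0 < sqnormH h + 1 by rewrite ltr_wpDl.
(* With this tolerance Cauchy-Schwarz against g minus the combination would give x < x; the added 1
   avoids division by 0. *)
have [n [c [psi [epsi lt]]]] := dense (x / (sqnormH h + 1)) (divr_gt0 x0 s1).
have hpsi k : inH (psi k) by case: (epsi k).
have hcp k : inH (c k *: psi k) := @inHZ _ _ _ (c k) _ (@hpsi k).
have hsum : inH (\sum_k c k *: psi k) by apply: inH_sum.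
have e0 : ip h (\sum_k c k *: psi k) = 0.
  rewrite (ip_sumr _ hcp hh); apply: big1 => k _.
  by rewrite (ipZr (c k) (@hpsi k) hh) (Hac_orth_eigen hHC Hh (epsi k)) mulr0.
have hgs := inHB hg hsum.
have e1 : ip h (g - \sum_k c k *: psi k) = ip h g.
  by apply: (etrans (ipBr hg hsum hh)); rewrite e0 subr0.
have := ip_CS hh hgs; rewrite e1 -/x => le.
rewrite ltr_pdivlMr // in lt.
suff : x < x by rewrite ltxx.
apply: (le_lt_trans le); apply: le_lt_trans lt.
by rewrite mulrDr mulr1 mulrC lerDl (sqnormH_ge0 hgs).
Qed.

Lemma ip_finr_suml n (x : 'I_n -> C) (F : 'I_n -> state) g : finsupp g ->
  ip (\sum_j x j *: F j) g = \sum_j x j * ip (F j) g.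
Proof.
move=> fg; rewrite (big_morph (fun f => ip f g) (id1 := 0) (op1 := +%R)).
- by apply: eq_bigr => j _; rewrite ip_finrZl.
- by move=> f1 f2; rewrite ip_finrDl.
- exact: ip0l.
Qed.

Lemma evec_sum (x : 'cV[C]_r) : x = \sum_c x c 0 *: evec R c.
Proof.
apply/matrixP => i j; rewrite ord1 summxE (bigD1 i) //= !mxE !eqxx mulr1 big1 ?addr0 // => k ki.
by rewrite !mxE eq_sym (negbTE ki) mulr0.
Qed.

Lemma Psi_comb z (x : 'cV[C]_r) : Psi q HC V z x = \sum_c x c 0 *: Psi q HC V z (evec R c).
Proof.
apply: injective_projections; rewrite ?state_sum1 /=.
  rewrite [in LHS](evec_sum x) mulmx_sumr scaler_sumr; apply: eq_bigr => c _.
  by rewrite /= -scalemxAr !scalerA mulrC.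
apply/funext => n; rewrite state_sum2 [in LHS](evec_sum x) mulmx_sumr !scaler_sumr.
rewrite -[LHS]big_split; apply: eq_bigr => c _.
transitivity (x c 0 *: (z ^+ n.+1 *: evec R c + z ^- n.+1 *: (Smx q HC V z *m evec R c))) => //.
by rewrite scalerDr !scalerA -scalemxAr scalerA ![x c 0 * _]mulrC.
Qed.

Lemma Psith_comb t (x : 'cV[C]_r) : Psith q HC V W t x = \sum_c x c 0 *: Psith q HC V W t (evec R c).
Proof.
rewrite /Psith; case: asboolP => _; last exact: Psi_comb.
rewrite [in LHS](evec_sum x) linear_sum.
by apply: eq_bigr => c _; rewrite linearZ.
Qed.

(** Holds at every angle, on [ThetaF] by the linearity of [W t], so the integrand of the weak
    integral is the one of [cont_form] without exceptions. *)
Lemma Psith_fhat t f g : finsupp g ->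
  ip (Psith q HC V W t (fhat q HC V W f t)) g = PsiPsi t f g.
Proof.
move=> fg; rewrite Psith_comb ip_finr_suml //; apply: eq_bigr => c _.
by rewrite mxE.
Qed.

Lemma vsqnorm_fhat t f : finsupp f -> vsqnorm (fhat q HC V W f t) = complex.Re (PsiPsi t f f).
Proof.
move=> ff; rewrite /PsiPsi_form Re_sum; apply: eq_bigr => c _.
rewrite mxE /rank1_form [X in _ * X](ip_finlC _ ff) mulcJ.
by [].
Qed.

Section Basis.
Variables (n : nat) (phi : 'I_n -> state).
Hypothesis ophi : is_onb (Hpp q HC V) phi.

Let hphi j : inH (phi j). Proof. exact: onb_inH ophi j. Qed.
Let ohphi := onb_orth ophi.

Lemma Pac_eq f : inH f -> Pac q HC V f = f - proj phi f.
Proof.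
move=> hf; have hp : inH (proj phi f) by apply: proj_inH.
apply: (orth_proj_eq (@Hac_inH _ _ _ _ HC V)) => //; split; first exact: cont_part_Hac ophi _ hf.
move=> h Hh; have hh := Hac_inH Hh; rewrite opprB addrC subrK.
rewrite (ip_proj _ _ hh) //; apply: big1 => j _.
have Hj : Hpp q HC V (phi j) by case: ophi => H _ _; exact: H.
by rewrite (ip_eq0_sym hh (@hphi j) (Hac_orth_Hpp Hh Hj)) mulr0.
Qed.

Lemma weak_op_eq_Pac : weak_op_eq (Pac q HC V) (cont_form q HC V W).
Proof.
apply: weak_op_eq_bounded => [f hf|f fs hf hfs cf|f g ff fg].
- by rewrite (Pac_eq hf); exact: cont_inH ophi _ hf.
- have := cvgH_cont ophi hfs hf cf; rewrite -(Pac_eq hf).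
  by under eq_fun => k do rewrite -(Pac_eq (hfs k)).
- have [hf hg] := (finsupp_inH ff, finsupp_inH fg); rewrite (Pac_eq hf).
  have hp : inH (proj phi f) by apply: proj_inH.
  apply: (etrans (ipBl hf hp hg)); exact: (esym (Qform_proj hHC ha hd W ophi ff fg)).
Qed.

Lemma weak_op_eq_id : weak_op_eq id
  (fun f g => \sum_j rank1_form (phi j) (phi j) f g + cont_form q HC V W f g).
Proof.
apply: weak_op_eq_bounded => // f g ff fg; have hg := finsupp_inH fg.
rewrite -[cont_form _ _ _ _ _ _]/(Q f g) (Qform_proj hHC ha hd W ophi ff fg) (ip_proj _ _ hg) //.
by rewrite addrC subrK.
Qed.

Lemma sqnormH_Pac f : finsupp f -> (sqnormH (Pac q HC V f))%:C = Q f f.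
Proof.
move=> ff; have hf := finsupp_inH ff; have hc := cont_inH ophi hf.
rewrite (Pac_eq hf) -(ipff hc); have := Qform_moment hHC ha hd W ophi 1 ff.
by rewrite -polyC1 !polyJC !scale1r.
Qed.

Lemma sqnormH_expansion f : finsupp f ->
  sqnormH f = \sum_j normc (ip f (phi j)) ^+ 2 + complex.Re (Q f f).
Proof.
move=> ff; have hf := finsupp_inH ff.
have -> : sqnormH f = complex.Re (ip f f) by rewrite (ipff hf).
have e := Qform_proj hHC ha hd W ophi ff ff.
have -> : ip f f = ip (proj phi f) f + Q f f by rewrite e addrC subrK.
rewrite ReD; congr (_ + _); rewrite (ip_proj _ _ hf) // Re_sum; apply: eq_bigr => j _.
by rewrite (ipC hf (@hphi j)) mulcJ.
Qed.

End Basis.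

Lemma Re_Qform_fhat f : finsupp f ->
  ((complex.Re (Q f f))%:E = ((2 * pi)^-1)%:E *
      \int[mu]_(t in A) (vsqnorm (fhat q HC V W f t))%:E)%E.
Proof.
move=> ff; have [rn _] := nice_PsiPsi V hHC ha hd W ff ff.
under eq_integral do rewrite vsqnorm_fhat //.
rewrite (rnice_EFin_integral rn) -EFinM; congr (_%:E).
by rewrite /Qform /cont_form ReM /= mul0r subr0.
Qed.

End Expansions.

Theorem theorem2p12 (R : realType) (q d r : nat)
    (hq : exists p k : nat, [/\ prime p, (0 < k)%N & q = (p ^ k)%N])
    (hd : (0 < d)%N) (hr : (0 < r)%N)
    (HC : 'M[R[i]]_d) (hHC : HC = HC^t* ) (V : 'M[R[i]]_(d, r))
    (W : R -> {linear 'cV[R[i]]_r -> state R d r}) :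
  (forall t : R, angles t -> ~ ThetaF q HC V t ->
   forall f g : state R d r, finsupp f -> finsupp g ->
   exists Lp Lm : R[i]^o,
     [/\ ip (resolvent q HC V ((2 * ahop R q * cos t) +i* e) f) g
           @[e --> 0^'+] --> Lp,
         ip (resolvent q HC V ((2 * ahop R q * cos t) -i* e) f) g
           @[e --> 0^'+] --> Lm
       & Lp - Lm =
         'i%C / (2 * ahop R q * sin t)%:C * PsiPsi_form q HC V W t f g])
  /\
  (forall f g : state R d r, finsupp f -> finsupp g ->
     Cintegrable (fun t => PsiPsi_form q HC V W t f g))
  /\
  weak_op_eq (Pac q HC V) (cont_form q HC V W)
  /\
  (exists (N : nat) (phi : 'I_N -> state R d r), is_onb (Hpp q HC V) phi)
  /\
  (forall (N : nat) (phi : 'I_N -> state R d r), is_onb (Hpp q HC V) phi ->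
     weak_op_eq id
       (fun f g => \sum_j rank1_form (phi j) (phi j) f g
                   + cont_form q HC V W f g))
  /\
  (forall f g : state R d r, finsupp f -> finsupp g ->
     Cintegrable
       (fun t => ip (Psith q HC V W t (fhat q HC V W f t)) g) /\
     ip (Pac q HC V f) g =
     ((2 * pi)^-1)%:C *
     Cintegral (fun t => ip (Psith q HC V W t (fhat q HC V W f t)) g))
  /\
  (forall f : state R d r, finsupp f ->
     (sqnormH (Pac q HC V f))%:E =
     (((2 * pi)^-1)%:E *
      \int[lebesgue_measure]_(t in @angles R)
        (vsqnorm (fhat q HC V W f t))%:E)%E)
  /\
  (forall (N : nat) (phi : 'I_N -> state R d r), is_onb (Hpp q HC V) phi ->
   forall f : state R d r, finsupp f ->
     (sqnormH f)%:E =
     ((\sum_j Normc.normc (ip f (phi j)) ^+ 2)%:E +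
      ((2 * pi)^-1)%:E *
      \int[lebesgue_measure]_(t in @angles R)
        (vsqnorm (fhat q HC V W f t))%:E)%E).
Proof.
have ha : 0 < ahop R q.
  rewrite sqrtr_gt0 ltr0n; have [p [k [pp _ ->]]] := hq.
  by rewrite expn_gt0 prime_gt0.
have [n0 [phi0 [ob0 _ _]]] := Hpp_onb V hHC ha hd W.
split; last split; last split; last split; last split; last split; last split.
- move=> t At nt f g ff fg.
  have treg := Theta_regular At nt.
  have [Lp [Lq [h1 h2 e]]] := jump_all hHC ha At treg ff fg.
  exists Lp, (Lq^*%C); split; first exact: h1.
    by have := lower_conj hHC ha At ff fg h2; apply.
  by rewrite e PsiPsi_regular.
- by move=> f g ff fg; exact/nice_Cintegrable/nice_PsiPsi.
- exact: (weak_op_eq_Pac hHC ha hd W ob0).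
- by exists n0, phi0.
- by move=> N phi ob; exact: weak_op_eq_id.
- move=> f g ff fg; have e : (fun t => ip (Psith q HC V W t (fhat q HC V W f t)) g) =
      (fun t => PsiPsi_form q HC V W t f g) by apply/funext => t; exact: Psith_fhat.
  rewrite e; split; first exact/nice_Cintegrable/nice_PsiPsi.
  by have [-> //] := weak_op_eq_Pac hHC ha hd W ob0.
- move=> f ff; rewrite -(Re_Qform_fhat V hHC ha hd W ff); congr (_%:E).
  by rewrite -(sqnormH_Pac hHC ha hd W ob0 ff).
- move=> N phi ob f ff; rewrite -(Re_Qform_fhat V hHC ha hd W ff) -EFinD; congr (_%:E).
  exact: (sqnormH_expansion hHC ha hd W ob ff).
Qed.
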